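(* Fix a real number $\gamma$ with $1<\gamma\le\frac53$. Then there exists $s_0$ (depending on $\gamma$) such that for any integer $s\ge s_0$ the following holds. If $n,k$ are positive integers with $n\ge\gamma sk-(\gamma-1)s$, then $$m(n,k,s)\le\binom nk-\frac{\gamma-1}2\cdot\frac{5k-2}{\gamma k-(\gamma-1)}\binom{n-s}k .$$
   Context: $[n]=\{1,\dots,n\}$ and $\binom{[n]}k$ is the family of all $k$-element subsets of $[n]$. For $\mathcal F\subset\binom{[n]}k$, $\nu(\mathcal F)$ denotes the maximum number of pairwise disjoint members of $\mathcal F$. $m(n,k,s)$ is the maximum of $|\mathcal F|$ over all $\mathcal F\subset\binom{[n]}k$ with $\nu(\mathcal F)<s+1$. *)

(* Defs.v *)
From mathcomp Require Import all_boot all_order all_algebra reals.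

Set Implicit Arguments.
Unset Strict Implicit.
Unset Printing Implicit Defensive.

(* The ground set [n] = {1, ..., n} is represented by 'I_n = {0, ..., n-1}. *)

Definition ksets (n k : nat) : {set {set 'I_n}} := [set A : {set 'I_n} | #|A| == k].

Definition matching_number (T : finType) (F : {set {set T}}) : nat :=
  \max_(M : {set {set T}} | (M \subset F) && trivIset M) #|M|.

(* The empty family always qualifies, so the maximum is over a nonempty
   range. *)
Definition max_family (n k s : nat) : nat :=
  \max_(F : {set {set 'I_n}} |
         (F \subset ksets n k) && (matching_number F < s.+1)) #|F|.

(* Main.v *)
(* Two ideas are combined. Let mu(n, s) be the least fraction of the k-subsets of
   [n] missed by a family without s + 1 disjoint members. Counting the members of
   the family in a random t-tuple of disjoint k-sets, the variance being
   nonnegative, gives mu(n, s) >= (1 - 1/t) mu(n - k, s - 1) for t k <= n, and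
   r such steps cost a factor 1 - r/t only. They lead to n' = n - r k and
   s' = s - r with n' >= g s' k - (g - 1) s' for g = 33/20, where the bound of the
   Erdos matching conjecture, C(n', k) - C(n' - s', k), holds once s' is large;
   g < 5/3 leaves room for the rounding.

   For that bound F is taken shifted, and induction on n leaves only the smallest
   n. Split [n] into [0, m) and the rest, and throw disjoint (k-1)-blocks at
   random into the rest: by the spectral gap of the Kneser graph the number of
   blocks that lie in the link of a given point is concentrated, and a greedy
   matching of points with blocks must fail at some point. If the link of the
   point s has density at most 1/4, this is averaged over the blocks, for
   m = s + 1. Otherwise the failures at a critical level m and at m - 1 bound the
   densities of the links, and what remains is an inequality in two real
   variables with a definite slack. *)
Require Import Defs.
From mathcomp Require Import all_boot all_order all_algebra reals.
From mathcomp Require Import zify ring lra.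

Set Implicit Arguments.
Unset Strict Implicit.
Unset Printing Implicit Defensive.

Import Order.TTheory GRing.Theory Num.Theory.

(** * Shifting *)

(** The coefficient of the theorem is n'/n in the extreme case of slope 5/3. Each step (n, s) -> (n
    - k, s - 1) keeps D = n - s k, and D >= (gamma - 1) s (k - 1). Slope 5/3 asks for s' = 3 D / (2
    (k - 1)); for the least D this gives n' = D + s' k = (gamma - 1) s (5 k - 2) / 2, while n = s
    (gamma k - (gamma - 1)), and the quotient is exactly the coefficient. The steps cost a factor
    close to n'/n, so slope 5/3 would leave nothing for integer parts; slope 33/20 gains (gamma - 1)
    s k / 26, which covers them for large s.

    The level s + 1 alone cannot settle the matching bound: with T blocks, the pointwise inequality
    fails once the point s can be joined to more than about T - s of them without deviating from its
    mean. This forces the case of a dense link, where the level is dictated by the family.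

    Probabilities are averages over permutations of the ground set, so all takes place in an ordered
    field. *)

Definition nomatch (T : finType) (s : nat) (F : {set {set T}}) : Prop :=
  forall M : {set {set T}}, M \subset F -> trivIset M -> #|M| <= s.

Lemma nomatchP (T : finType) (s : nat) (F : {set {set T}}) :
  reflect (nomatch s F) (matching_number F < s.+1).
Proof.
rewrite ltnS; apply: (iffP (bigmax_leqP _ _ _)) => h M.
  by move=> MF tM; apply: h; rewrite MF.
by case/andP; apply: h.
Qed.

Lemma nomatch_sub (T : finType) (s : nat) (F G : {set {set T}}) :
  G \subset F -> nomatch s F -> nomatch s G.
Proof. by move=> GF h M MG; apply/h/(subset_trans MG). Qed.

(** Disjoint nonempty values make [f] injective, so a matching may be given as an indexed system. *)
Lemma nomatch_fun (T I : finType) (s : nat) (F : {set {set T}}) (f : I -> {set T}) :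
  nomatch s F -> (forall i, f i \in F) -> (forall i, f i != set0) ->
  (forall i j, i != j -> [disjoint f i & f j]) -> #|I| <= s.
Proof.
move=> h fF fN fD.
have inj : injective f.
  move=> i j eq; apply/eqP/negPn/negP => /fD.
  by rewrite eq -setI_eq0 setIid; apply/negP.
rewrite -(card_imset predT inj); apply: h.
  by apply/subsetP => _ /imsetP[i _ ->].
apply/trivIsetP => _ _ /imsetP[i _ ->] /imsetP[j _ ->] ne.
by apply: fD; apply: contraNneq ne => ->.
Qed.

(** The threshold [lo] restricts the shifts to the points from [lo] on, a property that passes to
    the members contained in a final interval. *)
Definition shifted n (lo : nat) (F : {set {set 'I_n}}) : Prop :=
  forall (A : {set 'I_n}) (i j : 'I_n), A \in F -> lo <= i -> i < j ->
    j \in A -> i \notin A -> i |: (A :\ j) \in F.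

Definition compress n (i j : 'I_n) (F : {set {set 'I_n}}) (A : {set 'I_n}) :=
  if [&& j \in A, i \notin A & i |: (A :\ j) \notin F] then i |: (A :\ j) else A.

Lemma card_swap n (A : {set 'I_n}) (i j : 'I_n) :
  j \in A -> i \notin A -> #|i |: (A :\ j)| = #|A|.
Proof.
move=> jA iA; rewrite cardsU1 [in RHS](cardsD1 j) jA.
by rewrite !inE negb_and (negbTE iA) orbT.
Qed.

Lemma swapK n (A : {set 'I_n}) (i j : 'I_n) :
  j \in A -> i \notin A -> j |: ((i |: (A :\ j)) :\ i) = A.
Proof.
move=> jA iA; apply/setP => x; rewrite !inE.
case: (eqVneq x j) => [->|xj] //=.
by case: (eqVneq x i) => [->|xi] //=; rewrite ?(negbTE iA).
Qed.

Lemma compress_inj n (i j : 'I_n) (F : {set {set 'I_n}}) :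
  {in F &, injective (compress i j F)}.
Proof.
move=> A B AF BF; rewrite /compress.
case: ifP => [/and3P[jA iA nA]|_]; case: ifP => [/and3P[jB iB nB]|_] //.
- by move=> eq; rewrite -(swapK jA iA) eq swapK.
- by move=> eq; rewrite eq BF in nA.
- by move=> eq; rewrite -eq AF in nB.
Qed.

(** Every new set contains [i], so a matching has at most one new member [A'], and no other member
    contains [i]. Exchanging [i] and [j] in all its members turns the matching into one inside
    [F]. *)
Lemma compress_nomatch n (i j : 'I_n) (s : nat) (F : {set {set 'I_n}}) :
  i != j -> set0 \notin F -> nomatch s F -> nomatch s (compress i j F @: F).
Proof.
move=> ij F0 h M MF tM.
have [/h/(_ tM)//|/subsetPn[A' A'M A'F]] := boolP (M \subset F).
have moved B : B \in M -> B \notin F ->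
    exists A, [/\ A \in F, j \in A, i \notin A & B = i |: (A :\ j)].
  move=> BM BF; have /imsetP[A AF def] := subsetP MF _ BM.
  move: def; rewrite /compress; case: ifP => [/and3P[jA iA nA]|_] def.
    by exists A.
  by rewrite def AF in BF.
have [A [AF jA iA defA']] := moved _ A'M A'F.
have iA' : i \in A' by rewrite defA' !inE eqxx.
have jA' : j \notin A' by rewrite defA' !inE eqxx eq_sym (negbTE ij).
have uniq_i B : B \in M -> B != A' -> i \notin B.
  move=> BM BA'; have /trivIsetP/(_ B A' BM A'M BA') := tM.
  by move/disjointFl => /(_ _ iA') ->.
have inF B : B \in M -> B != A' -> B \in F.
  move=> BM BA'; apply/negPn/negP => BF.
  have [C [_ _ _ defB]] := moved _ BM BF.
  by move: (uniq_i _ BM BA'); rewrite defB !inE eqxx.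
have disjM B C : B \in M -> C \in M -> B != C -> [disjoint B & C].
  by move=> BM CM; apply: (trivIsetP tM).
pose sw (B : {set 'I_n}) : {set 'I_n} :=
  [set x | if x == i then j \in B else if x == j then i \in B else x \in B].
have swF (B : {set 'I_n}) : B \in M -> sw B \in F.
  move=> BM; case: (eqVneq B A') => [->|BA'].
    suff -> : sw A' = A by [].
    apply/setP => x; rewrite inE defA' !inE.
    case: (eqVneq x i) => [->|xi]; first by rewrite eqxx eq_sym (negbTE ij) /= (negbTE iA).
    case: (eqVneq x j) => [->|xj]; first by rewrite eqxx /= jA.
    by [].
  have iB := uniq_i _ BM BA'; have BF := inF _ BM BA'.
  case: (boolP (j \in B)) => jB.
    have -> : sw B = i |: (B :\ j).
      apply/setP => x; rewrite !inE.
      case: (eqVneq x i) => [->|xi]; first by rewrite jB.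
      by case: (eqVneq x j) => [->|xj]; rewrite ?(negbTE iB).
    (* [B] is a value of [compress] that contains [j] but not [i], hence was left in place only
       because its shift is already in [F]. *)
    have /imsetP[C CF def] := subsetP MF _ BM.
    move: def; rewrite /compress; case: ifP => [_ def|].
      by move: iB; rewrite def !inE eqxx.
    by move=> + def; rewrite -def jB iB /= => /negbT; rewrite negbK.
  suff -> : sw B = B by [].
  apply/setP => x; rewrite !inE.
  case: (eqVneq x i) => [->|xi]; first by rewrite (negbTE iB) (negbTE jB).
  by case: (eqVneq x j) => [->|xj]; rewrite ?(negbTE iB) ?(negbTE jB).
pose f (B : {B | B \in M}) := sw (val B).
rewrite -(card_sig (mem M)); apply: (nomatch_fun (f := f) h).
- by move=> [B BM]; apply: swF.
- by move=> [B BM]; apply: contraNneq F0 => <-; apply: swF.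
- move=> [B BM] [C CM]; rewrite -val_eqE /= => BC.
  have dBC := disjM _ _ BM CM BC.
  rewrite /f /= -setI_eq0; apply/eqP/setP => x; rewrite !inE.
  case: (eqVneq x i) => _; last case: (eqVneq x j) => _; apply/negP => /andP[xB xC];
    by move: (disjointFr dBC xB); rewrite xC.
Qed.

(** Among the families with the required size and matching number, one that minimises the total sum
    of all elements is shifted: a compression that moves a set lowers this sum. *)
Lemma exists_shifted n k s (F : {set {set 'I_n}}) :
  0 < k -> F \subset ksets n k -> nomatch s F ->
  exists F' : {set {set 'I_n}}, [/\ F' \subset ksets n k, nomatch s F',
    #|F'| = #|F| & shifted 0 F'].
Proof.
move=> k0 Fk Fs.
pose P (G : {set {set 'I_n}}) :=
  [&& G \subset ksets n k, matching_number G < s.+1 & #|G| == #|F|].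
pose wt (A : {set 'I_n}) := \sum_(x in A) (x : nat).
have PF : P F by rewrite /P Fk eqxx andbT; apply/nomatchP.
case: (@arg_minnP _ F P (fun G => \sum_(A in G) wt A) PF) => G.
case/and3P => Gk /nomatchP Gs /eqP GF minG; exists G; split=> // A i j AG _ ij jA iA.
apply/negPn/negP => nG.
have neij : i != j by rewrite -val_eqE /= ltn_eqF.
have inj := @compress_inj _ i j G.
have PG : P (compress i j G @: G).
  apply/and3P; split.
  - apply/subsetP => _ /imsetP[B BG ->]; have := subsetP Gk _ BG.
    by rewrite /compress !inE; case: ifP => // /and3P[jB iB _]; rewrite card_swap.
  - apply/nomatchP/compress_nomatch => //.
    by apply/negP => /(subsetP Gk); rewrite inE cards0 eq_sym -leqn0 leqNgt k0.
  - by rewrite card_in_imset // GF.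
have := minG _ PG; rewrite leqNgt big_imset //=; case/negP.
have wtsw (B : {set 'I_n}) : j \in B -> i \notin B -> wt (i |: (B :\ j)) < wt B.
  move=> jB iB; rewrite /wt big_setU1 /=; last by rewrite !inE negb_and iB orbT.
  by rewrite [X in _ < X](big_setD1 j) //= ltn_add2r.
rewrite (big_setD1 A AG) [X in _ < X](big_setD1 A AG) /= -addSn leq_add //.
  by rewrite /compress jA iA nG /= wtsw.
apply: leq_sum => B _; rewrite /compress; case: ifP => // /and3P[jB iB _].
by rewrite ltnW ?wtsw.
Qed.

(** * Links and shadows of shifted families *)

Definition draws (T : finType) (D : {set T}) (k : nat) : {set {set T}} :=
  [set A : {set T} | (A \subset D) && (#|A| == k)].

Lemma drawsP (T : finType) (D : {set T}) k (A : {set T}) :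
  A \in draws D k -> A \subset D /\ #|A| = k.
Proof. by rewrite inE => /andP[? /eqP]. Qed.

Definition iv n (lo hi : nat) : {set 'I_n} := [set x : 'I_n | lo <= x < hi].

Lemma card_iv n lo hi : hi <= n -> #|iv n lo hi| = hi - lo.
Proof.
elim: hi => [_|hi IH hn].
  by apply/eqP; rewrite cards_eq0; apply/eqP/setP => x; rewrite !inE ltn0 andbF.
have [hl|lh] := ltnP hi lo.
  rewrite (eqP (hl : hi.+1 - lo == 0)); apply/eqP; rewrite cards_eq0.
  by apply/eqP/setP => x; rewrite !inE; apply/negP => /andP[]; lia.
have -> : iv n lo hi.+1 = Ordinal hn |: iv n lo hi.
  by apply/setP => x; rewrite !inE -val_eqE /= ; lia.
by rewrite cardsU1 !inE ltnn andbF IH ?subSn // ltnW.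
Qed.

Lemma iv_all n : iv n 0 n = setT.
Proof. by apply/setP => x; rewrite !inE ltn_ord. Qed.

Definition link (T : finType) (x : T) (F : {set {set T}}) : {set {set T}} :=
  [set A : {set T} | (x \notin A) && (x |: A \in F)].

Definition avoid (T : finType) (x : T) (F : {set {set T}}) : {set {set T}} :=
  [set A in F | x \notin A].

Definition shadow (T : finType) (F : {set {set T}}) : {set {set T}} :=
  [set B : {set T} | [exists x, B \in link x F]].

Lemma card_avoid_link (T : finType) (x : T) (F : {set {set T}}) :
  #|F| = #|avoid x F| + #|link x F|.
Proof.
rewrite -(cardsID [set A : {set T} | x \notin A] F); congr addn.
  by apply: eq_card => A; rewrite !inE.
rewrite -(card_in_imset (f := fun A => x |: A) (D := link x F)).
  apply: eq_card => A; apply/setDP/imsetP => [[AF]|[B]].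
    rewrite inE negbK => xA; exists (A :\ x); last by rewrite setD1K.
    by rewrite inE setD1K // !inE eqxx.
  move=> BL ->; move: BL; rewrite [B \in _]inE => /andP[xB BF].
  by split; rewrite // inE negbK !inE eqxx.
move=> A B; rewrite inE => /andP[xA _]; rewrite inE => /andP[xB _] eq.
by rewrite -(setU1K xA) eq setU1K.
Qed.

Lemma card_dep (T U : finType) (A : {set T}) (f : T -> {set U}) :
  #|[set p : T * U | (p.1 \in A) && (p.2 \in f p.1)]| = \sum_(a in A) #|f a|.
Proof.
under eq_bigr do rewrite -sum1_card.
by rewrite pair_big_dep /= -sum1_card; apply: eq_bigl => -[a b]; rewrite inE.
Qed.

(** If s + 1 disjoint sets lay in the link of the last point, the interval would still have room for
    s + 1 distinct points outside their union; by shiftedness these replace the last point, one for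
    each set, and yield s + 1 disjoint members of [F]. *)
Lemma link_nomatch n lo hi k s (F : {set {set 'I_n}}) (t : 'I_n) :
  t = hi :> nat -> F \subset draws (iv n lo hi.+1) k.+1 -> shifted lo F ->
  nomatch s F -> k.+1 * s.+1 <= hi.+1 - lo -> nomatch s (link t F).
Proof.
move=> th Fd Fsh Fs big M ML tM; rewrite leqNgt; apply/negP => /card_geqP[q [qu qs qM]].
pose f (i : 'I_s.+1) := nth set0 q i.
have fM i : f i \in M by apply/qM/mem_nth; rewrite qs.
have fD i j : i != j -> [disjoint f i & f j].
  move=> ij; apply: (trivIsetP tM) => //.
  by rewrite /f nth_uniq ?qs.
have fL i : (t \notin f i) && (t |: f i \in F).
  by have := subsetP ML _ (fM i); rewrite inE.
have fk i : #|f i| = k.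
  case/andP: (fL i) => tf /(subsetP Fd)/drawsP[_]; rewrite cardsU1 tf => /eqP.
  by rewrite eqSS => /eqP.
pose U := \bigcup_i f i; pose W := iv n lo hi.+1 :\: U.
have Wc : s.+1 <= #|W|.
  have cU : #|U| <= k * s.+1.
    apply: leq_trans (_ : \sum_(i < s.+1) #|f i| <= _).
      rewrite /U; elim/big_rec2: _ => [|i a B _ h]; first by rewrite cards0.
      by apply: leq_trans (leq_card_setU _ _) _; rewrite leq_add2l.
    by under eq_bigr do rewrite fk; rewrite sum_nat_const card_ord mulnC.
  have cI : #|iv n lo hi.+1| = hi.+1 - lo by rewrite card_iv // -th.
  have cIU := leq_trans (subset_leq_card (subsetIr (iv n lo hi.+1) U)) cU.
  rewrite /W cardsD cI leq_subRL; last by apply: leq_trans cIU _; apply: leq_trans big; rewrite leq_mul2r leqnSn orbT.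
  by apply: leq_trans big; rewrite mulSn addnC leq_add2l.
have [z0 z0W] : exists z, z \in W.
  by apply/set0Pn; rewrite -card_gt0; apply: leq_trans Wc.
pose w (i : 'I_s.+1) := nth z0 (enum W) i.
have wW i : w i \in W.
  by rewrite -mem_enum; apply: mem_nth; rewrite -cardE; apply: leq_trans Wc.
have winj i j : i != j -> w i != w j.
  by move=> ij; rewrite /w nth_uniq ?enum_uniq // -cardE; apply: leq_trans Wc.
have wf i j : w i \notin f j.
  have := wW i; rewrite inE => /andP[nU _]; apply: contra nU => h.
  by apply/bigcupP; exists j.
have := @nomatch_fun _ _ _ _ (fun i => w i |: f i) Fs _ _ _.
rewrite card_ord ltnn => /(_ _ _ _)/negP; apply=> //.
- move=> i; case/andP: (fL i) => tf tF.
  have := wW i; rewrite !inE => /andP[_ /andP[lw wh]].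
  case: (eqVneq (w i) t) => [->//|wt].
  have -> : w i |: f i = w i |: ((t |: f i) :\ t) by rewrite setU1K.
  apply: Fsh => //; rewrite ?inE ?eqxx // ?negb_or ?wt ?wf //.
  by move: wh; rewrite ltnS leq_eqVlt -th => /orP[/eqP/val_inj e|//]; rewrite e eqxx in wt.
- by move=> i; apply/set0Pn; exists (w i); rewrite !inE eqxx.
- move=> i j ij; rewrite -setI_eq0; apply/eqP/setP => x; rewrite !inE.
  apply/negP => /andP[/orP[/eqP->|xi] /orP[/eqP e|xj]].
  + by have := winj _ _ ij; rewrite e eqxx.
  + by rewrite (negbTE (wf i j)) in xj.
  + by rewrite e (negbTE (wf j i)) in xi.
  + by have := disjointFr (fD _ _ ij) xi; rewrite xj.
Qed.

Lemma link_draws n lo hi k (F : {set {set 'I_n}}) (t : 'I_n) : t = hi :> nat ->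
  F \subset draws (iv n lo hi.+1) k.+1 -> link t F \subset draws (iv n lo hi) k.
Proof.
move=> th Fd; apply/subsetP => A; rewrite inE => /andP[tA /(subsetP Fd)/drawsP[sA cA]].
rewrite inE; apply/andP; split; last by move: cA; rewrite cardsU1 tA => /eqP.
apply/subsetP => x xA; have := subsetP sA x; rewrite !inE xA orbT => /(_ isT).
case/andP => -> /=; rewrite ltnS leq_eqVlt => /orP[/eqP e|//].
by case/negP: tA; rewrite (_ : t = x) //; apply: val_inj; rewrite /= th.
Qed.

Lemma avoid_draws n lo hi k (F : {set {set 'I_n}}) (t : 'I_n) : t = hi :> nat ->
  F \subset draws (iv n lo hi.+1) k -> avoid t F \subset draws (iv n lo hi) k.
Proof.
move=> th Fd; apply/subsetP => A; rewrite inE => /andP[/(subsetP Fd)/drawsP[sA cA] tA].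
rewrite inE cA eqxx andbT; apply/subsetP => x xA.
have := subsetP sA x xA; rewrite !inE.
case/andP => -> /=; rewrite ltnS leq_eqVlt => /orP[/eqP e|//].
by case/negP: tA; rewrite (_ : t = x) //; apply: val_inj; rewrite /= th.
Qed.

Lemma link_shifted n lo hi k (F : {set {set 'I_n}}) (t : 'I_n) : t = hi :> nat ->
  F \subset draws (iv n lo hi.+1) k -> shifted lo F -> shifted lo (link t F).
Proof.
move=> th Fd Fsh A i j; rewrite !inE => /andP[tA AF] li ij jA iA.
have jt : j != t by apply: contraTneq jA => ->.
have jlt : (j < t)%N.
  have [sA _] := drawsP (subsetP Fd _ AF).
  have := subsetP sA j; rewrite !inE jA orbT => /(_ isT)/andP[_].
  rewrite ltnS leq_eqVlt th => /orP[/eqP e|//].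
  by case/eqP: jt; apply: val_inj; rewrite /= th.
have it : i != t by rewrite -val_eqE /= ltn_eqF // (ltn_trans ij).
have -> : t |: (i |: A :\ j) = i |: ((t |: A) :\ j).
  apply/setP => x; rewrite !inE; case: (eqVneq x t) => [->|//].
  by rewrite [t == j]eq_sym jt orbT.
rewrite negb_or [t == i]eq_sym it negb_and tA orbT /=.
by apply: Fsh; rewrite // !inE ?jA ?orbT // negb_or it.
Qed.

Lemma avoid_shifted n lo hi k (F : {set {set 'I_n}}) (t : 'I_n) : t = hi :> nat ->
  F \subset draws (iv n lo hi.+1) k -> shifted lo F -> shifted lo (avoid t F).
Proof.
move=> th Fd Fsh A i j AA; have := AA; rewrite !inE => /andP[AF tA] li ij jA iA.
rewrite Fsh //=; have jlt : (j < t)%N.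
  have [sA _] := drawsP (subsetP (avoid_draws th Fd) A AA).
  by have := subsetP sA _ jA; rewrite inE th => /andP[].
by rewrite (negbTE tA) andbF orbF eq_sym -val_eqE /= ltn_eqF // (ltn_trans ij).
Qed.

Lemma singletons_le (T : finType) s (D : {set T}) (F : {set {set T}}) :
  F \subset draws D 1 -> nomatch s F -> (#|F| <= s)%N.
Proof.
move=> Fd; apply=> //; apply/trivIsetP => B C BF CF.
have [_ /eqP/cards1P[x ->]] := drawsP (subsetP Fd _ BF).
have [_ /eqP/cards1P[y ->]] := drawsP (subsetP Fd _ CF).
by move=> ne; rewrite disjoints1 inE; apply: contraNneq ne => ->.
Qed.

(** Frankl's inequality. With fewer than (k + 1)(s + 1) points, a set of the shadow has at most (k +
    1) s extensions, and double counting suffices. With more points, the link of the last point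
    inherits the matching condition, and the shadows of the two parts of [F] embed into the
    corresponding parts of the shadow of [F]. *)
Lemma shadow_bound n lo hi k s (F : {set {set 'I_n}}) :
  F \subset draws (iv n lo hi) k.+1 -> shifted lo F -> nomatch s F ->
  #|F| <= s * #|shadow F|.
Proof.
elim: hi k F => [|hi IH] k F Fd Fsh Fs.
  have -> : F = set0.
    apply/eqP; rewrite -subset0; apply/subsetP => A /(subsetP Fd)/drawsP[sA cA].
    suff : A = set0 by move=> A0; rewrite A0 cards0 in cA.
    apply/eqP; rewrite -subset0; apply: subset_trans sA _.
    by apply/subsetP => x; rewrite !inE ltn0 andbF.
  by rewrite cards0.
case: (leqP n hi) => [nh|hn].
  apply: (IH k) => //; apply: subset_trans Fd _; apply/subsetP => A; rewrite !inE.
  case/andP => sA ->; rewrite andbT; apply: subset_trans sA _.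
  apply/subsetP => x; rewrite !inE => /andP[-> _] /=.
  exact: leq_trans (ltn_ord x) nh.
pose t := Ordinal hn.
case: (ltnP (hi.+1 - lo) (k.+1 * s.+1)) => [small|big].
  have cI : #|iv n lo hi.+1| = hi.+1 - lo by rewrite card_iv.
  pose P := [set p : {set 'I_n} * 'I_n | (p.1 \in F) && (p.2 \in p.1)].
  pose Q := [set p : {set 'I_n} * 'I_n | (p.1 \in shadow F) && (p.2 \in iv n lo hi.+1 :\: p.1)].
  have cP : #|P| = #|F| * k.+1.
    rewrite (card_dep F id) -sum_nat_const; apply: eq_bigr => A /(subsetP Fd).
    by case/drawsP.
  have cQ : #|Q| <= #|shadow F| * (k.+1 * s).
    rewrite (card_dep (shadow F) (fun B => iv n lo hi.+1 :\: B)) -sum_nat_const.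
    apply: leq_sum => B; rewrite inE => /existsP[x]; rewrite inE => /andP[xB BF].
    have [sB cB] := drawsP (subsetP Fd _ BF).
    have BI : B \subset iv n lo hi.+1 by apply: subset_trans sB; apply: subsetUr.
    move: cB; rewrite cardsU1 xB cardsD (setIidPr BI) cI.
    move: small; rewrite mulnS mulSn; lia.
  have : #|P| <= #|Q|.
    rewrite -(card_in_imset (f := fun p => (p.1 :\ p.2, p.2)) (D := P)).
      apply/subset_leq_card/subsetP => z /imsetP[[A x]]; rewrite inE /= => /andP[AF xA] ->{z}.
      have [sA _] := drawsP (subsetP Fd _ AF).
      have := subsetP sA _ xA; rewrite inE => xI; rewrite !inE eqxx /= xI andbT.
      by apply/existsP; exists x; rewrite inE !inE eqxx setD1K.
    move=> [A x] [B y]; rewrite !inE /= => /andP[_ xA] /andP[_ yB] [e xy].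
    by rewrite -(setD1K xA) e xy setD1K.
  rewrite cP => /leq_trans/(_ cQ).
  by rewrite mulnCA (mulnC #|F|) leq_pmul2l // mulnC.
have tE : t = hi :> nat by [].
have Lsh := link_shifted tE Fd Fsh.
have Ld := link_draws tE Fd.
have Ls : nomatch s (link t F) by apply: (link_nomatch (lo := lo) (hi := hi) (k := k)).
case: k => [|k] in Fd big Ld *.
  have [->|[A AF]] := set_0Vmem F; first by rewrite cards0.
  have sh0 : 0 < #|shadow F|.
    rewrite card_gt0; apply/set0Pn; exists set0; rewrite inE.
    have [_ /eqP/cards1P[x Ax]] := drawsP (subsetP Fd _ AF).
    by apply/existsP; exists x; rewrite !inE setU0 -Ax AF.
  apply: leq_trans (_ : s <= _); last by rewrite leq_pmulr.
  exact: singletons_le Fd Fs.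
have Ad := avoid_draws tE Fd.
have Ash := avoid_shifted tE Fd Fsh.
have As : nomatch s (avoid t F) by apply: nomatch_sub Fs; apply/subsetP => A; rewrite inE => /andP[].
rewrite (card_avoid_link t).
apply: leq_trans (leq_add (IH _ _ Ad Ash As) (IH _ _ Ld Lsh Ls)) _.
rewrite -mulnDr leq_mul2l (card_avoid_link t (shadow F)); apply/orP; right.
apply: leq_add; apply/subset_leq_card/subsetP => B; rewrite !inE.
- case/existsP => x; rewrite !inE => /andP[xB /andP[BF]]; rewrite negb_or => /andP[tx ->].
  by rewrite andbT; apply/existsP; exists x; rewrite inE xB.
- case/existsP => x; rewrite !inE => /andP[xB /andP[]]; rewrite negb_or => /andP[tx tB] BF.
  rewrite tB /=; apply/existsP; exists x; rewrite !inE negb_or eq_sym tx xB /=.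
  by rewrite setUCA.
Qed.

(** * Disjoint pairs in the Kneser graph *)

Local Open Scope ring_scope.

Definition ip (X : finType) (R : realFieldType) (l : nat) (f g : {set X} -> R) : R :=
  \sum_(A in draws [set: X] l) f A * g A.

Definition kneser (X : finType) (R : realFieldType) (l : nat) (f : {set X} -> R)
    (A : {set X}) : R :=
  \sum_(B in draws [set: X] l | [disjoint A & B]) f B.

Definition incl (X : finType) (R : realFieldType) (Z A : {set X}) : R := (Z \subset A)%:R.

(** On the [l]-subsets, the functions of degree below [i]. This filtration stands in for the
    eigenspaces of the Johnson scheme. *)
Definition low (X : finType) (R : realFieldType) (l i : nat) (f : {set X} -> R) : Prop :=
  exists c : {set X} -> R, forall A, A \in draws [set: X] l ->
    f A = \sum_(Z : {set X} | (#|Z| < i)%N) c Z * incl R Z A.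

Lemma low_eq (X : finType) (R : realFieldType) l i (f g : {set X} -> R) :
  (forall A, A \in draws [set: X] l -> f A = g A) -> low l i f -> low l i g.
Proof. by move=> fg [c fc]; exists c => A AS; rewrite -fg // fc. Qed.

Lemma low_lin (X : finType) (R : realFieldType) l i a (f g : {set X} -> R) :
  low l i f -> low l i g -> low l i (fun A => f A + a * g A).
Proof.
move=> [c fc] [d gd]; exists (fun Z => c Z + a * d Z) => A AS.
rewrite fc // gd // mulr_sumr -big_split /=; apply: eq_bigr => Z _; ring.
Qed.

Lemma low_incl (X : finType) (R : realFieldType) l i (Z : {set X}) :
  (#|Z| < i)%N -> low l i (incl R Z).
Proof.
move=> Zi; exists (fun W => (W == Z)%:R) => A _.
rewrite (bigD1 Z) //= eqxx mul1r big1 ?addr0 // => W /andP[_ /negbTE ->].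
by rewrite mul0r.
Qed.

Lemma low_sum (X : finType) (R : realFieldType) l i (I : Type) (r : seq I) (P : pred I)
    (a : I -> R) (f : I -> {set X} -> R) :
  (forall j, P j -> low l i (f j)) ->
  low l i (fun A => \sum_(j <- r | P j) a j * f j A).
Proof.
move=> h; elim: r => [|j r IH].
  by exists (fun=> 0) => A _; rewrite big_nil big1 // => Z _; rewrite mul0r.
case Pj: (P j); last by apply: low_eq IH => A _; rewrite big_cons Pj.
by apply: low_eq (low_lin (a j) IH (h _ Pj)) => A _; rewrite big_cons Pj addrC.
Qed.

Lemma low_mono (X : finType) (R : realFieldType) l i j (f : {set X} -> R) :
  (i <= j)%N -> low l i f -> low l j f.
Proof.
move=> ij [c fc]; apply: low_eq (_ : low l j (fun A => \sum_(Z : {set X} | (#|Z| < i)%N) c Z * incl R Z A)).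
  by move=> A AS; rewrite fc.
by apply: low_sum => Z Zi; apply/low_incl/(leq_trans Zi).
Qed.

(* inclusion-exclusion, modulo functions of lower degree *)
Lemma low_disjoint (X : finType) (R : realFieldType) l m (Z : {set X}) : #|Z| = m ->
  low l m (fun A => ([disjoint Z & A])%:R + - (-1) ^+ m * incl R Z A).
Proof.
elim: m Z => [|m IH] Z cZ.
  move/eqP: cZ; rewrite cards_eq0 => /eqP ->; exists (fun=> 0) => A _.
  by rewrite /incl sub0set -setI_eq0 set0I eqxx big1 ?expr0 => [|Y _]; ring.
have /card_gt0P[x xZ] : (0 < #|Z|)%N by rewrite cZ.
have cZ' : #|Z :\ x| = m by move: cZ; rewrite (cardsD1 x) xZ => -[].
have [c IHc] := IH _ cZ'.
have l1 := low_mono (leqnSn m) (IH _ cZ').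
have l2 : low l m.+1 (fun A => \sum_(Y : {set X} | (#|Y| < m)%N) c Y * incl R (x |: Y) A).
  by apply: low_sum => Y Ym; apply: low_incl; rewrite cardsU1; apply: leq_ltn_trans (_ : 1 + #|Y| < _)%N; rewrite ?leq_add2r ?leq_b1.
have l3 : low l m.+1 (incl R (Z :\ x)) by apply: low_incl; rewrite cZ'.
apply: low_eq (low_lin ((-1) ^+ m) (low_lin (-1) l1 l2) l3) => A AS.
have -> : \sum_(Y : {set X} | (#|Y| < m)%N) c Y * incl R (x |: Y) A =
    (x \in A)%:R * \sum_(Y : {set X} | (#|Y| < m)%N) c Y * incl R Y A.
  rewrite mulr_sumr; apply: eq_bigr => Y _.
  by rewrite /incl subUset sub1set; case: (x \in A); rewrite /= ?mul1r ?mul0r ?mulr0.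
rewrite -IHc // exprS.
have -> : incl R Z A = (x \in A)%:R * incl R (Z :\ x) A.
  by rewrite /incl -{1}(setD1K xZ) subUset sub1set; case: (x \in A); rewrite /= ?mul1r ?mul0r.
have -> : [disjoint Z & A] = (x \notin A) && [disjoint Z :\ x & A].
  by rewrite -{1}(setD1K xZ) !disjoints_subset subUset sub1set inE.
case: (x \in A) => /=; ring.
Qed.

(** When [Z] misses [A], the sets counted are [Z] together with any l - |Z| points outside both. *)
Lemma kneser_incl (X : finType) (R : realFieldType) l (Z A : {set X}) :
  A \in draws [set: X] l -> (#|Z| <= l)%N ->
  kneser l (incl R Z) A = 'C(#|X| - l - #|Z|, l - #|Z|)%:R * [disjoint Z & A]%:R.
Proof.
move=> /drawsP[_ cA] Zl.
have -> : kneser l (incl R Z) A =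
    #|[set B in draws [set: X] l | [disjoint A & B] & Z \subset B]|%:R.
  rewrite /kneser -sum1_card natr_sum [RHS]big_mkcond [LHS]big_mkcond /=.
  apply: eq_bigr => B _; rewrite !inE subsetT /incl.
  by case: (#|B| == l); case: [disjoint A & B]; case: (Z \subset B).
have [dZA|] := boolP [disjoint Z & A]; last first.
  move=> ndZA; rewrite mulr0; apply/eqP; rewrite pnatr_eq0 cards_eq0.
  apply/eqP/setP => B; rewrite !inE; apply/negP => /and3P[_ dAB ZB].
  by case/negP: ndZA; rewrite disjoint_sym; apply: disjointWr dAB.
rewrite mulr1; apply/eqP; rewrite eqr_nat; apply/eqP.
have cAZ : #|~: (A :|: Z)| = (#|X| - l - #|Z|)%N.
  rewrite cardsCs setCK cardsU (_ : A :&: Z = set0) ?cards0 ?subn0 ?cA ?subnDA //.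
  by apply/eqP; rewrite setI_eq0 disjoint_sym.
have := cards_draws (~: (A :|: Z)) (l - #|Z|)%N; rewrite cAZ => <-.
rewrite -(card_in_imset (f := fun B => Z :|: B)).
  apply: eq_card => B; apply/idP/imsetP => [|[C]].
    rewrite !inE subsetT => /and3P[/eqP cB dAB ZB]; exists (B :\: Z); last by rewrite setDE setUIr setUCr setIT (setUidPr ZB).
    rewrite inE cardsD (setIidPr ZB) cB eqxx andbT setCU subsetI.
    apply/andP; split; last by rewrite setDE subsetIr.
    by rewrite subsetC; apply: subset_trans (_ : ~: B \subset _); [rewrite -disjoints_subset | rewrite setCS subsetDl].
  case/drawsP; rewrite setCU subsetI => /andP[CA CZ] cC ->.
  have ZC : Z :&: C = set0 by apply/eqP; rewrite setI_eq0 disjoint_sym disjoints_subset.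
  rewrite !inE subsetT cardsU ZC cards0 subn0 cC subnKC // eqxx subsetUl andbT /=.
  by rewrite disjoints_subset setCU subsetI -[A \subset ~: Z]disjoints_subset [[disjoint A & Z]]disjoint_sym dZA subsetC CA.
move=> B C /drawsP[]; rewrite setCU subsetI => /andP[_ BZ] _ /drawsP[].
rewrite subsetI => /andP[_ CZ] _ eq.
have rec (D : {set X}) : D \subset ~: Z -> (Z :|: D) :\: Z = D.
  by move=> DZ; rewrite setDUl setDv set0U setDE; apply/setIidPl.
by rewrite -(rec _ BZ) eq rec.
Qed.

Lemma ipC (X : finType) (R : realFieldType) l (f g : {set X} -> R) : ip l f g = ip l g f.
Proof. by apply: eq_bigr => A _; rewrite mulrC. Qed.

Lemma ip_lin (X : finType) (R : realFieldType) l a (f g h : {set X} -> R) :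
  ip l (fun A => f A + a * g A) h = ip l f h + a * ip l g h.
Proof. by rewrite /ip mulr_sumr -big_split /=; apply: eq_bigr => A _; ring. Qed.

Lemma ip_linr (X : finType) (R : realFieldType) l a (f g h : {set X} -> R) :
  ip l h (fun A => f A + a * g A) = ip l h f + a * ip l h g.
Proof. by rewrite ipC ip_lin !(ipC _ h). Qed.

Lemma ip_eql (X : finType) (R : realFieldType) l (f g h : {set X} -> R) :
  (forall A, A \in draws [set: X] l -> f A = g A) -> ip l f h = ip l g h.
Proof. by move=> fg; apply: eq_bigr => A AS; rewrite fg. Qed.

Lemma ip_eqr (X : finType) (R : realFieldType) l (f g h : {set X} -> R) :
  (forall A, A \in draws [set: X] l -> f A = g A) -> ip l h f = ip l h g.
Proof. by move=> fg; apply: eq_bigr => A AS; rewrite fg. Qed.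

Lemma ip_ge0 (X : finType) (R : realFieldType) l (f : {set X} -> R) : 0 <= ip l f f.
Proof. by apply: sumr_ge0 => A _; rewrite -expr2 sqr_ge0. Qed.

Lemma ip_eq0 (X : finType) (R : realFieldType) l (f : {set X} -> R) :
  ip l f f = 0 -> forall A, A \in draws [set: X] l -> f A = 0.
Proof.
move=> /psumr_eq0P h A AS; apply/eqP; rewrite -sqrf_eq0 expr2 h //.
by move=> B _; rewrite -expr2 sqr_ge0.
Qed.

Lemma kneser_lin (X : finType) (R : realFieldType) l a (f g : {set X} -> R) A :
  kneser l (fun A => f A + a * g A) A = kneser l f A + a * kneser l g A.
Proof. by rewrite /kneser mulr_sumr -big_split. Qed.

Lemma kneser_eq (X : finType) (R : realFieldType) l (f g : {set X} -> R) A :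
  (forall A, A \in draws [set: X] l -> f A = g A) -> kneser l f A = kneser l g A.
Proof. by move=> fg; apply: eq_bigr => B /andP[BS _]; rewrite fg. Qed.

Lemma kneser_sym (X : finType) (R : realFieldType) l (f g : {set X} -> R) :
  ip l f (kneser l g) = ip l (kneser l f) g.
Proof.
rewrite /ip /kneser.
under eq_bigr do rewrite mulr_sumr.
under [RHS]eq_bigr do rewrite mulr_suml.
rewrite [RHS](exchange_big_dep (fun B => B \in draws [set: X] l)) /=; last by move=> ? ? _ /andP[].
apply: eq_bigr => A AS; apply: eq_bigl => B.
by rewrite AS disjoint_sym.
Qed.

Lemma kneser_sum (X : finType) (R : realFieldType) l (I : Type) (r : seq I) (P : pred I)
    (a : I -> R) (f : I -> {set X} -> R) A :
  kneser l (fun A => \sum_(j <- r | P j) a j * f j A) A =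
  \sum_(j <- r | P j) a j * kneser l (f j) A.
Proof.
rewrite /kneser exchange_big /=; apply: eq_bigr => j _.
by rewrite mulr_sumr.
Qed.

(* The Kneser operator is triangular for the filtration by degree, with the
   eigenvalue (-1)^i C(|X|-l-i, l-i) on the i-th quotient. *)
Lemma kneser_low_quot (X : finType) (R : realFieldType) l i (f : {set X} -> R) :
  (i <= l)%N -> low l i.+1 f ->
  low l i (fun A => kneser l f A + - ((-1) ^+ i * 'C(#|X| - l - i, l - i)%:R) * f A).
Proof.
move=> il [c fc].
pose lam := (-1) ^+ i * ('C(#|X| - l - i, l - i)%:R : R).
apply: low_eq (_ : low l i (fun A => \sum_(Z : {set X} | (#|Z| < i.+1)%N)
    c Z * (kneser l (incl R Z) A + - lam * incl R Z A))).
  move=> A AS; rewrite (kneser_eq A fc) kneser_sum fc // mulr_sumr -big_split /=.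
  by apply: eq_bigr => Z _; rewrite /lam; ring.
apply: low_sum => Z Zi.
have Zl : (#|Z| <= l)%N by apply: leq_trans il.
have dl := low_disjoint R l (erefl #|Z|).
have e : forall A, A \in draws [set: X] l ->
  kneser l (incl R Z) A = 'C(#|X| - l - #|Z|, l - #|Z|)%:R * [disjoint Z & A]%:R.
  by move=> A AS; apply: kneser_incl.
move: Zi; rewrite ltnS leq_eqVlt => /orP[/eqP Zi|Zi].
  have [d dE] := dl.
  exists (fun Y => 'C(#|X| - l - #|Z|, l - #|Z|)%:R * d Y) => A AS.
  rewrite e // -Zi; under eq_bigr do rewrite -mulrA.
  by rewrite -mulr_sumr -dE // /lam Zi; ring.
have l1 : low l i (incl R Z) by apply: low_incl.
have l0 : low l i (fun _ : {set X} => 0 : R) by exists (fun=> 0) => A _; rewrite big1 // => Y _; rewrite mul0r.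
have l2 := low_lin ((-1) ^+ #|Z|) (low_mono (ltnW Zi) dl) l1.
apply: low_eq (low_lin (- lam) (low_lin ('C(#|X| - l - #|Z|, l - #|Z|)%:R) l0 l2) l1) => A AS.
by rewrite e //; ring.
Qed.

Lemma kneser_low (X : finType) (R : realFieldType) l i (f : {set X} -> R) :
  (i <= l.+1)%N -> low l i f -> low l i (kneser l f).
Proof.
case: i => [_ [c fc]|i il fi].
  exists (fun=> 0) => A AS; rewrite /kneser !big1 // => B /andP[BS _].
  by rewrite fc // big1.
have q := low_mono (leqnSn i) (kneser_low_quot (il : (i <= l)%N) fi).
by apply: low_eq (low_lin ((-1) ^+ i * 'C(#|X| - l - i, l - i)%:R) q fi) => A _; ring.
Qed.

(** Gram-Schmidt, without independence of the functions [incl R Z]: if the part of [incl R W]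
    orthogonal to the earlier ones has norm 0, it vanishes on all [l]-sets, and the quotient by 0 is
    harmless. *)
Lemma orth_proj (X : finType) (R : realFieldType) l (r : seq {set X}) (f : {set X} -> R) :
  uniq r -> exists c : {set X} -> R, forall Z, Z \in r ->
    ip l (fun A => f A + (-1) * \sum_(Y <- r) c Y * incl R Y A) (incl R Z) = 0.
Proof.
elim: r f => [|W r IH] f; first by exists (fun=> 0).
move=> /= /andP[Wr ru].
have [c cE] := IH f ru; have [d dE] := IH (incl R W) ru.
pose f' A := f A + (-1) * \sum_(Y <- r) c Y * incl R Y A.
pose w' A := incl R W A + (-1) * \sum_(Y <- r) d Y * incl R Y A.
have sp_orth (g : {set X} -> R) (b : {set X} -> R) : (forall Z, Z \in r -> ip l g (incl R Z) = 0) ->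
    ip l g (fun A => \sum_(Y <- r) b Y * incl R Y A) = 0.
  move=> h; rewrite /ip; under eq_bigr do rewrite mulr_sumr.
  rewrite exchange_big /= big_seq big1 // => Y Yr.
  have := h Y Yr; rewrite /ip => hY.
  by under eq_bigr do rewrite mulrCA; rewrite -mulr_sumr hY mulr0.
pose t := ip l f' w' / ip l w' w'.
exists (fun Y => if Y == W then t else c Y - t * d Y) => Z.
have defE A : f A + (-1) * \sum_(Y <- W :: r) (if Y == W then t else c Y - t * d Y) * incl R Y A
    = f' A + (- t) * w' A.
  rewrite big_cons eqxx /f' /w'.
  have -> : \sum_(Y <- r) (if Y == W then t else c Y - t * d Y) * incl R Y A =
      \sum_(Y <- r) c Y * incl R Y A - t * \sum_(Y <- r) d Y * incl R Y A.
    rewrite mulr_sumr -sumrB big_seq [RHS]big_seq; apply: eq_bigr => Y Yr.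
    by case: eqP => [e|_]; [rewrite -e Yr in Wr | ring].
  ring.
rewrite (ip_eql (g := fun A => f' A + (- t) * w' A)); last by move=> A _; rewrite defE.
rewrite ip_lin inE => /orP[/eqP ->|Zr]; last by rewrite cE // dE // mulr0 addr0.
have WE (g : {set X} -> R) : (forall Z, Z \in r -> ip l g (incl R Z) = 0) ->
    ip l g (incl R W) = ip l g w'.
  move=> h; rewrite [RHS]ipC /w' ip_lin [X in _ + _ * X]ipC sp_orth // mulr0 addr0.
  exact: ipC.
rewrite !WE // /t; have [w0|w0] := eqVneq (ip l w' w') 0; last by rewrite mulNr divfK ?subrr.
rewrite w0 mulr0 addr0 ipC /ip big1 // => A AS.
by rewrite (ip_eq0 w0 AS) mul0r.
Qed.

Lemma low_proj (X : finType) (R : realFieldType) l i (f : {set X} -> R) :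
  exists2 p, low l i p & forall g, low l i g -> ip l (fun A => f A + (-1) * p A) g = 0.
Proof.
have [c cE] := @orth_proj X R l (enum [pred Z : {set X} | (#|Z| < i)%N]) f (enum_uniq _).
exists (fun A => \sum_(Y <- enum [pred Z : {set X} | (#|Z| < i)%N]) c Y * incl R Y A).
  by exists c => A _; rewrite big_enum.
move=> g [d gd]; rewrite ipC (ip_eql _ gd) /ip.
under eq_bigr do rewrite mulr_suml.
rewrite exchange_big /= big1 // => Z Zi.
have := cE Z; rewrite mem_enum inE Zi => /(_ isT); rewrite ipC /ip => h.
by under eq_bigr do rewrite -mulrA; rewrite -mulr_sumr h mulr0.
Qed.

(** Split f = p + w with p of lower degree and w orthogonal to all lower degrees. By triangularity
    [kneser w] minus a multiple of w has lower degree, so the form splits and no eigenvectors are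
    needed. The absolute values of the eigenvalues decrease with the degree, so degree 1 gives the
    bound; degree 0 is excluded by orthogonality to the constants. *)
Lemma kneser_form_le (X : finType) (R : realFieldType) l i (f : {set X} -> R) :
  (i <= l)%N -> (0 < l)%N -> (2 * l <= #|X|)%N ->
  low l i.+1 f -> ip l f (fun=> 1) = 0 ->
  ip l f (kneser l f) <= 'C((#|X| - l).-1, l.-1)%:R * ip l f f.
Proof.
move=> + l0 lX; elim: i f => [|i IH] f il fl f1.
  have [c fc] := fl.
  have f0 A : A \in draws [set: X] l -> f A = 0.
    have fE B : B \in draws [set: X] l -> f B = c set0.
      move=> BS; rewrite fc // (bigD1 set0) /= ?cards0 // /incl sub0set mulr1 big1 ?addr0 //.
      by move=> Z /andP[]; rewrite ltnS leqn0 cards_eq0 => ->.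
    move=> AS; move: f1; rewrite fE // /ip (eq_bigr (fun=> c set0)); last by move=> B BS; rewrite fE // mulr1.
    rewrite sumr_const => /eqP; rewrite mulrn_eq0 cards_eq0 => /orP[/eqP S0|/eqP//].
    by rewrite S0 inE in AS.
  by rewrite /ip !big1 ?mulr0 // => A AS; rewrite f0 // mul0r.
have [p pl pE] := low_proj l i.+1 f.
pose w A := f A + (-1) * p A.
have wl : low l i.+2 w by apply: low_lin => //; apply: low_mono pl.
have one_low : low l i.+1 (fun _ : {set X} => 1 : R).
  apply: low_eq (_ : low l i.+1 (incl R set0)); last by apply: low_incl; rewrite cards0.
  by move=> A _; rewrite /incl sub0set.
have p1 : ip l p (fun=> 1) = 0.
  by have := pE _ one_low; rewrite ip_lin f1 add0r mulN1r => /eqP; rewrite oppr_eq0 => /eqP.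
have IHp := IH p (ltnW il) pl p1.
have fE A : f A = p A + 1 * w A by rewrite /w; ring.
have kfE A : kneser l f A = kneser l p A + 1 * kneser l w A.
  by rewrite -kneser_lin; apply: kneser_eq => B _; apply: fE.
have wp : ip l w p = 0 by apply: pE.
have wkp : ip l w (kneser l p) = 0.
  by apply/pE/kneser_low => //; rewrite ltnW // ltnS.
pose lam := (-1) ^+ i.+1 * ('C(#|X| - l - i.+1, l - i.+1)%:R : R).
have wkw : ip l w (kneser l w) = lam * ip l w w.
  have := pE _ (kneser_low_quot il wl); rewrite -/w ipC ip_lin ipC => /eqP.
  by rewrite mulNr subr_eq0 => /eqP.
clearbody w.
have -> : ip l f (kneser l f) = ip l p (kneser l p) + lam * ip l w w.
  rewrite (ip_eql _ (fun A _ => fE A)) (ip_eqr _ (fun A _ => kfE A)) ip_lin !ip_linr.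
  by rewrite wkp wkw [ip l p (kneser l w)]kneser_sym [ip l (kneser l p) w]ipC wkp; ring.
have -> : ip l f f = ip l p p + ip l w w.
  rewrite (ip_eql _ (fun A _ => fE A)) (ip_eqr _ (fun A _ => fE A)) ip_lin !ip_linr.
  by rewrite wp [ip l p w]ipC wp; ring.
rewrite mulrDr lerD // ler_wpM2r ?ip_ge0 // /lam.
have binle a b : (b <= a)%N -> ('C(a, b) <= 'C(a.+1, b.+1))%N by move=> _; rewrite binS leq_addl.
have bin_chain j : (j < l)%N -> ('C(#|X| - l - j.+1, l - j.+1) <= 'C((#|X| - l).-1, l.-1))%N.
  elim: j => [|j IHj] jl; first by rewrite !subn1.
  apply: leq_trans (IHj (ltnW jl)).
  have -> : (#|X| - l - j.+1 = (#|X| - l - j.+2).+1)%N by move: lX; lia.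
  have -> : (l - j.+1 = (l - j.+2).+1)%N by lia.
  by apply: binle; move: lX; lia.
apply: le_trans (_ : 'C(#|X| - l - i.+1, l - i.+1)%:R <= _); last by rewrite ler_nat bin_chain.
rewrite -[leRHS]mul1r ler_wpM2r ?ler0n // -signr_odd.
by case: (odd _); rewrite ?expr1 ?expr0 // lerN10 || lra.
Qed.

Definition disjoint_pairs (X : finType) (G : {set {set X}}) : {set {set X} * {set X}} :=
  [set p : {set X} * {set X} | [&& p.1 \in G, p.2 \in G & [disjoint p.1 & p.2]]].

(** The form bound applied to the indicator of [G] minus its density; the constant part contributes
    the main term. *)
Lemma disjoint_pairs_le (X : finType) (R : realFieldType) l (G : {set {set X}}) :
  (0 < l)%N -> (2 * l <= #|X|)%N -> G \subset draws [set: X] l ->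
  #|disjoint_pairs G|%:R <=
    'C(#|X| - l, l)%:R * #|G|%:R ^+ 2 / 'C(#|X|, l)%:R + 'C((#|X| - l).-1, l.-1)%:R * #|G|%:R :> R.
Proof.
move=> l0 lX GS.
have cS : #|draws [set: X] l| = 'C(#|X|, l) by rewrite cards_draws cardsT.
have S0 : (0 : R) < 'C(#|X|, l)%:R by rewrite ltr0n bin_gt0; lia.
pose g : R := #|G|%:R / 'C(#|X|, l)%:R.
pose f (A : {set X}) : R := (A \in G)%:R.
pose h A := f A + (- g) * 1.
have sumG (u : {set X} -> R) : \sum_(A in draws [set: X] l) f A * u A = \sum_(A in G) u A.
  rewrite big_mkcond [RHS]big_mkcond; apply: eq_bigr => A _; rewrite /f.
  by case: (boolP (A \in G)) => [/(subsetP GS) ->|_]; rewrite ?mul1r ?mul0r ?if_same.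
have f1 : ip l f (fun=> 1) = #|G|%:R by rewrite /ip sumG sumr_const.
have ff : ip l f f = #|G|%:R.
  rewrite /ip sumG -sum1_card natr_sum; apply: eq_bigr => A AG; by rewrite /f AG.
have i11 : ip l (fun _ : {set X} => 1 : R) (fun=> 1) = 'C(#|X|, l)%:R.
  by rewrite /ip -cS -sum1_card natr_sum; apply: eq_bigr => A _; rewrite mulr1.
have h1 : ip l h (fun=> 1) = 0.
  by rewrite /h ip_lin f1 i11 /g mulNr divfK ?subrr // gt_eqF.
(* Every function has degree at most [l], since among [l]-sets [incl R Z] with |Z| = l is the
   indicator of the single set [Z]. *)
have hl : low l l.+1 h.
  exists (fun Z : {set X} => if #|Z| == l then h Z else 0) => A AS.
  rewrite (bigD1 A) /=; last by case/drawsP: AS => _ ->.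
  have [_ cA] := drawsP AS; rewrite cA eqxx /incl subxx mulr1 big1 ?addr0 // => Z /andP[_ ZA].
  case: eqP => cZ; rewrite ?mul0r //.
  suff -> : Z \subset A = false by rewrite mulr0.
  by apply/negbTE; apply: contra ZA => ZA; rewrite eqEcard ZA cA cZ /=.
have := kneser_form_le (leqnn l) l0 lX hl h1.
have k1 A : A \in draws [set: X] l -> kneser l (fun _ : {set X} => 1 : R) A = 'C(#|X| - l, l)%:R * 1.
  move=> AS; have := kneser_incl R AS (_ : #|set0 : {set X}| <= l)%N.
  rewrite cards0 !subn0 -setI_eq0 set0I eqxx => /(_ isT) <-.
  by apply: kneser_eq => B _; rewrite /incl sub0set.
have fE A : f A = h A + g * 1 by rewrite /h; ring.
have pairsE : ip l f (kneser l f) = #|disjoint_pairs G|%:R.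
  rewrite /ip sumG /kneser -sum1_card natr_sum.
  transitivity (\sum_(A in G) \sum_(B in G | [disjoint A & B]) (1 : R)).
    apply: eq_bigr => A _; rewrite big_mkcondr [RHS]big_mkcondr /=.
    rewrite -(sumG (fun B => if [disjoint A & B] then 1 else 0)); apply: eq_bigr => B _.
    by case: ifP; rewrite ?mulr1 ?mulr0.
  by rewrite pair_big_dep /=; apply: eq_bigl => -[A B]; rewrite inE.
have hh : ip l h h = #|G|%:R - g ^+ 2 * 'C(#|X|, l)%:R.
  rewrite /h ip_lin !ip_linr ff f1 i11 [ip l (fun=> 1) f]ipC f1 /g.
  by field; rewrite gt_eqF ?S0.
clearbody h f.
have -> : ip l h (kneser l h) = #|disjoint_pairs G|%:R - g ^+ 2 * 'C(#|X| - l, l)%:R * 'C(#|X|, l)%:R.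
  have kfE A : kneser l f A = kneser l h A + g * kneser l (fun=> 1) A.
    by rewrite -kneser_lin; apply: kneser_eq => B _; apply: fE.
  rewrite -pairsE (ip_eql _ (fun A _ => fE A)) (ip_eqr _ (fun A _ => kfE A)) ip_lin !ip_linr.
  have k1f (u : {set X} -> R) : ip l (kneser l (fun=> 1)) u = 'C(#|X| - l, l)%:R * ip l (fun=> 1) u.
    by rewrite (ip_eql _ k1) /ip mulr_sumr; apply: eq_bigr => A _; ring.
  rewrite [ip l h (kneser l (fun=> 1))]ipC [ip l (fun=> 1) (kneser l h)]kneser_sym !k1f [ip l (fun=> 1) (kneser l _)]kneser_sym k1f i11 [ip l (fun=> 1) h]ipC h1.
  by ring.
rewrite hh.
move=> le1.
have gg : 'C(#|X| - l, l)%:R * #|G|%:R ^+ 2 / 'C(#|X|, l)%:R = g ^+ 2 * 'C(#|X| - l, l)%:R * 'C(#|X|, l)%:R.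
  by rewrite /g; field; rewrite gt_eqF ?S0.
have : 0 <= 'C((#|X| - l).-1, l.-1)%:R * (g ^+ 2 * 'C(#|X|, l)%:R).
  by apply: mulr_ge0; rewrite ?ler0n // mulr_ge0 ?sqr_ge0 ?ler0n.
rewrite gg; lra.
Qed.

(** * Random blocks *)

From mathcomp Require Import all_fingroup.

Lemma perm_of_seqs (X : finType) (p q : seq X) :
  uniq p -> uniq q -> size p = size q -> (forall x, x \in p) ->
  exists sg : {perm X}, map sg p = q.
Proof.
move=> pu qu pq pall.
pose f x := nth x q (index x p).
have lt x : (index x p < size q)%N by rewrite -pq index_mem.
have finj : injective f.
  move=> x y; rewrite /f (set_nth_default y x (lt x)) => /eqP.
  rewrite nth_uniq // => /eqP e.
  by rewrite -(nth_index y (pall x)) e nth_index.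
exists (perm finj); have [x0 _|X0] := pickP (mem p); last first.
  have p0 : size p = 0%N by case E: p => [//|x p']; have := X0 x; rewrite /= E inE eqxx.
  by rewrite (size0nil p0); apply/esym/size0nil; rewrite -pq.
apply: (@eq_from_nth _ x0); rewrite size_map // => i ip.
rewrite (nth_map x0) // permE /f index_uniq //; apply: set_nth_default.
by rewrite -pq.
Qed.

Lemma perm_of_pair (X : finType) (A A' B B' : {set X}) :
  #|A| = #|B| -> #|A'| = #|B'| -> [disjoint A & A'] -> [disjoint B & B'] ->
  exists sg : {perm X}, sg @: A = B /\ sg @: A' = B'.
Proof.
move=> AB AB' dA dB.
pose sq (C C' : {set X}) := enum C ++ enum C' ++ enum (~: (C :|: C')).
have sqE (C C' : {set X}) : [disjoint C & C'] -> uniq (sq C C').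
  move=> dC; rewrite !cat_uniq !enum_uniq /= andbT -!all_predC.
  apply/andP; split; apply/allP => x; rewrite /= ?mem_cat !mem_enum.
    rewrite !inE negb_or; case/orP => [xC|/andP[]//].
    by rewrite (disjointFl dC).
  by rewrite !inE negb_or => /andP[].
have sz (C C' : {set X}) : [disjoint C & C'] -> size (sq C C') = #|X|.
  move=> dC; rewrite !size_cat -!cardE addnA.
  have <- : #|C :|: C'| = (#|C| + #|C'|)%N.
    by rewrite cardsU (_ : C :&: C' = set0) ?cards0 ?subn0 //; apply/eqP; rewrite setI_eq0.
  by rewrite cardsC.
have szAB : size (sq A A') = size (sq B B') by rewrite !sz.
have allA x : x \in sq A A'.
  by rewrite !mem_cat !mem_enum !inE; case: (x \in A); case: (x \in A').
have [sg e] := perm_of_seqs (sqE _ _ dA) (sqE _ _ dB) szAB allA.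
have im (C D : {set X}) : map sg (enum C) = enum D -> sg @: C = D.
  move=> eCD; apply/setP => y; apply/imsetP/idP => [[x xC ->]|yD].
    by rewrite -mem_enum -eCD map_f // mem_enum.
  have : y \in map sg (enum C) by rewrite eCD mem_enum.
  by case/mapP => x; rewrite mem_enum => xC ->; exists x.
exists sg; move: e; rewrite /sq !map_cat => /eqP.
rewrite eqseq_cat; last by rewrite size_map -!cardE.
case/andP => /eqP e1; rewrite eqseq_cat; last by rewrite size_map -!cardE.
by case/andP => /eqP e2 _; split; apply: im.
Qed.

Definition disj_sets (X : finType) (l l' : nat) : {set {set X} * {set X}} :=
  [set B : {set X} * {set X} | [&& #|B.1| == l, #|B.2| == l' & [disjoint B.1 & B.2]]].

Lemma card_disj_sets (X : finType) l l' :
  #|disj_sets X l l'| = ('C(#|X|, l) * 'C(#|X| - l, l'))%N.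
Proof.
have -> : disj_sets X l l' =
    [set p : {set X} * {set X} | (p.1 \in draws [set: X] l) && (p.2 \in draws (~: p.1) l')].
  apply/setP => -[A B]; rewrite !inE /= subsetT /= andbA [RHS]andbA [in RHS]andbAC.
  by rewrite disjoint_sym disjoints_subset.
rewrite (card_dep (draws [set: X] l) (fun A => draws (~: A) l')).
rewrite (eq_bigr (fun=> 'C(#|X| - l, l'))) => [|A /drawsP[_ cA]].
  by rewrite sum_nat_const cards_draws cardsT.
by rewrite cards_draws cardsCs setCK cA.
Qed.

(** A random permutation carries a fixed disjoint pair to a uniform one: the sum over permutations
    is the same for all pairs of these sizes, because some permutation maps one pair to another, and
    so it may be averaged over all pairs. *)
Lemma sum_perm_pair (X : finType) (R : realFieldType) l l' (phi : {set X} -> {set X} -> R)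
    (A A' : {set X}) : #|A| = l -> #|A'| = l' -> [disjoint A & A'] ->
  (\sum_(p : {perm X}) phi (p @: A) (p @: A')) * #|disj_sets X l l'|%:R =
  #|{perm X}|%:R * \sum_(B in disj_sets X l l') phi B.1 B.2.
Proof.
move=> cA cA' dA.
pose cnt (B : {set X} * {set X}) : R := \sum_(p : {perm X}) phi (p @: B.1) (p @: B.2).
have cntE B : B \in disj_sets X l l' -> cnt B = cnt (A, A').
  rewrite inE => /and3P[/eqP cB /eqP cB' dB].
  have [||sg [e e']] := perm_of_pair _ _ dA dB; rewrite ?cA ?cA' ?cB ?cB' //.
  rewrite /cnt [RHS](reindex_inj (mulgI sg)) /=; apply: eq_bigr => p _.
  by rewrite -e -e' -!imset_comp; congr (phi _ _); apply: eq_imset => x /=; rewrite permM.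
transitivity (\sum_(B in disj_sets X l l') cnt B).
  rewrite [RHS](eq_bigr (fun=> cnt (A, A'))); last by move=> B; apply: cntE.
  by rewrite sumr_const mulr_natr.
rewrite /cnt exchange_big /= mulr_natl -sumr_const; apply: eq_bigr => p _.
pose h (B : {set X} * {set X}) := (p @: B.1, p @: B.2).
have hinj : injective h.
  by move=> [B C] [B' C'] [] /(imset_inj (@perm_inj _ p)) -> /(imset_inj (@perm_inj _ p)) ->.
rewrite [RHS](reindex_inj hinj) /=; apply: eq_bigl => B.
rewrite !inE /= !card_imset //; try exact: perm_inj.
by rewrite -!setI_eq0 -imsetI ?imset_eq0 //; apply: in2W; apply: perm_inj.
Qed.

(** Random disjoint blocks are modelled as fixed blocks [b] moved by a random permutation. *)
Definition hits (X : finType) (T : nat) (b : 'I_T -> {set X}) (G : {set {set X}})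
    (p : {perm X}) : nat := #|[set a : 'I_T | p @: b a \in G]|.

Lemma hitsE (X : finType) (R : realFieldType) T (b : 'I_T -> {set X}) G p :
  (hits b G p)%:R = \sum_a (p @: b a \in G)%:R :> R.
Proof.
rewrite /hits -sum1_card natr_sum big_mkcond /=; apply: eq_bigr => a _.
by rewrite inE; case: (_ \in _).
Qed.

Lemma block_single (X : finType) (R : realFieldType) l (A : {set X}) (G : {set {set X}}) :
  #|A| = l -> (l <= #|X|)%N -> G \subset draws [set: X] l ->
  \sum_(p : {perm X}) (p @: A \in G)%:R = #|{perm X}|%:R * (#|G|%:R / 'C(#|X|, l)%:R) :> R.
Proof.
move=> cA lX GS.
have C0 : ('C(#|X|, l)%:R : R) != 0 by rewrite pnatr_eq0 -lt0n bin_gt0.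
have := @sum_perm_pair X R l 0 (fun B _ => (B \in G)%:R) A set0 cA (cards0 _).
rewrite -setI_eq0 setI0 eqxx card_disj_sets bin0 muln1 => /(_ isT) e.
apply: (mulIf C0); rewrite e -[RHS]mulrA divfK //; congr (_ * _).
rewrite -sum1_card natr_sum big_mkcond [RHS]big_mkcond /=.
pose u (B C : {set X}) : R := if (B, C) \in disj_sets X l 0 then (B \in G)%:R else 0.
transitivity (\sum_(B : {set X}) \sum_(C : {set X}) u B C).
  by rewrite pair_bigA; apply: eq_bigr => -[B C].
rewrite /u; apply: eq_bigr => B _; rewrite (bigD1 set0) //= big1 ?addr0 => [|C C0']; last first.
  by rewrite inE /= cards_eq0 (negbTE C0') andbF.
rewrite inE /= cards0 eqxx -setI_eq0 setI0 eqxx andbT.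
by case: (boolP (B \in G)) => [/(subsetP GS)/drawsP[_ ->]|_]; rewrite ?eqxx ?if_same.
Qed.

Lemma block_pair (X : finType) (R : realFieldType) l (A A' : {set X}) (G : {set {set X}}) :
  #|A| = l -> #|A'| = l -> [disjoint A & A'] -> G \subset draws [set: X] l ->
  \sum_(p : {perm X}) (p @: A \in G)%:R * (p @: A' \in G)%:R =
  #|{perm X}|%:R * (#|disjoint_pairs G|%:R / ('C(#|X|, l)%:R * 'C(#|X| - l, l)%:R)) :> R.
Proof.
move=> cA cA' dA GS.
have lX : (l + l <= #|X|)%N.
  rewrite -{1}cA -{1}cA' -cardsUI (_ : A :&: A' = set0) ?cards0 ?addn0 ?max_card //.
  by apply/eqP; rewrite setI_eq0.
have D0 : ('C(#|X|, l)%:R * 'C(#|X| - l, l)%:R : R) != 0.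
  by rewrite mulf_neq0 // pnatr_eq0 -lt0n bin_gt0; lia.
have := @sum_perm_pair X R l l (fun B C => (B \in G)%:R * (C \in G)%:R) A A' cA cA' dA.
rewrite card_disj_sets natrM => e.
apply: (mulIf D0); rewrite e -[RHS]mulrA divfK //; congr (_ * _).
rewrite -sum1_card natr_sum big_mkcond [RHS]big_mkcond /=.
apply: eq_bigr => -[B C] _; rewrite !inE /=.
case: (boolP (B \in G)) => [/(subsetP GS)/drawsP[_ ->]|_]; last by rewrite mul0r if_same.
case: (boolP (C \in G)) => [/(subsetP GS)/drawsP[_ ->]|_]; last by rewrite mulr0 if_same.
by rewrite eqxx mulr1.
Qed.

Lemma block_mean (X : finType) (R : realFieldType) l T (b : 'I_T -> {set X}) (G : {set {set X}}) :
  (forall a, #|b a| = l) -> (l <= #|X|)%N -> G \subset draws [set: X] l ->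
  \sum_(p : {perm X}) (hits b G p)%:R =
  #|{perm X}|%:R * (T%:R * (#|G|%:R / 'C(#|X|, l)%:R)) :> R.
Proof.
move=> cb lX GS; under eq_bigr do rewrite hitsE.
rewrite exchange_big /= (eq_bigr _ (fun a _ => block_single R (cb a) lX GS)).
by rewrite sumr_const card_ord -mulr_natl; ring.
Qed.

Lemma block_variance (X : finType) (R : realFieldType) l T (b : 'I_T -> {set X})
    (G : {set {set X}}) :
  (forall a, #|b a| = l) -> (forall a a', a != a' -> [disjoint b a & b a']) ->
  (l <= #|X|)%N -> G \subset draws [set: X] l ->
  \sum_(p : {perm X}) ((hits b G p)%:R - T%:R * (#|G|%:R / 'C(#|X|, l)%:R)) ^+ 2 =
  #|{perm X}|%:R * (T%:R * (#|G|%:R / 'C(#|X|, l)%:R)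
    + T%:R * (T%:R - 1) * (#|disjoint_pairs G|%:R / ('C(#|X|, l)%:R * 'C(#|X| - l, l)%:R))
    - (T%:R * (#|G|%:R / 'C(#|X|, l)%:R)) ^+ 2) :> R.
Proof.
move=> cb db lX GS.
set g := #|G|%:R / _; set q := #|disjoint_pairs G|%:R / _; set M : R := #|{perm X}|%:R.
have sq : \sum_(p : {perm X}) (hits b G p)%:R ^+ 2 = M * (T%:R * g + T%:R * (T%:R - 1) * q) :> R.
  under eq_bigr do rewrite hitsE expr2 mulr_suml.
  rewrite exchange_big /=.
  rewrite (eq_bigr (fun=> M * (g + (T%:R - 1) * q))) => [|a _]; last first.
    under eq_bigr do rewrite mulr_sumr.
    rewrite exchange_big /= (bigD1 a) //=.
    rewrite (eq_bigr (fun p : {perm X} => (p @: b a \in G)%:R)) => [|p _]; last first.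
      by case: (_ \in _); rewrite ?mulr1 ?mulr0.
    rewrite (block_single R (cb a) lX GS) -/g -/M.
    rewrite (eq_bigr (fun=> M * q)) => [|a' aa']; last first.
      by rewrite (block_pair R (cb a) (cb a')) // db // eq_sym.
    rewrite sumr_const (_ : #|_| = T.-1); last by rewrite cardC1 card_ord.
    case: T a {b cb db} => [[]|T] // _ /=; rewrite -mulr_natl -natr1; ring.
  by rewrite sumr_const card_ord -mulr_natl; ring.
transitivity (\sum_(p : {perm X}) ((hits b G p)%:R ^+ 2 + (- 2 * (T%:R * g)) * (hits b G p)%:R + (T%:R * g) ^+ 2)).
  by apply: eq_bigr => p _; ring.
rewrite !big_split /= sq -mulr_sumr (block_mean R cb lX GS) -/g -/M sumr_const -mulr_natl -/M.
ring.
Qed.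

(** Relative to the main term, the spectral error is l / (|X| - l) <= 1 / (T - 1), because T blocks
    fit into X. The correlations of pairs therefore add at most one further mean: the variance is at
    most twice the mean, whatever the block size. *)
Lemma block_variance_le (X : finType) (R : realFieldType) l T (b : 'I_T -> {set X})
    (G : {set {set X}}) :
  (forall a, #|b a| = l) -> (forall a a', a != a' -> [disjoint b a & b a']) ->
  (0 < l)%N -> (1 < T)%N -> (T * l <= #|X|)%N -> G \subset draws [set: X] l ->
  \sum_(p : {perm X}) ((hits b G p)%:R - T%:R * (#|G|%:R / 'C(#|X|, l)%:R)) ^+ 2 <=
  #|{perm X}|%:R * (2 * (T%:R * (#|G|%:R / 'C(#|X|, l)%:R))) :> R.
Proof.
move=> cb db l0 T1 TX GS.
have lX2 : (2 * l <= #|X|)%N by apply: leq_trans TX; rewrite leq_mul2r T1 orbT.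
have lX : (l <= #|X|)%N by apply: leq_trans lX2; rewrite leq_pmull.
rewrite block_variance // ler_wpM2l ?ler0n //.
have C0 : (0 : R) < 'C(#|X|, l)%:R by rewrite ltr0n bin_gt0.
have C1 : (0 : R) < 'C(#|X| - l, l)%:R by rewrite ltr0n bin_gt0; lia.
set c := 'C(#|X|, l)%:R in C0 *; set d := 'C(#|X| - l, l)%:R in C1 *.
set n := #|G|%:R : R; have n0 : 0 <= n by rewrite ler0n.
have := disjoint_pairs_le R l0 lX2 GS; rewrite -/c -/d -/n.
set e := 'C((#|X| - l).-1, l.-1)%:R : R; set q := #|disjoint_pairs G|%:R => qle.
have eE : ((T - 1)%:R : R) * e <= d.
  have : ((#|X| - l) * 'C((#|X| - l).-1, l.-1) = l * 'C(#|X| - l, l))%N.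
    by case: l l0 {qle e d c C0 C1 GS cb lX} lX2 TX => // l _ lX2 TX; rewrite -mul_bin_diag.
  move=> bE; rewrite /e /d -natrM ler_nat -(leq_pmul2l l0) -bE mulnA leq_mul2r.
  by apply/orP; right; move: TX; case: T T1 {b cb db} => // T _; rewrite mulSn; lia.
have e0 : 0 <= e by rewrite ler0n.
have T1R : (1 : R) <= T%:R by rewrite ler1n ltnW.
have TE : (T - 1)%:R = T%:R - 1 :> R by rewrite natrB // ltnW.
rewrite TE in eE.
have qd : q / (c * d) <= (n / c) ^+ 2 + n / c * (e / d).
  rewrite ler_pdivrMr ?mulr_gt0 //.
  apply: le_trans qle _; rewrite le_eqVlt; apply/orP; left; apply/eqP.
  by field; rewrite !gt_eqF.
have ed : (T%:R - 1) * (e / d) <= 1 by rewrite mulrA ler_pdivrMr // mul1r.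
have nc : 0 <= n / c by rewrite divr_ge0 // ltW.
have : T%:R * (T%:R - 1) * (q / (c * d)) <= T%:R * (T%:R - 1) * ((n / c) ^+ 2 + n / c * (e / d)).
  by rewrite ler_wpM2l // mulr_ge0 ?ler0n // subr_ge0.
have : T%:R * (n / c) * ((T%:R - 1) * (e / d)) <= T%:R * (n / c) * 1.
  by rewrite ler_wpM2l // mulr_ge0 ?ler0n.
have : 0 <= T%:R * (n / c) ^+ 2 by rewrite mulr_ge0 ?ler0n ?sqr_ge0.
lra.
Qed.

(** Chebyshev's inequality and a union bound: one permutation serves all indices. *)
Lemma exists_typical (X I : finType) (R : realFieldType) (dev : I -> {perm X} -> R) (V d : R) :
  (forall r, \sum_p dev r p ^+ 2 <= #|{perm X}|%:R * V) -> 0 < d -> #|I|%:R * V < d ^+ 2 ->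
  exists p, forall r, - d < dev r p.
Proof.
move=> devV d0 small.
have M0 : (0 : R) < #|{perm X}|%:R by rewrite ltr0n; apply/card_gt0P; exists 1%g.
have [p hp|no] := pickP (fun p : {perm X} => \sum_r dev r p ^+ 2 < d ^+ 2).
  exists p => r; rewrite ltNge; apply/negP => h; move: hp; rewrite ltNge => /negP; apply.
  apply: le_trans (_ : dev r p ^+ 2 <= _); first by nra.
  by rewrite (bigD1 r) //= lerDl sumr_ge0 // => *; rewrite sqr_ge0.
have : #|{perm X}|%:R * d ^+ 2 <= \sum_(p : {perm X}) \sum_r dev r p ^+ 2.
  by rewrite mulr_natl -sumr_const; apply: ler_sum => p _; rewrite leNgt no.
rewrite exchange_big /= => h.
have : \sum_r \sum_(p : {perm X}) dev r p ^+ 2 <= #|I|%:R * (#|{perm X}|%:R * V).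
  by rewrite [leRHS]mulr_natl -sumr_const; apply: ler_sum => r _; apply: devV.
move=> /(le_trans h); rewrite [leRHS]mulrCA ler_pM2l // => /(lt_le_trans small).
by rewrite ltxx.
Qed.

(** * Greedy matchings and traces *)

Definition slice (X : finType) (lo hi : nat) : {set X} :=
  [set x : X | lo <= enum_rank x < hi]%N.

Lemma card_slice (X : finType) lo hi : (hi <= #|X|)%N -> #|slice X lo hi| = (hi - lo)%N.
Proof.
move=> hX; rewrite -(card_iv lo hX) -(card_imset _ (@enum_rank_inj X)).
apply: eq_card => i; apply/imsetP/idP => [[x]|]; first by rewrite !inE => xI ->.
by rewrite !inE => iI; exists (enum_val i); rewrite ?inE enum_valK.
Qed.

Lemma slice_disjoint (X : finType) lo hi lo' hi' :
  (hi <= lo')%N -> [disjoint slice X lo hi & slice X lo' hi'].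
Proof.
by move=> h; rewrite -setI_eq0; apply/eqP/setP => x; rewrite !inE; apply/negP; lia.
Qed.

Lemma slice_disj_lt (X : finType) (k : nat) (a a' : nat) (c : nat) : a != a' ->
  [disjoint slice X (c + a * k) (c + a.+1 * k) & slice X (c + a' * k) (c + a'.+1 * k)].
Proof.
wlog lt : a a' / (a < a')%N => [W ne|_].
  by case: (ltngtP a a') => h; [apply: W | rewrite disjoint_sym; apply: W => //; rewrite eq_sym | rewrite h eqxx in ne].
by apply: slice_disjoint; rewrite leq_add2l leq_mul2r lt orbT.
Qed.

Definition pull (T : finType) (Y : {set T}) (G : {set {set T}}) : {set {set {x | x \in Y}}} :=
  [set B : {set {x | x \in Y}} | val @: B \in G].

Lemma pull_draws (T : finType) (Y : {set T}) l (G : {set {set T}}) :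
  G \subset draws Y l -> pull Y G \subset draws [set: {x | x \in Y}] l.
Proof.
move=> GY; apply/subsetP => B; rewrite inE => /(subsetP GY)/drawsP[_ c].
by rewrite inE subsetT -c card_imset ?eqxx //; apply: val_inj.
Qed.

Lemma card_pull (T : finType) (Y : {set T}) l (G : {set {set T}}) :
  G \subset draws Y l -> #|pull Y G| = #|G|.
Proof.
move=> GY; rewrite -(card_imset (pull Y G) (imset_inj (@val_inj _ _ {x | x \in Y}))).
apply: eq_card => A; apply/imsetP/idP => [[B]|AG]; first by rewrite inE => BG ->.
have [sA _] := drawsP (subsetP GY _ AG).
have eA : val @: [set x : {x | x \in Y} | val x \in A] = A.
  apply/setP => x; apply/imsetP/idP => [[y]|xA]; first by rewrite inE => yA ->.
  by exists (Sub x (subsetP sA _ xA)); rewrite ?inE.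
by exists [set x : {x | x \in Y} | val x \in A]; rewrite ?inE eA.
Qed.

(** The choice proceeds from the index s downwards: when [i] is served, s - i elements are taken and
    at least s + 1 - i were eligible. *)
Lemma greedy (A : finType) s (D : {set A}) (Q : nat -> pred A) :
  (forall i, (i <= s)%N -> (s.+1 - i <= #|[set a in D | Q i a]|)%N) ->
  exists f : nat -> A, (forall i, (i <= s)%N -> (f i \in D) && Q i (f i)) /\
    (forall i j, (i <= s)%N -> (j <= s)%N -> i != j -> f i != f j).
Proof.
elim: s D => [|s IH] D h.
  have /card_gt0P[a] := h 0%N (leqnn _); rewrite inE => aD.
  exists (fun=> a); split=> [i|i j]; first by rewrite leqn0 => /eqP ->.
  by rewrite !leqn0 => /eqP -> /eqP ->.
have : (0 < #|[set a in D | Q s.+1 a]|)%N by apply: leq_trans (h s.+1 (leqnn _)); rewrite subSnn.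
case/card_gt0P => a; rewrite inE => /andP[aD Qa].
have [i is_|f [fQ finj]] := IH (D :\ a).
  have := h i (leqW is_); rewrite (cardsD1 a) => le.
  apply: leq_trans (_ : #|[set a in D | Q i a] :\ a| <= _)%N.
    by move: le; case: (a \in _) => /=; lia.
  by apply/subset_leq_card/subsetP => x; rewrite !inE andbA.
exists (fun i => if (i <= s)%N then f i else a); split.
  move=> i; rewrite leq_eqVlt ltnS => /orP[/eqP ->|is_]; first by rewrite ltnn aD.
  by rewrite is_; have := fQ i is_; rewrite !inE => /andP[/andP[_ ->]].
have ne i : (i <= s)%N -> f i != a by move=> is_; have := fQ i is_; rewrite !inE => /andP[/andP[]].
move=> i j; rewrite leq_eqVlt ltnS => /orP[/eqP ->|is_]; rewrite leq_eqVlt ltnS => /orP[/eqP ->|js].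
- by rewrite eqxx.
- by rewrite ltnn js => _; rewrite eq_sym; apply: ne.
- by rewrite ltnn is_ => _; apply: ne.
- by rewrite is_ js => ij; apply: finj.
Qed.

Lemma no_greedy n s T (F : {set {set 'I_n}}) (e : nat -> 'I_n) (B : 'I_T -> {set 'I_n}) :
  nomatch s F ->
  (forall i j, (i <= s)%N -> (j <= s)%N -> i != j -> e i != e j) ->
  (forall i a, (i <= s)%N -> e i \notin B a) ->
  (forall a a', a != a' -> [disjoint B a & B a']) ->
  exists2 i, (i <= s)%N & (#|[set a | e i |: B a \in F]| <= s - i)%N.
Proof.
move=> Fs einj eB dB.
have [/existsP[i hi]|/existsPn no] := boolP [exists i : 'I_s.+1, #|[set a | e i |: B a \in F]| <= s - i]%N.
  by exists i => //; rewrite -ltnS.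
have [i is_|f [fQ finj]] := @greedy _ s setT (fun i a => e i |: B a \in F).
  have := no (Ordinal (is_ : (i < s.+1)%N)); rewrite -ltnNge /= => le.
  by rewrite subSn //; apply: leq_trans le _; apply/subset_leq_card/subsetP => a; rewrite !inE.
have := @nomatch_fun _ 'I_s.+1 s F (fun i => e i |: B (f i)) Fs.
rewrite card_ord ltnn => abs; exfalso; apply/notF/abs => [i|i|i j ij].
- by have /andP[_] := fQ i (ltn_ord i : (i <= s)%N).
- by apply/set0Pn; exists (e i); rewrite !inE eqxx.
- have is_ := ltn_ord i : (i <= s)%N; have js := ltn_ord j : (j <= s)%N.
  have dij : [disjoint B (f i) & B (f j)] by apply/dB/finj.
  rewrite -setI_eq0; apply/eqP/setP => x; rewrite !inE.
  apply/negP => /andP[/orP[/eqP ->|xi] /orP[/eqP e'|xj]].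
  + by have := einj i j is_ js ij; rewrite e' eqxx.
  + by have := eB i (f j) is_; rewrite xj.
  + by have := eB j (f i) js; rewrite -e' xi.
  + by rewrite (disjointFr dij xi) in xj.
Qed.

(* fam F m h k x: traces on [m, h) of the members of F meeting {x} + [0, m) in {x} *)
Definition fam n (F : {set {set 'I_n}}) (m h k : nat) (x : 'I_n) : {set {set 'I_n}} :=
  link x F :&: draws (iv n m h) k.

Lemma fam_draws n (F : {set {set 'I_n}}) m h k x : fam F m h k x \subset draws (iv n m h) k.
Proof. exact: subsetIr. Qed.

Lemma famE n (F : {set {set 'I_n}}) m h k (x : 'I_n) (B : {set 'I_n}) :
  (B \in fam F m h k x) = [&& x \notin B, x |: B \in F & B \in draws (iv n m h) k].
Proof. by rewrite in_setI inE andbA. Qed.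

Lemma fam_anti n (F : {set {set 'I_n}}) m h k (x y : 'I_n) (B : {set 'I_n}) : shifted 0 F -> (x <= y)%N ->
  x \notin B -> B \in fam F m h k y -> B \in fam F m h k x.
Proof.
move=> Fsh xy xB; rewrite !famE xB => /and3P[yB yF ->]; rewrite andbT /=.
move: xy; rewrite leq_eqVlt => /orP[/eqP/val_inj -> //|xy].
have -> : x |: B = x |: ((y |: B) :\ y) by rewrite setU1K.
apply: Fsh => //; rewrite !inE ?eqxx // negb_or xB andbT.
by rewrite -val_eqE /= ltn_eqF.
Qed.

Lemma notin_draws n m h k (x : 'I_n) (B : {set 'I_n}) : (x < m)%N -> B \in draws (iv n m h) k -> x \notin B.
Proof.
move=> xm /drawsP[sB _]; apply/negP => /(subsetP sB); rewrite inE => /andP[mx _].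
by rewrite leqNgt xm in mx.
Qed.

Lemma fam_sub n (F : {set {set 'I_n}}) m h k (x y : 'I_n) : shifted 0 F -> (x <= y)%N ->
  (x < m)%N -> fam F m h k y \subset fam F m h k x.
Proof.
move=> Fsh xy xm; apply/subsetP => B By; have BD := subsetP (fam_draws F m h k y) _ By.
by apply: fam_anti By => //; apply: notin_draws BD.
Qed.

(** Only sets with at most one point in [0, m) are counted as missing from [F]; all sets with two or
    more are conceded. *)
Lemma level_count n (F : {set {set 'I_n}}) m h k :
  (m <= h <= n)%N -> F \subset draws (iv n 0 h) k.+1 ->
  (#|F| + ('C(h - m, k.+1) - #|F :&: draws (iv n m h) k.+1|) +
     \sum_(i in iv n 0 m) ('C(h - m, k) - #|fam F m h k i|) <= 'C(h, k.+1))%N.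
Proof.
case/andP=> mh hn FS.
have cI : #|iv n m h| = (h - m)%N by rewrite card_iv.
have cD j : #|draws (iv n m h) j| = 'C(h - m, j) by rewrite cards_draws cI.
have -> : 'C(h, k.+1) = #|draws (iv n 0 h) k.+1| by rewrite cards_draws card_iv // subn0.
pose D0 := draws (iv n m h) k.+1 :\: F.
pose P := [set p : 'I_n * {set 'I_n} | (p.1 \in iv n 0 m) &&
  (p.2 \in draws (iv n m h) k :\: fam F m h k p.1)].
pose ext (p : 'I_n * {set 'I_n}) := p.1 |: p.2.
have cD0 : #|D0| = ('C(h - m, k.+1) - #|F :&: draws (iv n m h) k.+1|)%N.
  by rewrite cardsD cD setIC.
have cP : #|P| = (\sum_(i in iv n 0 m) ('C(h - m, k) - #|fam F m h k i|))%N.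
  rewrite (card_dep (iv n 0 m) (fun i => draws (iv n m h) k :\: fam F m h k i)).
  by apply: eq_bigr => i _; rewrite cardsD cD (setIidPr (fam_draws _ _ _ _ _)).
have Pin p : p \in P -> [/\ (p.1 < m)%N, p.1 \notin p.2 & p.2 \in draws (iv n m h) k].
  rewrite inE => /andP[]; rewrite inE => pm /setDP[pD _]; split=> //.
  exact: notin_draws pD.
have tr p : p \in P -> ext p :&: iv n 0 m = [set p.1].
  case/Pin => pm _ /drawsP[sB _]; apply/setP => x; rewrite !inE.
  case: (eqVneq x p.1) => [->|xp] /=; first by rewrite pm.
  by apply/negP => /andP[/(subsetP sB)]; rewrite inE; lia.
have ext_inj : {in P &, injective ext}.
  move=> p q pP qP e; have := tr _ pP; rewrite e tr // => /set1_inj e1.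
  have [_ np _] := Pin _ pP; have [_ nq _] := Pin _ qP.
  move: e; rewrite /ext -e1 => e.
  rewrite [p]surjective_pairing [q]surjective_pairing -e1; congr (_, _).
  have np' : q.1 \notin p.2 by rewrite e1.
  by rewrite -(setU1K np') e setU1K.
rewrite -cD0 -cP -(card_in_imset ext_inj) -addnA.
have d1 : [disjoint D0 & ext @: P].
  rewrite -setI_eq0; apply/eqP/setP => A; rewrite !inE; apply/negP.
  case/andP => /andP[_ /andP[sA _]] /imsetP[p pP eA].
  have [pm _ _] := Pin _ pP.
  have : p.1 \in A by rewrite eA !inE eqxx.
  by move/(subsetP sA); rewrite inE leqNgt pm.
have -> : (#|D0| + #|ext @: P| = #|D0 :|: ext @: P|)%N.
  by rewrite cardsU (_ : D0 :&: _ = set0) ?cards0 ?subn0 //; apply/eqP; rewrite setI_eq0.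
have d2 : [disjoint F & D0 :|: ext @: P].
  rewrite -setI_eq0; apply/eqP/setP => A; rewrite !inE; apply/negP.
  case/andP => AF /orP[/andP[]|/imsetP[p pP eA]]; first by rewrite AF.
  have [pm pn pd] := Pin _ pP.
  move: pP; rewrite inE => /andP[_ /setDP[_]]; rewrite famE pn pd andbT /= => /negP; apply.
  by rewrite eA in AF.
have -> : (#|F| + #|D0 :|: ext @: P| = #|F :|: (D0 :|: ext @: P)|)%N.
  by rewrite [#|F :|: _|]cardsU (_ : F :&: _ = set0) ?cards0 ?subn0 //; apply/eqP; rewrite setI_eq0.
apply: subset_leq_card; rewrite !subUset FS /=; apply/andP; split.
  apply/subsetP => A /setDP[/drawsP[sA cA] _]; rewrite inE cA eqxx andbT.
  by apply: subset_trans sA _; apply/subsetP => x; rewrite !inE => /andP[].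
apply/subsetP => A /imsetP[p pP ->]; have [pm pn /drawsP[sB cB]] := Pin _ pP.
rewrite inE /ext cardsU1 pn cB eqxx andbT subUset sub1set inE.
rewrite (leq_trans pm mh) /=; apply: subset_trans sB _.
by apply/subsetP => x; rewrite !inE => /andP[].
Qed.

Lemma shadow_fam n (F : {set {set 'I_n}}) m h k (x : 'I_n) :
  shifted 0 F -> (x < m)%N -> shadow (F :&: draws (iv n m h) k.+1) \subset fam F m h k x.
Proof.
move=> Fsh xm; apply/subsetP => B; rewrite inE => /existsP[y].
rewrite inE => /andP[yB]; rewrite inE => /andP[BF BD].
have [sB cB] := drawsP BD.
have Bd : B \in draws (iv n m h) k.
  by rewrite inE (subset_trans (subsetUr _ _) sB) /=; move: cB; rewrite cardsU1 yB add1n => -[->].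
have yx : (x <= y)%N.
  by have := subsetP sB y; rewrite !inE eqxx => /(_ isT)/andP[my _]; apply: ltnW (leq_trans xm my).
by apply: (fam_anti Fsh yx); [apply: notin_draws Bd | rewrite famE yB BF Bd].
Qed.

(** For the members of [F] that avoid [0, m), removing a point leaves a set that shiftedness puts
    into the link of every x < m. Their shadow is thus no larger than that link, and [shadow_bound]
    applies. *)
Lemma empty_trace_bound n (F : {set {set 'I_n}}) s m h k (x : 'I_n) :
  shifted 0 F -> nomatch s F -> (x < m)%N ->
  (#|F :&: draws (iv n m h) k.+1| <= s * #|fam F m h k x|)%N.
Proof.
move=> Fsh Fs xm; apply: leq_trans (_ : s * #|shadow (F :&: draws (iv n m h) k.+1)| <= _)%N.
  apply: (@shadow_bound n m h k); first exact: subsetIr.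
    move=> A i j /setIP[AF AD] mi ij jA iA; rewrite inE Fsh //=.
    have [sA cA] := drawsP AD; rewrite inE card_swap // cA eqxx andbT subUset sub1set inE mi.
    have := subsetP sA _ jA; rewrite inE => /andP[_ jh]; rewrite (ltn_trans ij jh) /=.
    by apply: subset_trans sA; apply: subsetDl.
  by apply: nomatch_sub Fs; apply: subsetIl.
by rewrite leq_mul2l; apply/orP; right; apply/subset_leq_card/shadow_fam.
Qed.

(** * Concentration for random blocks and points *)

Definition blocks (X : finType) (c k T : nat) (a : 'I_T) : {set X} :=
  slice X (c + a * k) (c + a.+1 * k).

Lemma card_blocks (X : finType) c k T (a : 'I_T) :
  (c + T * k <= #|X|)%N -> #|blocks X c k a| = k.
Proof.
move=> h; rewrite card_slice ?mulSn; first by rewrite subnDl addnK.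
by apply: leq_trans h; rewrite leq_add2l -mulSn leq_mul2r ltn_ord orbT.
Qed.

Lemma blocks_disjoint (X : finType) c k T (a a' : 'I_T) :
  a != a' -> [disjoint blocks X c k a & blocks X c k a'].
Proof. by move=> ne; apply: slice_disj_lt. Qed.

Lemma imset_perm_disjoint (X : finType) (p : {perm X}) (A B : {set X}) :
  [disjoint A & B] -> [disjoint p @: A & p @: B].
Proof.
by rewrite -!setI_eq0 -imsetI ?imset_eq0 //; apply: in2W; apply: perm_inj.
Qed.

Lemma imset_val_disjoint (T : finType) (Y : {set T}) (A B : {set {x | x \in Y}}) :
  [disjoint A & B] -> [disjoint val @: A & val @: B].
Proof.
by rewrite -!setI_eq0 -imsetI ?imset_eq0 //; apply: in2W; apply: val_inj.
Qed.

Lemma hits_fam n (F : {set {set 'I_n}}) m h k T (b : 'I_T -> {set {x | x \in iv n m h}})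
    (p : {perm {x | x \in iv n m h}}) (x y : 'I_n) :
  shifted 0 F -> (x <= y)%N -> (forall a, x \notin val @: (p @: b a)) ->
  (hits b (pull (iv n m h) (fam F m h k y)) p <=
    #|[set a | x |: (val @: (p @: b a)) \in F]|)%N.
Proof.
move=> Fsh xy xb; apply/subset_leq_card/subsetP => a.
rewrite [a \in _]inE [_ \in pull _ _]inE => By; rewrite inE.
by have := fam_anti Fsh xy (xb a) By; rewrite famE => /and3P[].
Qed.

Lemma rank_elements n s (D : {set 'I_n}) : (s < #|D|)%N ->
  exists e : nat -> 'I_n, [/\ forall i, (i <= s)%N -> e i \in D,
    forall i j, (i <= s)%N -> (j <= s)%N -> i != j -> e i != e j &
    forall i, (i <= s)%N -> #|[set x in D | (x < e i)%N]| = i].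
Proof.
move=> sD; have [x0 x0D] : exists x, x \in D by apply/card_gt0P/leq_ltn_trans/sD.
pose rk (y : 'I_n) := #|[set x in D | (x < y)%N]|.
have rk_lt (y z : 'I_n) : y \in D -> (y < z)%N -> (rk y < rk z)%N.
  move=> yD yz; apply/proper_card/properP; split.
    by apply/subsetP => x; rewrite !inE => /andP[-> /ltn_trans]; apply.
  by exists y; rewrite !inE ?yD ?yz // ltnn.
have rkD y : y \in D -> (rk y < #|D|)%N.
  move=> yD; apply/proper_card/properP; split; first by apply/subsetP => x; rewrite inE => /andP[].
  by exists y; rewrite // inE ltnn andbF.
pose f (y : {y | y \in D}) := Ordinal (rkD _ (valP y)).
have finj : injective f.
  move=> y z /(congr1 val) /= e; apply/val_inj/val_inj => /=.
  case: (ltngtP (val y) (val z)) => // h.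
    by have := rk_lt _ _ (valP y) h; rewrite e ltnn.
  by have := rk_lt _ _ (valP z) h; rewrite e ltnn.
have onto i : (i <= s)%N -> exists2 y, y \in D & rk y = i.
  move=> is_; have iD := leq_ltn_trans is_ sD.
  have fi : Ordinal iD \in codom f by apply: inj_card_onto => //; rewrite card_ord card_sig.
  by exists (val (iinv fi)); [apply: valP | have /(congr1 val) := f_iinv fi].
exists (fun i => odflt x0 [pick y in D | rk y == i]).
have eE i : (i <= s)%N -> let y := odflt x0 [pick y in D | rk y == i] in y \in D /\ rk y = i.
  case/onto => y yD yi; case: pickP => [z /andP[zD /eqP]|/(_ y)] //=.
  by rewrite yD yi eqxx.
split=> [i /eE[]//|i j /eE[_ ei] /eE[_ ej]|i /eE[_]//].
by apply: contraNneq => e; rewrite -ei -ej e.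
Qed.

(** The expected number of elements below [y], rounded down, in the union of [0, m) with U random
    points of the N points from m on. *)
Definition pos (m U N y : nat) : nat := if (y < m)%N then y else (m + (U * (y - m)) %/ N)%N.

Definition dens (R : realFieldType) n (F : {set {set 'I_n}}) (m h k : nat) (y : 'I_n) : R :=
  #|fam F m h k y|%:R / 'C(h - m, k)%:R.

(** Satisfiability of [P] is left to the conclusion, so that an extremal point can be chosen for
    every cell of a grid at once, empty cells included. *)
Lemma pred_max n (P : pred 'I_n) (y0 : 'I_n) :
  exists z : 'I_n, forall y, P y -> P z /\ (y <= z)%N.
Proof.
case: (pickP P) => [y Py|no]; last by exists y0 => y; rewrite no.
by case: (arg_maxnP (fun z : 'I_n => z : nat) Py) => z Pz zmax; exists z => x Px; split=> //; apply: zmax.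
Qed.

Lemma pred_min n (P : pred 'I_n) (y0 : 'I_n) :
  exists z : 'I_n, forall y, P y -> P z /\ (z <= y)%N.
Proof.
case: (pickP P) => [y Py|no]; last by exists y0 => y; rewrite no.
by case: (arg_minnP (fun z : 'I_n => z : nat) Py) => z Pz zmin; exists z => x Px; split=> //; apply: zmin.
Qed.

Lemma dens_ge0 (R : realFieldType) n (F : {set {set 'I_n}}) m h k y : 0 <= dens R F m h k y.
Proof. by rewrite divr_ge0 ?ler0n. Qed.

Lemma card_fam_le n (F : {set {set 'I_n}}) m h k y :
  (h <= n)%N -> (#|fam F m h k y| <= 'C(h - m, k))%N.
Proof.
move=> hn; apply: leq_trans (subset_leq_card (fam_draws _ _ _ _ _)) _.
by rewrite cards_draws card_iv.
Qed.

Lemma dens_le1 (R : realFieldType) n (F : {set {set 'I_n}}) m h k y :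
  (h <= n)%N -> (k <= h - m)%N -> dens R F m h k y <= 1.
Proof.
by move=> hn kh; rewrite ler_pdivrMr ?ltr0n ?bin_gt0 // mul1r ler_nat card_fam_le.
Qed.

(** Place T disjoint random [k]-blocks and U further random points in [m, h), and match [0, m) and
    the random points, in increasing order, with the blocks. The greedy matching fails at some y of
    rank i that goes with at most s - i blocks; by concentration i is at least about the expected
    rank, and the number of blocks is about T times the density of the link. For m = s + 1 the
    failure lies in [0, m). *)
Lemma dichotomy (R : realFieldType) n (F : {set {set 'I_n}}) s m h k T U g L (d : R) :
  (0 < k)%N -> (1 < T)%N -> (1 < U)%N -> (0 < g)%N -> (T * k + U <= h - m)%N ->
  (m <= h <= n)%N -> (s < m + U)%N -> ((m + U) %/ g < L)%N ->
  shifted 0 F -> nomatch s F ->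
  0 < d -> (L.*2)%:R * (2 * (T%:R + U%:R)) < d ^+ 2 ->
  exists y : 'I_n, [/\ (y < h)%N, (y < m)%N || (m <= s)%N &
    (pos m U (h - m) y)%:R + T%:R * dens R F m h k y <= s%:R + g%:R + 2 * d].
Proof.
move=> k0 T1 U1 g0 TU /andP[mh hn] sU gL Fsh Fs d0 small.
pose allowed (y : 'I_n) := (y < h)%N && ((y < m)%N || (m <= s)%N).
pose N := (h - m)%N.
pose good (y : 'I_n) := (pos m U N y)%:R + T%:R * dens R F m h k y <= s%:R + g%:R + 2 * d.
have [y /andP[/andP[yh ya] yg]|no] := pickP (fun y => allowed y && good y).
  by exists y.
exfalso.
have H y : allowed y -> s%:R + g%:R + 2 * d < (pos m U N y)%:R + T%:R * dens R F m h k y.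
  by move=> ay; have := no y; rewrite ay /good ltNge /= => ->.
have mn : (m < n)%N by apply: leq_trans hn; rewrite -subn_gt0; apply: leq_trans TU; rewrite addn_gt0 (ltnW U1) orbT.
pose y0 := Ordinal mn.
pose Y := iv n m h; pose X := {x | x \in Y}.
have cX : #|{: X}| = N by rewrite card_sig card_iv.
have UX : (U <= #|{: X}|)%N by rewrite cX; apply: leq_trans TU; apply: leq_addl.
have TkX : (T * k <= #|{: X}|)%N by rewrite cX; apply: leq_trans TU; apply: leq_addr.
pose bl := @blocks X U k T.
pose ev (a : 'I_U) : X := enum_val (widen_ord UX a).
pose ex (a : 'I_U) : {set X} := [set ev a].
have ev_inj : injective ev by move=> a a' /enum_val_inj/(congr1 val) /= e; apply: val_inj.
have cbl a : #|bl a| = k by apply: card_blocks; rewrite cX addnC.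
have dbl a a' : a != a' -> [disjoint bl a & bl a'] by apply: blocks_disjoint.
have ev_bl a a' : ev a \notin bl a'.
  rewrite inE enum_valK /=; apply/negP => /andP[h1 _].
  by have := leq_ltn_trans (leq_trans (leq_addr _ _) h1) (ltn_ord a); rewrite ltnn.
(* The expected ranks are cut into L cells of length g. By monotonicity it is enough to control the
   links at the largest point [hi] and the ranks at the least point [lo] of each cell: 2 L
   deviations in all, at the price of the error g. *)
have [hi hiP] := fin_all_exists (fun i : 'I_L =>
  @pred_max n (fun y => allowed y && (pos m U N y < i.+1 * g)%N) y0).
have [lo loP] := fin_all_exists (fun i : 'I_L =>
  @pred_min n (fun y : 'I_n => (y < h)%N && (i * g <= pos m U N y)%N) y0).
pose low1 (i : 'I_L) : {set {set X}} := [set [set x] | x in [set x : X | (val x < lo i)%N]].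
have low1S i : low1 i \subset draws [set: X] 1.
  by apply/subsetP => _ /imsetP[x _ ->]; rewrite inE subsetT cards1.
have clow1 i : (m <= lo i)%N -> (lo i < h)%N -> #|low1 i| = (lo i - m)%N.
  move=> ml lh; rewrite card_imset; last by apply: set1_inj.
  rewrite -(card_iv m (ltnW (ltn_ord (lo i)))) -(card_imset _ val_inj); apply: eq_card => x.
  apply/imsetP/idP => [[z]|]; rewrite !inE.
    by move=> zl ->; rewrite zl andbT; have := valP z; rewrite inE => /andP[].
  case/andP => mx xl; have xY : x \in Y by rewrite inE mx (ltn_trans xl lh).
  by exists (Sub x xY); rewrite ?inE.
have pfam i := pull_draws (fam_draws F m h k (hi i)).
pose dev (r : bool * 'I_L) (p : {perm X}) : R :=
  if r.1 then (hits bl (pull Y (fam F m h k (hi r.2))) p)%:R - T%:R * (#|pull Y (fam F m h k (hi r.2))|%:R / 'C(#|{: X}|, k)%:R)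
  else (hits ex (low1 r.2) p)%:R - U%:R * (#|low1 r.2|%:R / 'C(#|{: X}|, 1)%:R).
have dens1 l (G : {set {set X}}) : G \subset draws [set: X] l -> (#|G|%:R / 'C(#|{: X}|, l)%:R : R) <= 1.
  move=> /subset_leq_card; rewrite cards_draws cardsT => le1.
  have [C0|C0] := eqVneq 'C(#|{: X}|, l) 0%N; first by rewrite C0 invr0 mulr0 ler01.
  by rewrite ler_pdivrMr ?ltr0n ?lt0n // mul1r ler_nat.
have devV r : \sum_p dev r p ^+ 2 <= #|{perm X}|%:R * (2 * (T%:R + U%:R)) :> R.
  have T0 : (0 : R) <= T%:R := ler0n _ _; have U0 : (0 : R) <= U%:R := ler0n _ _.
  rewrite /dev; case: r.1.
    apply: le_trans (block_variance_le R cbl dbl k0 T1 TkX (pfam _)) _.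
    rewrite ler_wpM2l ?ler0n //; have := dens1 _ _ (pfam r.2); nra.
  have dex a a' : a != a' -> [disjoint ex a & ex a'].
    by move=> ne; rewrite disjoints1 inE; apply: contra ne => /eqP/ev_inj ->.
  apply: le_trans (block_variance_le R (fun a => cards1 (ev a)) dex (ltn0Sn _) U1 _ (low1S _)) _.
    by rewrite muln1.
  rewrite ler_wpM2l ?ler0n //; have := dens1 _ _ (low1S r.2); nra.
have [p pP] : exists p, forall r, - d < dev r p.
  by apply: (exists_typical devV d0); rewrite card_prod card_bool card_ord mul2n.
pose E := [set val (p (ev a)) | a : 'I_U].
have cE : #|E| = U.
  by rewrite card_imset ?card_ord // => a a' /val_inj/perm_inj/ev_inj.
have EY : E \subset Y by apply/subsetP => _ /imsetP[a _ ->]; apply: valP.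
pose D := iv n 0 m :|: E.
have dDE : iv n 0 m :&: E = set0.
  apply/setP => x; rewrite !inE; apply/negP => /andP[/andP[_ xm] /(subsetP EY)].
  by rewrite inE leqNgt xm.
have cD : #|D| = (m + U)%N.
  by rewrite cardsU dDE cards0 subn0 cE card_iv ?subn0 // (leq_trans mh).
have [e [eD einj erk]] := @rank_elements n s D (etrans (congr1 _ cD) sU).
pose B (a : 'I_T) := val @: (p @: bl a).
have eB i a : (i <= s)%N -> e i \notin B a.
  move=> /eD; rewrite !inE => /orP[/andP[_ im]|].
    by apply/negP => /imsetP[x _ ex']; have := valP x; rewrite inE -ex' leqNgt im.
  case/imsetP => a' _ ->; apply/negP => /imsetP[x /imsetP[z zb ->]] /val_inj/perm_inj ez.
  by have := ev_bl a' a; rewrite ez zb.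
have dB a a' : a != a' -> [disjoint B a & B a'].
  by move=> ne; apply/imset_val_disjoint/imset_perm_disjoint/dbl.
have [i is_ few] := no_greedy Fs einj eB dB.
pose y := e i.
have yh : (y < h)%N.
  have := eD i is_; rewrite !inE => /orP[/andP[_ ym]|/(subsetP EY)]; first exact: leq_trans mh.
  by rewrite inE => /andP[].
have ay : allowed y.
  (* If m > s, the element of rank i <= s cannot lie beyond the m elements of [0, m), all of which
     belong to [D]. *)
  rewrite /allowed yh /=; case: (leqP m s) => ms; rewrite ?orbT // orbF ltnNge; apply/negP => my.
  have : (#|iv n 0 m| <= #|[set x in D | (x < y)%N]|)%N.
    apply/subset_leq_card/subsetP => x; rewrite !inE => /andP[_ xm].
    by rewrite xm (leq_trans xm my).
  by rewrite erk // card_iv ?subn0 ?(ltnW mn) // leqNgt (leq_ltn_trans is_ ms).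
pose t := (pos m U N y %/ g)%N.
have tL : (t < L)%N.
  apply: leq_ltn_trans gL; rewrite leq_div2r // /pos; case: ltnP => ym.
    by rewrite (leq_trans (ltnW ym)) ?leq_addr.
  rewrite leq_add2l; apply: leq_trans (_ : (U * N) %/ N <= _)%N.
    by rewrite leq_div2r // leq_mul2l leq_sub2r ?orbT // ltnW.
  by rewrite mulnK // subn_gt0 (leq_ltn_trans ym).
pose ti := Ordinal tL.
have tg : (t * g <= pos m U N y)%N by rewrite leq_divM.
have tg1 : (pos m U N y < t.+1 * g)%N by rewrite ltn_ceil.
have [/andP[az pz] yz] := hiP ti y (introT andP (conj ay tg1)).
have [/andP[wh pw] wy] := loP ti y (introT andP (conj yh tg)).
have := H _ az; have := pP (true, ti); rewrite /dev /= cX (card_pull (fam_draws _ _ _ _ _)).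
have cnt : (hits bl (pull Y (fam F m h k (hi ti))) p <= s - i)%N.
  by apply: leq_trans few; apply: hits_fam => // a; apply: eB.
move: cnt; rewrite -(ler_nat R) natrB // => cnt h1 h2.
have pzR : (pos m U N (hi ti))%:R <= t%:R * g%:R + g%:R :> R.
  by rewrite -natrM -natrD ler_nat -mulSnr ltnW.
have h1' : - d < (hits bl (pull Y (fam F m h k (hi ti))) p)%:R - T%:R * dens R F m h k (hi ti) by [].
have ilt : i%:R < t%:R * g%:R - d :> R by lra.
suff : t%:R * g%:R - d <= i%:R :> R by rewrite leNgt ilt.
have rk : (#|[set x in D | (x < lo ti)%N]| <= i)%N.
  rewrite -(erk i is_); apply/subset_leq_card/subsetP => x; rewrite !inE => /andP[->] /=.
  by move=> xl; apply: leq_trans wy.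
have pwR : t%:R * g%:R <= (pos m U N (lo ti))%:R :> R by rewrite -natrM ler_nat.
case: (ltnP (lo ti) m) => lm.
  have : (lo ti <= i)%N.
    apply: leq_trans rk; rewrite -{1}[lo ti : nat]subn0 -(card_iv 0 (ltnW (ltn_ord (lo ti)))).
    apply/subset_leq_card/subsetP => x; rewrite !inE => /andP[_ xl].
    by rewrite (ltn_trans xl lm).
  move: pwR; rewrite /pos lm -(ler_nat R) => ? ?; lra.
have := pP (false, ti); rewrite /dev /= bin1 cX clow1 //.
have mh' : (m + hits ex (low1 ti) p <= i)%N.
  apply: leq_trans rk.
  rewrite -{1}(subn0 m) -(card_iv 0 (leq_trans mh hn)).
  rewrite /hits -(card_imset _ (_ : injective (fun a => val (p (ev a))))); last first.
    by move=> a a' /val_inj/perm_inj/ev_inj.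
  apply: leq_trans (_ : #|iv n 0 m| + #|[set x in E | (x < lo ti)%N]| <= _)%N.
    rewrite leq_add2l; apply/subset_leq_card/subsetP => z /imsetP[a ah ->{z}].
    have zE : val (p (ev a)) \in E by apply: imset_f.
    rewrite inE zE /=; move: ah; rewrite inE imset_set1 => /imsetP[x].
    by rewrite inE => xl /set1_inj ->.
  have d3 : iv n 0 m :&: [set x in E | (x < lo ti)%N] = set0.
    by apply/eqP; rewrite -subset0 -dDE setIS //; apply/subsetP => x; rewrite inE => /andP[].
  have <- : #|iv n 0 m :|: [set x in E | (x < lo ti)%N]| =
      (#|iv n 0 m| + #|[set x in E | (x < lo ti)%N]|)%N by rewrite cardsU d3 cards0 subn0.
  apply/subset_leq_card/subsetP => x.
  rewrite !inE => /orP[/andP[_ xm]|/andP[-> ->]]; last by rewrite orbT.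
  by rewrite xm (leq_trans xm lm).
have pwle : (pos m U N (lo ti))%:R <= m%:R + U%:R * ((lo ti - m)%:R / N%:R) :> R.
  rewrite /pos ltnNge lm /= natrD lerD2l mulrA -natrM.
  by rewrite ler_pdivlMr ?ltr0n ?subn_gt0 ?(leq_ltn_trans lm) // -natrM ler_nat leq_divM.
move: mh'; rewrite -(ler_nat R) natrD => mh' h3; lra.
Qed.

(** The pointwise form of [small_trace]: j is s - i for the index i where the greedy matching fails,
    b the number of blocks in the link of the point s, and mu its mean. The quadratic term is what
    the variance pays for on average. *)
Lemma cover_slack (R : realFieldType) (S T j b mu : R) :
  33 / 20 * S - 3 <= T -> T <= 33 / 20 * S -> 1600 <= S ->
  0 <= b -> b <= j -> j <= S -> mu <= T / 4 ->
  (S - j) * T + j * j + (S + 1) * b <= S * T - S / 25 * b + 32 * (b - mu) ^+ 2.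
Proof.
move=> T1 T2 S0 b0 bj jS muT.
have sq : 0 <= (b - mu) ^+ 2 by rewrite sqr_ge0.
have conc : 0 <= (j - b) * (S - j) by rewrite mulr_ge0 ?subr_ge0.
(* Up to 3/5 S the slack of T over S is enough. Beyond it, b exceeds its mean, at most 33/80 S, by
   3/16 S, and the square dominates. *)
have [bs|bs] := lerP b (3 / 5 * S).
  have h1 : 0 <= (j - b) * (T - S - b) by rewrite mulr_ge0 ?subr_ge0 //; lra.
  have h2 : 0 <= b * (T - S - b - 1 - S / 25) by rewrite mulr_ge0 //; lra.
  nra.
have h0 : 0 <= j * (T - j) by rewrite mulr_ge0 //; lra.
have h3 : 3 / 16 * S <= b - mu by lra.
have h4 : (3 / 16 * S) ^+ 2 <= (b - mu) ^+ 2 by rewrite ler_sqr ?nnegrE; lra.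
have h5 : b * (S + 1 + S / 25) <= S * (S + 1 + S / 25) by rewrite ler_wpM2r; lra.
have h6 : S * (S + 1 + S / 25) <= 32 * (3 / 16 * S) ^+ 2 by nra.
nra.
Qed.

Lemma sum_step (s i T c : nat) : (i <= s)%N ->
  (\sum_(l < s) (if (l < i)%N then T else c) = i * T + (s - i) * c)%N.
Proof.
move=> is_; rewrite -(big_mkord xpredT (fun l => if (l < i)%N then T else c)).
rewrite (@big_cat_nat _ _ _ i) //=; congr addn.
  by rewrite big_nat (eq_bigr (fun=> T)) => [|l /andP[_ ->]]; rewrite // -big_nat sum_nat_const_nat subn0.
rewrite big_nat (eq_bigr (fun=> c)) => [|l /andP[il _]]; last by rewrite ltnNge il.
by rewrite -big_nat sum_nat_const_nat.
Qed.

Lemma sum_iv (V : nmodType) n m (mn : (m <= n)%N) (f : 'I_n -> V) :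
  \sum_(i in iv n 0 m) f i = \sum_(i < m) f (widen_ord mn i).
Proof. by rewrite (eq_bigl (fun i : 'I_n => (i < m)%N)) ?big_ord_narrow // => i; rewrite inE. Qed.

(** Here m = s + 1 and every point of [0, s] takes part, so [no_greedy] holds for every permutation;
    averaging the resulting inequality replaces block counts by link sizes. *)
Lemma small_trace (R : realFieldType) n (F : {set {set 'I_n}}) s h k T (xs : 'I_n) :
  (0 < k)%N -> (h <= n)%N -> xs = s :> nat -> (1 < T)%N -> (T * k <= h - s.+1)%N ->
  shifted 0 F -> nomatch s F ->
  33 / 20 * s%:R - 3 <= T%:R :> R -> T%:R <= 33 / 20 * s%:R :> R -> (1600 <= s)%N ->
  (4 * #|fam F s.+1 h k xs| <= 'C(h - s.+1, k))%N ->
  (\sum_(i in iv n 0 s.+1) #|fam F s.+1 h k i| + s * #|fam F s.+1 h k xs| <=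
    s * 'C(h - s.+1, k))%N.
Proof.
move=> k0 hn xsE T1 Tk Fsh Fs TlR TuR s0 small.
have sn : (s.+1 <= n)%N by rewrite -xsE ltn_ord.
pose Y := iv n s.+1 h; pose X := {x | x \in Y}; pose N := (h - s.+1)%N.
have cX : #|{: X}| = N by rewrite card_sig card_iv.
have kN : (k <= N)%N by apply: leq_trans Tk; rewrite leq_pmull // ltnW.
have C0 : (0 : R) < 'C(N, k)%:R by rewrite ltr0n bin_gt0.
pose bl := @blocks X 0 k T.
have cbl a : #|bl a| = k by apply: card_blocks; rewrite cX add0n.
have dbl a a' : a != a' -> [disjoint bl a & bl a'] by apply: blocks_disjoint.
pose w (i : 'I_s.+1) := widen_ord sn i.
pose G i := pull Y (fam F s.+1 h k (w i)).
have GS i : G i \subset draws [set: X] k by apply/pull_draws/fam_draws.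
have cG i : #|G i| = #|fam F s.+1 h k (w i)| by apply/card_pull/fam_draws.
have wmax : w ord_max = xs by apply: val_inj.
pose b (i : 'I_s.+1) p := hits bl (G i) p.
have bT i p : (b i p <= T)%N by rewrite -[leqRHS]card_ord max_card.
have b_anti (i j : 'I_s.+1) p : (i <= j)%N -> (b j p <= b i p)%N.
  move=> ij; apply/subset_leq_card/subsetP => a.
  rewrite [a \in _]inE [_ \in pull _ _]inE => By; rewrite inE [_ \in pull _ _]inE.
  exact: (subsetP (fam_sub h k Fsh (ij : (w i <= w j)%N) (ltn_ord i))).
pose g : R := #|fam F s.+1 h k xs|%:R / 'C(N, k)%:R.
pose mu : R := T%:R * g.
have mu4 : mu <= T%:R / 4.
  rewrite /mu ler_wpM2l ?ler0n // ler_pdivrMr // mulrC ler_pdivlMr ?ltr0n //.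
  by rewrite mulrC -natrM ler_nat.
have pt p : (\sum_i (b i p)%:R : R) + s%:R * (b ord_max p)%:R <=
    s%:R * T%:R - s%:R / 25 * (b ord_max p)%:R + 32 * ((b ord_max p)%:R - mu) ^+ 2.
  pose B (a : 'I_T) := val @: (p @: bl a).
  pose e (i : nat) : 'I_n := insubd xs i.
  have eE i : (i <= s)%N -> e i = i :> nat by move=> is_; rewrite val_insubd (leq_ltn_trans is_).
  have [i is_ few] : exists2 i, (i <= s)%N & (#|[set a | e i |: B a \in F]| <= s - i)%N.
    apply: no_greedy => //.
    - by move=> i j is_ js; apply: contraNneq => eij; rewrite -(eE _ is_) -(eE _ js) eij.
    - move=> i a is_; apply/negP => /imsetP[x _ ex]; have := valP x.
      by rewrite inE -ex eE // ltnNge is_.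
    - by move=> a a' ne; apply/imset_val_disjoint/imset_perm_disjoint/dbl.
  pose io : 'I_s.+1 := Ordinal (is_ : (i < s.+1)%N).
  have bi : (b io p <= s - i)%N.
    apply: leq_trans few; have -> : e i = w io by apply: val_inj; rewrite /= eE.
    apply: hits_fam => // a; apply/negP => /imsetP[x _ ex]; have := valP x.
    by rewrite inE -ex /= ltnNge is_.
  (* Before the failing index nothing better than T is known; from i on, the counts decrease and are
     at most s - i. The last point keeps its own count. *)
  have bsum : (\sum_i b i p <= i * T + (s - i) * (s - i) + b ord_max p)%N.
    rewrite big_ord_recr /= leq_add2r -sum_step //; apply: leq_sum => l _.
    case: ltnP => li; first exact: bT.
    by apply: leq_trans bi; apply: b_anti.
  have bmax : (b ord_max p <= s - i)%N by apply: leq_trans bi; apply: b_anti.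
  have iR : (s - i)%:R = s%:R - i%:R :> R by rewrite natrB.
  have := @cover_slack R s%:R T%:R (s - i)%:R (b ord_max p)%:R mu TlR TuR _ _ _ _ mu4.
  rewrite !ler_nat ler0n bmax leq_subr s0 => /(_ isT isT isT isT).
  move: bsum; rewrite -(ler_nat R) !natrD !natrM natr_sum iR; lra.
have Mperm : (0 : R) < #|{perm X}|%:R by rewrite ltr0n; apply/card_gt0P; exists 1%g.
have tot := ler_sum (index_enum {perm X}) (fun p (_ : true) => pt p).
have mean i : \sum_(p : {perm X}) (b i p)%:R = #|{perm X}|%:R * (T%:R * (#|fam F s.+1 h k (w i)|%:R / 'C(N, k)%:R)) :> R.
  by rewrite /b (block_mean R cbl) ?cX ?cG.
have var : \sum_(p : {perm X}) ((b ord_max p)%:R - mu) ^+ 2 <= #|{perm X}|%:R * (2 * mu) :> R.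
  have := block_variance_le R cbl dbl k0 T1 _ (GS ord_max).
  by rewrite cX cG wmax => /(_ Tk).
have T0 : (0 : R) < T%:R by rewrite ltr0n ltnW.
have g0 : 0 <= g by rewrite divr_ge0 // ltW.
have sR : (1600 : R) <= s%:R by rewrite (ler_nat R 1600).
move: tot; rewrite !big_split /= exchange_big /= (eq_bigr _ (fun i _ => mean i)).
rewrite -mulr_sumr -mulr_sumr -mulr_suml -!mulr_sumr mean wmax -/g.
rewrite sumr_const sumrN -mulr_sumr mean wmax -/g -/mu -[_ *+ _]mulr_natl.
set Q := \sum_(p : {perm X}) _ ^+ 2 in var *; set M := #|{perm X}|%:R in Mperm var *.
set Z := \sum_i _ => tot.
have tot' : M * (T%:R * (Z / 'C(N, k)%:R) + s%:R * mu) <= M * (s%:R * T%:R).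
  (* The variance is at most 2 mu, so the quadratic term costs at most 64 mu, and s >= 1600 makes
     s/25 at least 64. *)
  have h1 : 0 <= M * mu * (s%:R / 25 - 64) by apply: mulr_ge0; [apply: mulr_ge0; [exact: ltW | apply: mulr_ge0 => //; exact: ltW] | lra].
  have h2 : 32 * Q <= 32 * (M * (2 * mu)) by rewrite ler_pM2l.
  move: tot; rewrite mulrDr. nra.
rewrite -(ler_nat R) natrD !natrM natr_sum (sum_iv sn) -/Z.
move: tot'; rewrite ler_pM2l // /mu /g.
set f := #|fam _ _ _ _ xs|%:R.
have -> : T%:R * (Z / 'C(N, k)%:R) + s%:R * (T%:R * (f / 'C(N, k)%:R)) =
  T%:R * ((Z + s%:R * f) / 'C(N, k)%:R) by ring.
by rewrite [leRHS]mulrC ler_pM2l // ler_pdivrMr.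
Qed.

(** * The numerical inequality *)

(* Bernstein products: a polynomial with nonnegative Bernstein coefficients on
   the rectangle is a nonnegative combination of these *)
Lemma bernstein_ge0 (R : realFieldType) (a b c d v w : R) i i' j j' :
  a <= v <= b -> c <= w <= d ->
  0 <= (v - a) ^+ i * (b - v) ^+ i' * ((w - c) ^+ j * (d - w) ^+ j').
Proof.
by case/andP => av vb /andP[cw wd]; rewrite !mulr_ge0 ?exprn_ge0 ?subr_ge0.
Qed.

Ltac bernstein4 H :=
  move: (H 0%N 4%N 0%N 2%N) (H 0%N 4%N 1%N 1%N) (H 0%N 4%N 2%N 0%N)
    (H 1%N 3%N 0%N 2%N) (H 1%N 3%N 1%N 1%N) (H 1%N 3%N 2%N 0%N)
    (H 2%N 2%N 0%N 2%N) (H 2%N 2%N 1%N 1%N) (H 2%N 2%N 2%N 0%N)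
    (H 3%N 1%N 0%N 2%N) (H 3%N 1%N 1%N 1%N) (H 3%N 1%N 2%N 0%N)
    (H 4%N 0%N 0%N 2%N) (H 4%N 0%N 1%N 1%N) (H 4%N 0%N 2%N 0%N); lra.

Ltac bernstein5 H :=
  move: (H 0%N 5%N 0%N 3%N) (H 0%N 5%N 1%N 2%N) (H 0%N 5%N 2%N 1%N) (H 0%N 5%N 3%N 0%N)
    (H 1%N 4%N 0%N 3%N) (H 1%N 4%N 1%N 2%N) (H 1%N 4%N 2%N 1%N) (H 1%N 4%N 3%N 0%N)
    (H 2%N 3%N 0%N 3%N) (H 2%N 3%N 1%N 2%N) (H 2%N 3%N 2%N 1%N) (H 2%N 3%N 3%N 0%N)
    (H 3%N 2%N 0%N 3%N) (H 3%N 2%N 1%N 2%N) (H 3%N 2%N 2%N 1%N) (H 3%N 2%N 3%N 0%N)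
    (H 4%N 1%N 0%N 3%N) (H 4%N 1%N 1%N 2%N) (H 4%N 1%N 2%N 1%N) (H 4%N 1%N 3%N 0%N)
    (H 5%N 0%N 0%N 3%N) (H 5%N 0%N 1%N 2%N) (H 5%N 0%N 2%N 1%N) (H 5%N 0%N 3%N 0%N); lra.

(** With w = k / (k + 1), level m + 1 and v = (s - m) / s, all in units of s: [tauf] is the number
    of [k]-blocks left over when 2/5 w s points are set aside from 33/20 s k; [degf] is (h - m) / (k
    + 1); [gainf] is a lower estimate of ('C(h - m - 1, k + 1) - 'C(h - s, k + 1)) / 'C(h - m - 1,
    k). *)
Definition tauf (R : realFieldType) (w : R) : R := 5 / 4 + 2 / 5 * w.
Definition degf (R : realFieldType) (v w : R) : R := v + (33 / 20 - v) * w.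
Definition gainf (R : realFieldType) (v w : R) : R := v - 10 / 33 * v ^+ 2 + 11 / 100 * (1 - w) * v ^+ 3 + 3 / 100 * v ^+ 4.

(* The slack of a convex combination, with weight l, of the two bounds of
   trace_gap at y = v, y = 7/50 and y = 1; slack_u is the case y = 1 multiplied
   by u = v + 2/5 w, needed when u < 1. *)
Definition slack_v (R : realFieldType) (v w l : R) : R :=
  tauf w * gainf v w - l * degf v w * (v + 1 / 2000) - (1 - l) * v - 7 / 1000 * tauf w.
Definition slack_0 (R : realFieldType) (v w l : R) : R :=
  tauf w * gainf v w + (7 / 50 - v) * (tauf w - 7 / 50) - l * degf v w * (v + 1 / 2000)
   - (1 - l) * (7 / 50) - 7 / 1000 * tauf w.
Definition slack_1 (R : realFieldType) (v w l : R) : R :=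
  tauf w * gainf v w + (1 - v) * (tauf w - 1) - l * degf v w * (v + 1 / 2000)
   - (1 - l) - 7 / 1000 * tauf w.
Definition slack_u (R : realFieldType) (v w l : R) : R :=
  (v + 2 / 5 * w) * (tauf w * gainf v w + (1 - v) * (tauf w - 1) - (1 - l) - 7 / 1000 * tauf w)
   - l * degf v w * (v + 1 / 2000).

(** On each of four strips in v, a weight that is affine in v and w works. The slacks then have
    degree (4, 2) in (v, w), or (5, 3) for [slack_u], and [lra] writes them as nonnegative
    combinations of Bernstein products. *)
Lemma slack_exists (R : realFieldType) (v w : R) : 0 <= v <= 1 -> 1 / 2 <= w <= 1 ->
  exists l, [/\ 0 <= l <= 1, (7 / 50 < v -> 0 <= slack_v v w l),
    (v <= 7 / 50 -> 0 <= slack_0 v w l), 0 <= slack_1 v w l & 0 <= slack_u v w l].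
Proof.
move=> /andP[v0 v1] hw; have /andP[w0 w1] := hw.
rewrite /slack_v /slack_0 /slack_1 /slack_u /tauf /degf /gainf.
have [va|va] := lerP v (7 / 50).
  exists (13 / 10 + 1 / 25 * v - 21 / 25 * w).
  have H i i' j j' := bernstein_ge0 i i' j j' (introT andP (conj v0 va)) hw.
  split=> [|//|_||]; [by lra | by bernstein4 H | by bernstein4 H | by bernstein5 H].
have [vb|vb] := lerP v (1 / 2).
  exists (371 / 250 - 261 / 500 * v - 839 / 1000 * w).
  have H i i' j j' := bernstein_ge0 i i' j j' (introT andP (conj (ltW va) vb)) hw.
  split=> [|_|//||]; [by lra | by bernstein4 H | by bernstein4 H | by bernstein5 H].
have [vc|vc] := lerP v (3 / 4).
  exists (149 / 100 - 19 / 20 * v - 47 / 100 * w).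
  have H i i' j j' := bernstein_ge0 i i' j j' (introT andP (conj (ltW vb) vc)) hw.
  split=> [|_|//||]; [by lra | by bernstein4 H | by bernstein4 H | by bernstein5 H].
exists (183 / 100 - 149 / 100 * v - 17 / 50 * w).
have H i i' j j' := bernstein_ge0 i i' j j' (introT andP (conj (ltW vc) v1)) hw.
split=> [|_|//||]; [by lra | by bernstein4 H | by bernstein4 H | by bernstein5 H].
Qed.

(** If both alternatives failed, so would their combination G with weight l. As G is concave in y,
    it is nonnegative as soon as it is so at both ends of the range of y. *)
Lemma trace_gap (R : realFieldType) (v w y q r : R) :
  0 <= v <= 1 -> 1 / 2 <= w <= 1 -> v <= y <= 1 -> 7 / 50 <= y -> 0 <= q <= 1 -> 0 <= r ->
  r <= v + 1 / 2000 - (v + 2 / 5 * w) * q ->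
  let base := tauf w * gainf v w + (y - v) * (tauf w - y) - 7 / 1000 * tauf w in
  y <= base \/ degf v w * (q * y + (1 - q) * r) <= base.
Proof.
move=> hv hw /andP[vy y1] y0 /andP[q0 q1] r0 rle base.
have [l [/andP[l0 l1] Sv S0 S1 Su]] := slack_exists hv hw.
case/andP: hv hw => v0 v1 /andP[w0 w1].
have d0 : 0 <= degf v w.
  by rewrite addr_ge0 // mulr_ge0; lra.
pose G (z : R) := tauf w * gainf v w + (z - v) * (tauf w - z) - 7 / 1000 * tauf w
  - l * (degf v w * (q * z + (1 - q) * r)) - (1 - l) * z.
suff Gy : 0 <= G y.
  have [?|by_] := lerP y base; first by left.
  have [?|bd] := lerP (degf v w * (q * y + (1 - q) * r)) base; first by right.
  exfalso; move: Gy; rewrite /G -/base.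
  have : 0 <= l * (degf v w * (q * y + (1 - q) * r) - base) by rewrite mulr_ge0 // subr_ge0 ltW.
  have [->|l1'] := eqVneq l 1; first by lra.
  have : 0 < (1 - l) * (y - base).
    by rewrite mulr_gt0 ?subr_gt0 // lt_neqAle l1' l1.
  by lra.
have mono (x z : R) : x <= z -> l * (degf v w * x) <= l * degf v w * z.
  by move=> xz; rewrite mulrA ler_wpM2l // mulr_ge0.
have qr : 0 <= q * r by rewrite mulr_ge0.
have uq : 0 <= (v + 2 / 5 * w) * q by rewrite mulr_ge0 // addr_ge0 // mulr_ge0 //; lra.
have G1 : 0 <= G 1.
  (* With u = v + 2/5 w, the hypothesis on r bounds q + (1 - q) r by v + 1/2000 if u >= 1, and u
     times it by the same amount if u < 1. *)
  have [u1|u1] := lerP 1 (v + 2 / 5 * w).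
    have qu : q <= (v + 2 / 5 * w) * q by rewrite ler_peMl.
    have /mono : (q * 1 + (1 - q) * r) <= v + 1 / 2000 by lra.
    by rewrite /G; move: S1; rewrite /slack_1; lra.
  have u0 : 0 < v + 2 / 5 * w by lra.
  rewrite -(pmulr_rge0 _ u0).
  have ur : 0 <= (1 - (v + 2 / 5 * w) * (1 - q)) * r by rewrite mulr_ge0 //; nra.
  have /mono : ((v + 2 / 5 * w) * (q * 1 + (1 - q) * r)) <= v + 1 / 2000 by nra.
  by rewrite /G; move: Su; rewrite /slack_u; nra.
(* The lower end is the larger of v and 7/50; the latter is at most u because w >= 1/2. *)
have Glow : exists2 y0, y0 <= y & 0 <= G y0.
  have [va|va] := lerP v (7 / 50).
    exists (7 / 50) => //.
    have uq' : 7 / 50 * q <= (v + 2 / 5 * w) * q by rewrite ler_wpM2r //; lra.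
    have /mono : (q * (7 / 50) + (1 - q) * r) <= v + 1 / 2000 by lra.
    by rewrite /G; move: (S0 va); rewrite /slack_0; lra.
  exists v => //.
  have hq : 0 <= (1 - q) * (v + 1 / 2000 - r) by rewrite mulr_ge0 ?subr_ge0 //; lra.
  have /mono : (q * v + (1 - q) * r) <= v + 1 / 2000 by nra.
  by rewrite /G; move: (Sv va); rewrite /slack_v; lra.
have [z zy Gz] := Glow.
have [e|z1] := eqVneq z 1; first by have -> : y = 1 by lra.
have {}z1 : z < 1 by rewrite lt_neqAle z1 (le_trans zy).
have z1' : 0 < 1 - z by rewrite subr_gt0.
rewrite -(pmulr_rge0 _ z1').
(* Concavity as an identity: the coefficient of y ^+ 2 in G is -1. *)
have -> : (1 - z) * G y = (1 - y) * G z + (y - z) * G 1 + (1 - y) * (y - z) * (1 - z).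
  by rewrite /G; ring.
have y1' : 0 <= 1 - y by rewrite subr_ge0.
have yz : 0 <= y - z by rewrite subr_ge0.
apply: addr_ge0; last by apply: mulr_ge0 (ltW z1'); apply: mulr_ge0.
by apply: addr_ge0; apply: mulr_ge0.
Qed.

(** * Dense links *)

Lemma draws_sub (T : finType) (D E : {set T}) k : D \subset E -> draws D k \subset draws E k.
Proof.
by move=> DE; apply/subsetP => A; rewrite !inE => /andP[AD ->]; rewrite (subset_trans AD DE).
Qed.

Lemma iv_sub n lo lo' hi : (lo' <= lo)%N -> iv n lo hi \subset iv n lo' hi.
Proof. by move=> ll; apply/subsetP => x; rewrite !inE => /andP[/(leq_trans ll) ->]. Qed.

Lemma fam_lower n (F : {set {set 'I_n}}) m m' h k (x : 'I_n) :
  (m' <= m)%N -> fam F m h k x \subset fam F m' h k x.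
Proof. by move=> mm; apply/setIS/draws_sub/iv_sub. Qed.

(** Exchanging p for x in the sets that contain p embeds the link of x into the link of p. *)
Lemma fam_degree n (F : {set {set 'I_n}}) m h k (p x : 'I_n) :
  shifted 0 F -> (m <= p)%N -> (p <= x)%N -> (x < h)%N ->
  (#|fam F m h k x| <= #|fam F m h k p|)%N.
Proof.
move=> Fsh mp px xh; have [->//|pnx] := eqVneq p x.
have {}px : (p < x)%N by rewrite ltn_neqAle px andbT; apply: contra pnx => /eqP/val_inj ->.
pose sw (B : {set 'I_n}) := if p \in B then x |: B :\ p else B.
rewrite -(card_in_imset (f := sw) (D := fam F m h k x)); last first.
  move=> B B'; rewrite !famE => /and3P[xB _ _] /and3P[xB' _ _]; rewrite /sw.
  case: ifP => pB; case: ifP => pB' // e.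
  - by rewrite -(swapK pB xB) e swapK.
  - by rewrite -e setU11 in xB'.
  - by rewrite e setU11 in xB.
apply/subset_leq_card/subsetP => _ /imsetP[B + ->]; rewrite !famE /sw.
case/and3P => xB BF BD; have [sB cB] := drawsP BD.
case: ifP => pB.
  have -> : p |: (x |: B :\ p) = x |: B by rewrite setUCA setD1K.
  rewrite BF !inE !negb_or pnx eqxx /= subUset sub1set inE xh andbT.
  rewrite (leq_trans mp (ltnW px)) (subset_trans (subsetDl _ _) sB) /=.
  by rewrite card_swap // cB.
rewrite pB BD andbT /=; have -> : p |: B = p |: ((x |: B) :\ x) by rewrite setU1K.
by apply: Fsh => //; rewrite !inE ?eqxx // negb_or pnx pB.
Qed.

Lemma degree_sum n (F : {set {set 'I_n}}) m h k :
  (k.+1 * #|F :&: draws (iv n m h) k.+1| = \sum_(x in iv n m h) #|fam F m h k x|)%N.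
Proof.
pose P := [set p : {set 'I_n} * 'I_n | (p.1 \in F :&: draws (iv n m h) k.+1) && (p.2 \in p.1)].
pose Q := [set p : 'I_n * {set 'I_n} | (p.1 \in iv n m h) && (p.2 \in fam F m h k p.1)].
have <- : #|Q| = (\sum_(x in iv n m h) #|fam F m h k x|)%N by apply: card_dep.
have <- : #|P| = (k.+1 * #|F :&: draws (iv n m h) k.+1|)%N.
  rewrite mulnC -sum_nat_const (card_dep _ id); apply: eq_bigr => A /setIP[_].
  by case/drawsP.
rewrite -(card_in_imset (f := fun p => (p.2, p.1 :\ p.2)) (D := P)); last first.
  move=> [A x] [B y]; rewrite !inE /= => /andP[_ xA] /andP[_ yB] [e xy].
  by rewrite -(setD1K xA) xy e setD1K.
apply: eq_card => -[x B]; apply/imsetP/idP => [[[A y]]|].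
  rewrite inE /= => /andP[/setIP[AF AD] yA] [-> ->]; have [sA cA] := drawsP AD.
  rewrite inE /= famE setD1K // AF (subsetP sA _ yA) !inE eqxx /=.
  rewrite (subset_trans (subsetDl _ _) sA) /=.
  by move: cA; rewrite (cardsD1 y) yA add1n => -[->].
rewrite inE /= famE => /andP[xI /and3P[xB BF /drawsP[sB cB]]].
exists (x |: B, x); rewrite ?setU1K // inE /= inE BF setU11 !andbT /=.
by rewrite inE cardsU1 xB cB eqxx subUset sub1set xI sB.
Qed.

(** The degree sum is split at p: every point below p has a link inside that of [i], and from p on
    the degrees are at most that of p at the lower level m. *)
Lemma empty_trace_split n (F : {set {set 'I_n}}) m h k (i p : 'I_n) :
  shifted 0 F -> (i < m.+1)%N -> (m <= p < h)%N -> (h <= n)%N ->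
  (k.+1 * #|F :&: draws (iv n m.+1 h) k.+1| <=
    (p - m) * #|fam F m.+1 h k i| + (h - p) * #|fam F m h k p|)%N.
Proof.
move=> Fsh im /andP[mp ph] hn; rewrite degree_sum (bigID (fun x : 'I_n => (x < p)%N)) /=.
apply: leq_add.
  apply: leq_trans (_ : \sum_(x in iv n m.+1 p) #|fam F m.+1 h k i| <= _)%N.
    rewrite [leqLHS](eq_bigl (fun x => x \in iv n m.+1 p)) => [|x]; last by rewrite !inE; lia.
    apply: leq_sum => x; rewrite inE => /andP[mx _].
    by apply/subset_leq_card/fam_sub => //; apply: ltnW (leq_trans im mx).
  rewrite sum_nat_const card_iv ?(ltnW (ltn_ord p)) // leq_mul2r.
  by rewrite leq_sub2l ?orbT.
apply: leq_trans (_ : \sum_(x in iv n p h) #|fam F m h k p| <= _)%N; last first.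
  by rewrite sum_nat_const card_iv.
rewrite big_mkcond [leqRHS]big_mkcond; apply: leq_sum => x _; rewrite !inE -leqNgt.
case: (leqP p x) => px; rewrite ?andbF ?andbT //=; case: (ltnP x h) => xh; rewrite ?andbF //= andbT.
case: ifP => // _; apply: leq_trans (fam_degree k Fsh mp px xh).
exact/subset_leq_card/fam_lower.
Qed.

Lemma bin_ratio N n k : (n <= N)%N -> ('C(n, k) * N ^ k <= 'C(N, k) * n ^ k)%N.
Proof.
move=> nN; elim: k => [|k IH]; first by rewrite !bin0 !expn0.
rewrite -(leq_pmul2l (ltn0Sn k)) !mulnA !mul_bin_left !expnS.
apply: leq_trans (_ : ((N - k) * n) * ('C(N, k) * n ^ k) <= _)%N; last by rewrite !mulnA; lia.
apply: leq_trans (_ : ((n - k) * N) * ('C(n, k) * N ^ k) <= _)%N; first by rewrite !mulnA; lia.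
by apply: leq_mul => //; nia.
Qed.

Lemma exprD1_ge (R : realFieldType) (x : R) k : 0 <= x ->
  1 + k%:R * x + k%:R * (k%:R - 1) / 2 * x ^+ 2 <= (1 + x) ^+ k.
Proof.
move=> x0; elim: k => [|k IH]; first by rewrite expr0 !mul0r !addr0.
have x1 : 0 <= 1 + x by rewrite addr_ge0.
have k0 : (0 : R) <= k%:R * (k%:R - 1).
  case: k {IH} => [|k]; first by rewrite mul0r.
  by rewrite mulr_ge0 ?ler0n // -natr1 addrK ler0n.
have h : 0 <= k%:R * (k%:R - 1) * x ^+ 3 by rewrite mulr_ge0 ?exprn_ge0.
rewrite [_ ^+ k.+1]exprS -natr1; move: (ler_wpM2l x1 IH); set P := (1 + x) ^+ k => /= h1.
by lra.
Qed.

Lemma bin_sub_le N V k : (V <= N)%N -> ('C(N, k.+1) <= 'C(N - V, k.+1) + V * 'C(N.-1, k))%N.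
Proof.
elim: V => [|V IH] VN; first by rewrite subn0 mul0n addn0.
apply: leq_trans (IH (ltnW VN)) _; have e : (N - V = (N - V.+1).+1)%N by lia.
rewrite mulSn addnA leq_add2r e binS leq_add2l; apply: leq_bin2l; lia.
Qed.

(** The part v - 10/33 v^2 of [gainf] is the Taylor polynomial in v of [degf v w] (z + z^2/2) / (w +
    z + z^2/2), so the difference of the two sides is v^3 P. The remaining terms of [gainf] are
    small enough to leave P nonnegative on the rectangle. *)
Lemma gainf_le (R : realFieldType) (v w z : R) : 0 <= v <= 1 -> 1 / 2 <= w <= 1 ->
  z = 20 / 33 * v -> gainf v w * (w + (z + z ^+ 2 / 2)) <= degf v w * (z + z ^+ 2 / 2).
Proof.
move=> hv hw ->; have v0 : 0 <= v by case/andP: hv.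
have H i i' j j' := bernstein_ge0 i i' j j' hv hw.
rewrite -subr_ge0; pose P : R := 200 / 1089 - 113 * 283 / (100 * 1089) * w + 11 / 100 * w ^+ 2
  - 1979 / (165 * 1089) * v + 11 / 300 * (v * w) - 19 / 495 * v ^+ 2 + 2 / 99 * (v ^+ 2 * w) - 2 / 363 * v ^+ 3.
have P0 : 0 <= P.
  rewrite /P; move: (H 0%N 3%N 0%N 2%N) (H 0%N 3%N 1%N 1%N) (H 0%N 3%N 2%N 0%N)
    (H 1%N 2%N 0%N 2%N) (H 1%N 2%N 1%N 1%N) (H 1%N 2%N 2%N 0%N)
    (H 2%N 1%N 0%N 2%N) (H 2%N 1%N 1%N 1%N) (H 2%N 1%N 2%N 0%N)
    (H 3%N 0%N 0%N 2%N) (H 3%N 0%N 1%N 1%N) (H 3%N 0%N 2%N 0%N); lra.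
rewrite (_ : _ - _ = v ^+ 3 * P) ?mulr_ge0 ?exprn_ge0 //.
by rewrite /P /degf /gainf; field.
Qed.

Tactic Notation "lra_from" ne_hyp_list(hs) := clear - hs; lra.

(** The situation of [large_trace] in real numbers. Level m + 1 gets stuck at i with link density a,
    level m at p with density b; V is s - m, n1 is h - s, q is (p - m) / (h - m), E the sampling
    error. In units of 'C(h - m - 1, k), f is the number of members avoiding [0, m], ga is the gain,
    and c converts b. The shadow and the degrees bound f from above, the count at level m + 1 from
    below; with y = (s - i) / s and r = [tauf w] b this contradicts [trace_gap], whose terms 7/1000
    and 1/2000 absorb the errors. *)
Lemma trace_contra (R : realFieldType) (S K V n1 U T i q a b c f E ga : R) :
  let w := K / (K + 1) in let v := V / S in
  1 <= K -> 6000 <= S -> 0 <= V <= S -> 0 <= E -> E + 3 <= S / 2000 ->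
  n1 <= 33 / 20 * (S * K) + 1 ->
  2 / 5 * w * S <= U + 1 -> tauf w * S - 2 <= T ->
  0 <= a <= 1 -> i + T * a <= S + E -> 0 <= i -> i <= 43 / 50 * S -> i <= S - V ->
  0 <= b <= 1 -> 0 <= q <= 1 -> (V + 1 + U) * q + T * b <= V + 1 + E ->
  0 <= c -> c <= 1 + 1 / S -> 0 <= n1 + V ->
  (K + 1) * f <= (n1 + V) * (q * a + (1 - q) * (b * c)) -> f <= S * a ->
  (S + 1 - V - i) * (1 - a) + ga < f -> gainf v w * S - 5 <= ga -> False.
Proof.
move=> w v K1 S0 /andP[V0 VS] E0 ES n1le Ule Tge /andP[a0 a1] Ha i0 i86 iV /andP[b0 b1].
move=> /andP[q0 q1] Hb c0 cle N0 Hf Hf' Hlev Hga.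
have Sp : 0 < S by lra_from S0.
have k0 : 0 < K + 1 by lra_from K1.
have wk : w * (K + 1) = K by rewrite /w divfK // gt_eqF.
have w12 : 1 / 2 <= w <= 1 by rewrite ler_pdivlMr // ler_pdivrMr //; lra_from K1.
have vS : v * S = V by rewrite /v divfK // gt_eqF.
have v01 : 0 <= v <= 1 by rewrite ler_pdivlMr // ler_pdivrMr //; lra_from V0 VS.
clearbody w v.
pose y := (S - i) / S; have yS : y * S = S - i by rewrite /y divfK // gt_eqF.
have y1 : v <= y <= 1.
  by apply/andP; split; rewrite -(ler_pM2r Sp) ?vS yS; lra_from iV i0.
have y0 : 7 / 50 <= y by rewrite -(ler_pM2r Sp) yS; lra_from i86.
clearbody y; set t := tauf w in Tge *.
have t1 : 29 / 20 <= t <= 33 / 20 by rewrite /t /tauf; lra_from w12.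
case/andP: (v01) (w12) (y1) (t1) => v0 v1 /andP[w0 w1] /andP[vy y1'] /andP[t0 t1'].
have ta : t * a * S <= y * S + E + 2.
  have h : (t * S - 2) * a <= T * a by rewrite ler_wpM2r.
  by lra_from h a1 Ha yS.
have tp : 0 <= t by lra_from t0.
have tb0 : 0 <= t * b by rewrite mulr_ge0.
have u0 : 0 <= v + 2 / 5 * w by lra_from v0 w0.
have rle : t * b <= v + 1 / 2000 - (v + 2 / 5 * w) * q.
  rewrite -(ler_pM2r Sp).
  have h1 : (t * S - 2) * b <= T * b by rewrite ler_wpM2r.
  have h2 : (V + 2 / 5 * w * S) * q <= (V + 1 + U) * q by rewrite ler_wpM2r //; lra_from Ule.
  have h3 : (V + 2 / 5 * w * S) * q = (v + 2 / 5 * w) * q * S by rewrite -vS; ring.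
  by rewrite h3 in h2; lra_from h1 h2 Hb b1 vS ES.
pose d := degf v w; pose X := q * y + (1 - q) * (t * b).
have uq0 : 0 <= (v + 2 / 5 * w) * q by rewrite mulr_ge0.
have q1' : 0 <= 1 - q by rewrite subr_ge0.
have yp : 0 <= y := le_trans v0 vy.
have X0 : 0 <= X by rewrite /X addr_ge0 // mulr_ge0.
have tb2 : t * b <= 2 by lra_from rle uq0 v1.
have X2 : X <= 2.
  have : q * y <= q * 2 by rewrite ler_wpM2l //; lra_from y1'.
  have : (1 - q) * (t * b) <= (1 - q) * 2 by rewrite ler_wpM2l.
  by rewrite /X; clear; lra.
have d2 : 0 <= d <= 2.
  have h1 : v * w <= v by rewrite ler_piMr.
  have h2 : 0 <= (1 - v) * (1 - w) by rewrite mulr_ge0 // subr_ge0.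
  by rewrite /d /degf; apply/andP; split; lra_from h1 h2 w0 w1 v0 v1.
case/andP: d2 => d0 d2.
have dk : d * S * (K + 1) = V + 33 / 20 * (S * K).
  have -> : d * S * (K + 1) = v * S * (K + 1) + (33 / 20 - v) * S * (w * (K + 1)) by rewrite /d /degf; ring.
  by rewrite wk -vS; ring.
have lev : S * ((y - v) * (t - y) + t * gainf v w) - (E + 2) - 9 <= t * f.
  have h1 : S * (y - v) * (1 - a) <= (S + 1 - V - i) * (1 - a).
    by rewrite ler_wpM2r ?subr_ge0 // mulrBr ![S * _]mulrC yS vS; clear; lra.
  have h2 : t * (S * (y - v) * (1 - a) + gainf v w * S - 5) <= t * f.
    by rewrite ler_wpM2l //; lra_from h1 Hlev Hga.
  have h3 : (y - v) * (t * a * S) <= (y - v) * (y * S + E + 2).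
    by rewrite ler_wpM2l ?subr_ge0.
  have h4 : (y - v) * (E + 2) <= 1 * (E + 2) by rewrite ler_wpM2r //; [lra_from E0 | lra_from y1' v0].
  have -> : S * ((y - v) * (t - y) + t * gainf v w) = t * (S * (y - v) * 1 + gainf v w * S) - (y - v) * (y * S) by ring.
  by lra_from h2 h3 h4 t1'.
have [h|h] := trace_gap v01 w12 y1 y0 (introT andP (conj q0 q1)) tb0 rle; rewrite -/t in h.
  have h1 : t * f <= t * (S * a) by rewrite ler_wpM2l.
  have h2 : y * S <= ((t * gainf v w + (y - v) * (t - y)) - 7 / 1000 * t) * S by rewrite ler_pM2r.
  have h3 : 29 / 20 * S <= t * S by rewrite ler_pM2r.
  by lra_from h1 h2 h3 lev ta ES S0.
have h1 : (K + 1) * (t * f) <= (n1 + V) * (X + (E + 5) / S).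
  have h2 : t * ((K + 1) * f) <= t * ((n1 + V) * (q * a + (1 - q) * (b * c))).
    by rewrite ler_wpM2l.
  rewrite mulrCA; apply: le_trans h2 _.
  rewrite mulrCA ler_wpM2l //.
  have h3 : q * (t * a) <= q * y + (E + 2) / S.
    have h4 : t * a - y <= (E + 2) / S by rewrite ler_pdivlMr //; lra_from ta.
    have h5 : 0 <= (E + 2) / S by rewrite divr_ge0 ?(ltW Sp) //; lra_from E0.
    have h6 : q * (t * a - y) <= q * ((E + 2) / S) by rewrite ler_wpM2l.
    have h7 : q * ((E + 2) / S) <= (E + 2) / S by rewrite ler_piMl.
    by lra_from h6 h7.
  have h8 : (1 - q) * (t * b * c) <= (1 - q) * (t * b) + 2 / S.
    have h9 : (1 - q) * (t * b) * c <= (1 - q) * (t * b) * (1 + 1 / S).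
      by rewrite ler_wpM2l // mulr_ge0.
    have h10 : (1 - q) * (t * b) <= 2.
      by have hqb : 0 <= q * (t * b); [rewrite mulr_ge0 | lra_from hqb tb2].
    have h11 : (1 - q) * (t * b) * (1 / S) <= 2 * (1 / S).
      by rewrite ler_wpM2r // divr_ge0 // ltW.
    by lra_from h9 h11.
  have -> : (E + 5) / S = (E + 2) / S + 2 / S + 1 / S by rewrite -!mulrDl; congr (_ / _); ring.
  have h12 : 0 <= 1 / S by rewrite divr_ge0 // ltW.
  by rewrite /X; lra_from h3 h8 h12.
have ES0 : 0 <= (E + 5) / S by rewrite divr_ge0 ?(ltW Sp) //; lra_from E0.
have ESS : (E + 5) / S * S = E + 5 by rewrite divfK // gt_eqF.
have h2 : (K + 1) * (t * f) <= (K + 1) * ((d * S + 1) * (X + (E + 5) / S)).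
  apply: le_trans h1 _; rewrite [leRHS]mulrA.
  have XE : 0 <= X + (E + 5) / S by apply: addr_ge0.
  rewrite ler_wpM2r //.
  rewrite mulrC; lra_from dk n1le K1.
rewrite ler_pM2l // in h2.
have h3 : d * (E + 5) <= 2 * (E + 5) by rewrite ler_wpM2r //; lra_from E0.
have h4 : (E + 5) / S <= 1 by rewrite ler_pdivrMr //; lra_from ES S0.
have h5 : (d * S + 1) * (X + (E + 5) / S) <= d * X * S + 2 * (E + 5) + 3.
  have -> : (d * S + 1) * (X + (E + 5) / S) = d * X * S + d * ((E + 5) / S * S) + X + (E + 5) / S by ring.
  by rewrite ESS; lra_from h3 h4 X2.
have h6 : d * X * S <= ((t * gainf v w + (y - v) * (t - y)) - 7 / 1000 * t) * S by rewrite ler_pM2r.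
have h7 : 29 / 20 * S <= t * S by rewrite ler_pM2r.
by lra_from h2 h5 h6 h7 lev ES S0.
Qed.

Lemma gainf_lip (R : realFieldType) (v v' w : R) : 0 <= v' -> v' <= v -> v <= 1 ->
  1 / 2 <= w <= 1 -> gainf v w - gainf v' w <= 2 * (v - v').
Proof.
move=> v0 vv v1 /andP[w0 w1].
have v0' : 0 <= v := le_trans v0 vv.
have vp1 : v' <= 1 := le_trans vv v1.
have p2 : v ^+ 2 + v * v' + v' ^+ 2 <= 3.
  have : v * v' <= 1 by rewrite mulr_ile1.
  have : v ^+ 2 <= 1 by rewrite expr_le1.
  have : v' ^+ 2 <= 1 by rewrite expr_le1.
  by lra.
have p2' : 0 <= v ^+ 2 + v * v' + v' ^+ 2 by rewrite !addr_ge0 ?mulr_ge0 ?sqr_ge0.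
have p3 : (v + v') * (v ^+ 2 + v' ^+ 2) <= 4.
  have h1 : v ^+ 2 <= 1 by rewrite expr_le1.
  have h2 : v' ^+ 2 <= 1 by rewrite expr_le1.
  have h3 : 0 <= v ^+ 2 + v' ^+ 2 by rewrite addr_ge0 ?sqr_ge0.
  have : (v + v') * (v ^+ 2 + v' ^+ 2) <= 2 * (v ^+ 2 + v' ^+ 2) by rewrite ler_wpM2r //; lra_from v1 vp1.
  by lra_from h1 h2.
have p4 : (1 - w) * (v ^+ 2 + v * v' + v' ^+ 2) <= 1 * (v ^+ 2 + v * v' + v' ^+ 2).
  by rewrite ler_wpM2r //; lra_from w0.
have -> : gainf v w - gainf v' w = (v - v') * (1 - 10 / 33 * (v + v')
   + 11 / 100 * ((1 - w) * (v ^+ 2 + v * v' + v' ^+ 2)) + 3 / 100 * ((v + v') * (v ^+ 2 + v' ^+ 2))).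
  by rewrite /gainf; ring.
by rewrite [leRHS]mulrC ler_wpM2l ?subr_ge0 //; lra_from p4 p3 p2 v0 v0'.
Qed.

(** The ratio of the two upper binomials is at least (1 + x)^(k + 1) with x the relative increase of
    n1; expanding to second order gives the expression treated by [gainf_le]. *)
Lemma gain_bound (R : realFieldType) k n1 V s :
  (0 < k)%N -> (0 < s)%N -> (V <= s)%N -> (33 * s * k <= 20 * n1)%N -> (20 * n1 <= 33 * s * k + 20)%N ->
  gainf (V%:R / s%:R) (k%:R / (k%:R + 1)) * s%:R - 5 <=
  ('C((n1 + V).-1, k.+1)%:R - 'C(n1, k.+1)%:R) / 'C((n1 + V).-1, k)%:R :> R.
Proof.
move=> k0 s0 Vs n1g n1l.
have kn : (k < n1)%N by nia.
have C0 : (0 : R) < 'C((n1 + V).-1, k)%:R by rewrite ltr0n bin_gt0; lia.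
rewrite ler_pdivlMr //.
case: V Vs C0 => [|V] Vs C0.
  have -> : 'C(n1, k.+1) = ('C((n1 + 0).-1, k.+1) + 'C((n1 + 0).-1, k))%N.
    by rewrite addn0; case: (n1) kn => // n _; rewrite binS.
  by rewrite /gainf mul0r natrD; lra_from C0.
move: C0; rewrite addnS /= => C0.
set S : R := s%:R; set K : R := k%:R; set w := K / (K + 1); set v := V.+1%:R / S; set M : R := n1%:R.
have S0 : 0 < S by rewrite ltr0n.
have K1 : 1 <= K by rewrite ler1n.
have k1 : 0 < K + 1 by lra_from K1.
have wk : w * (K + 1) = K by rewrite /w divfK // gt_eqF.
have w12 : 1 / 2 <= w <= 1 by rewrite ler_pdivlMr // ler_pdivrMr //; lra_from K1.
have vS : v * S = V.+1%:R by rewrite /v divfK // gt_eqF.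
have v1 : v <= 1 by rewrite ler_pdivrMr // mul1r ler_nat.
have Mg : 33 * S * K <= 20 * M by move: n1g; rewrite -(ler_nat R) !natrM.
have Ml : 20 * M <= 33 * S * K + 20 by move: n1l; rewrite -(ler_nat R) natrD !natrM.
have M0 : 0 < M by rewrite ltr0n; lia.
clearbody w v.
pose x := V%:R / M; have xM : x * M = V%:R by rewrite /x divfK // gt_eqF.
have x0 : 0 <= x by rewrite divr_ge0 // ltW.
pose z := K * x; have z0 : 0 <= z by rewrite mulr_ge0 //; lra_from K1.
pose zz := z + z ^+ 2 / 2; have zz0 : 0 <= zz by rewrite addr_ge0 // divr_ge0 // sqr_ge0.
have w0 : 0 < w by lra_from w12.
set CN : R := 'C(n1 + V, k.+1)%:R; set Cn : R := 'C(n1, k.+1)%:R; set C : R := 'C(n1 + V, k)%:R in C0 *.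
have CNE : (K + 1) * CN = (M + V%:R - K) * C.
  have := mul_bin_left (n1 + V) k => /(congr1 (fun m => m%:R : R)).
  rewrite !natrM -natr1 natrB ?natrD //.
  exact: leq_trans (ltnW kn) (leq_addr V n1).
have rat : Cn * (1 + x) ^+ k.+1 <= CN.
  have := bin_ratio k.+1 (leq_addr V n1); rewrite -(ler_nat R) !natrM !natrX natrD -/CN -/Cn -/M -xM.
  have -> : M + x * M = (1 + x) * M by ring.
  by rewrite exprMn mulrA ler_pM2r // exprn_gt0.
have rat2 : Cn * (w + zz) <= CN * w.
  have h1 : 1 + (K + 1) * x + (K + 1) * (K + 1 - 1) / 2 * x ^+ 2 <= (1 + x) ^+ k.+1.
    by have := exprD1_ge k.+1 x0; rewrite -natr1.
  have h2 : (1 + z / w + z ^+ 2 / w / 2) * w = w + zz.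
    by rewrite /zz; field; rewrite gt_eqF.
  rewrite -h2 mulrA ler_pM2r //; apply: le_trans rat; rewrite ler_wpM2l ?ler0n //.
  apply: le_trans h1; rewrite le_eqVlt; apply/orP; left; apply/eqP.
  have kw : K / w = K + 1 by rewrite -{1}wk mulrC mulKf ?gt_eqF.
  have e : (K + 1) * (K + 1 - 1) = K * K / w by rewrite addrK -kw mulrAC.
  have e' : (K + 1) * x = K * x / w by rewrite -kw mulrAC.
  by rewrite e e' /z; ring.
have main : zz * CN <= (CN - Cn) * (w + zz) by lra_from rat2.
(* [gainf_le] needs z to be exactly 20/33 of its argument. This [v'] differs from v by at most 2/s,
   so [gainf_lip] bounds the loss. *)
pose v' := 33 / 20 * z.
have v'M : v' * M = 33 / 20 * (K * V%:R) by rewrite -xM /v' /z; ring.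
have vle : v' <= v.
  rewrite -(ler_pM2r M0) v'M.
  have h1 : v * (33 * S * K) <= v * (20 * M) by rewrite ler_wpM2l // -(ler_pM2r S0) vS mul0r.
  have h2 : v * (33 * S * K) = 33 * (K * (V%:R + 1)) by rewrite natr1 -vS; ring.
  by move: h1; rewrite h2; lra_from K1.
have v'0 : 0 <= v' by rewrite mulr_ge0 // divr_ge0 ?ler0n.
have vge : (v - v') * S <= 2.
  have h1 : v' * (20 * M) <= v' * (33 * S * K + 20) by rewrite ler_wpM2l.
  have h2 : v' <= 1 := le_trans vle v1.
  rewrite -(ler_pM2r (lt_le_trans ltr01 K1)).
  have h3 : (v - v') * S * K = (V%:R + 1) * K - v' * (S * K) by rewrite natr1 -vS; ring.
  by rewrite h3; lra_from h1 h2 v'M K1.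
have dd : degf v' w <= degf v w.
  have h : (v' - v) * (1 - w) <= 0 by rewrite mulr_le0_ge0 ?subr_le0 ?subr_ge0 //; case/andP: w12.
  by rewrite /degf; lra_from h.
have dk : degf v w * S * (K + 1) = V%:R + 1 + 33 / 20 * (S * K).
  have -> : degf v w * S * (K + 1) = v * S * (K + 1) + (33 / 20 - v) * S * (w * (K + 1)) by rewrite /degf; ring.
  by rewrite wk natr1 -vS; ring.
have CNg : (degf v w * S - 1) * C <= CN.
  rewrite -(ler_pM2l k1) CNE mulrA ler_pM2r //; lra_from dk Mg.
have v'1 : 0 <= v' <= 1 by rewrite v'0 (le_trans vle v1).
have gl : gainf v' w * (w + zz) <= degf v' w * zz.
  by apply: gainf_le => //; rewrite /v'; field.
have wz : 0 < w + zz by rewrite ltr_pwDl.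
rewrite -(ler_pM2r wz); apply: le_trans main.
have h1 : zz * ((degf v' w * S - 1) * C) <= zz * CN.
  rewrite ler_wpM2l //; apply: le_trans CNg; rewrite ler_pM2r // lerD2r ler_pM2r //.
have h2 : gainf v w * S - 5 <= gainf v' w * S - 1.
  have := gainf_lip v'0 vle v1 w12; rewrite -(ler_pM2r S0).
  by lra_from vge.
have h3 : (gainf v' w * S - 1) * (w + zz) <= zz * (degf v' w * S - 1).
  have h4 : gainf v' w * (w + zz) * S <= degf v' w * zz * S by rewrite ler_pM2r.
  by lra_from h4 w0.
apply: le_trans h1; rewrite mulrAC mulrA ler_pM2r //; apply: le_trans h3.
by rewrite ler_pM2r.
Qed.

Lemma floorR (R : realFieldType) a b : (0 < b)%N ->
  (a %/ b)%:R * b%:R <= a%:R :> R /\ a%:R < ((a %/ b)%:R + 1) * b%:R :> R.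
Proof. by move=> b0; rewrite natr1 -!natrM ler_nat ltr_nat leq_divM ltn_ceil. Qed.

(** Lowering the start of the interval from s + 1 to m makes at most 20/33 of the [k]-sets new, so
    'C(h - s - 1, k) is at least 13/33 of 'C(h - m, k); a density of 1/4 at s + 1 leaves 13/132. *)
Lemma trace_dens_ge (R : realFieldType) n (F : {set {set 'I_n}}) s m h k (i xs : 'I_n) :
  (0 < k)%N -> (0 < s)%N -> (h <= n)%N -> xs = s :> nat -> (s < h)%N -> (33 * s * k <= 20 * (h - s))%N ->
  shifted 0 F -> (i < m <= s.+1)%N ->
  ('C(h - s.+1, k) <= 4 * #|fam F s.+1 h k xs|)%N ->
  13 / 132 <= dens R F m h k i.
Proof.
move=> k0 s0 hn xsE sh n1g Fsh /andP[im ms] big.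
have k33 : (33 * k <= 20 * (h - s))%N.
  by apply: leq_trans n1g; rewrite mulnAC leq_pmulr.
have kN : (k <= h - m)%N by lia.
have C0 : (0 : R) < 'C(h - m, k)%:R by rewrite ltr0n bin_gt0.
rewrite /dens ler_pdivlMr //.
have le1 : (#|fam F s.+1 h k xs| <= #|fam F m h k i|)%N.
  apply: leq_trans (subset_leq_card (fam_lower F h k xs ms)) (subset_leq_card (fam_sub h k Fsh _ im)).
  by rewrite xsE -ltnS (leq_trans im ms).
have key : (33 * ('C(h - m, k) - 'C(h - s.+1, k)) <= 20 * 'C(h - m, k))%N.
  case: k k0 kN n1g {k33 big le1 C0} => // k _ kN n1g.
  have := @bin_sub_le (h - m) (s.+1 - m) k (leq_sub2r _ sh).
  rewrite (_ : (h - m - (s.+1 - m) = h - s.+1)%N); last by rewrite -subnDA subnKC.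
  have := mul_bin_diag (h - m) k.
  have : (33 * (s.+1 - m) * k.+1 <= 20 * (h - m))%N.
    move: ms; rewrite leq_eqVlt => /orP[/eqP ->|ms']; first by rewrite subnn muln0.
    apply: leq_trans (leq_trans n1g _); last by rewrite leq_mul2l leq_sub2l.
    by rewrite leq_mul2r leq_mul2l /=; lia.
  set A := 'C(_, k.+1); set B := 'C(_.-1, k); set D := 'C(_, _).
  move: (h - m)%N (s.+1 - m)%N kN => N V kN h1 h2 h3.
  rewrite -(leq_pmul2l (leq_ltn_trans (leq0n k) kN)).
  apply: leq_trans (_ : N * (33 * (V * B)) <= _)%N.
    by rewrite !leq_mul2l leq_subLR h3 !orbT.
  rewrite (mulnCA N 33) (mulnCA N V) mulnA h2 mulnA [leqRHS]mulnA (mulnC N).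
  by rewrite leq_mul2r h1 orbT.
have key' : (13 * 'C(h - m, k) <= 132 * #|fam F m h k i|)%N by lia.
by move: key'; rewrite -(ler_nat R) !natrM; lra.
Qed.

Lemma large_trace (R : realFieldType) n (F : {set {set 'I_n}}) s h k (xs : 'I_n) :
  (0 < k)%N -> (h <= n)%N -> xs = s :> nat -> (s < h)%N ->
  (33 * s * k <= 20 * (h - s))%N -> (20 * (h - s) <= 33 * s * k + 20)%N ->
  F \subset draws (iv n 0 h) k.+1 -> shifted 0 F -> nomatch s F ->
  1000 ^+ 5 <= s%:R :> R ->
  ('C(h - s.+1, k) <= 4 * #|fam F s.+1 h k xs|)%N ->
  (#|F| + 'C(h - s, k.+1) <= 'C(h, k.+1))%N.
Proof.
move=> k0 hn xsE sh n1g n1l FD Fsh Fs s_big big.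
set S : R := s%:R in s_big; set K : R := k%:R; pose w := K / (K + 1).
have S1 : 1000 * 1000 * 1000 <= S.
  by apply: le_trans s_big; rewrite exprS; lra.
have K1 : 1 <= K by rewrite ler1n.
have k1 : 0 < K + 1 by lra_from K1.
have wk : w * (K + 1) = K by rewrite /w divfK // gt_eqF.
have w12 : 1 / 2 <= w <= 1 by rewrite ler_pdivlMr // ler_pdivrMr //; lra_from K1.
have sp : (0 < s)%N by rewrite -(ltr_nat R) -/S; lra_from S1.
set M : R := (h - s)%:R.
have Mg : 33 * S * K <= 20 * M by move: n1g; rewrite -(ler_nat R) !natrM.
have Ml : 20 * M <= 33 * S * K + 20 by move: n1l; rewrite -(ler_nat R) natrD !natrM.
(* [U0] is the number 2/5 w s of points beyond the s + 1 needed to reach rank s. *)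
pose U0 := ((2 * k * s) %/ (5 * k.+1))%N; pose T := ((h - s.+1 - U0) %/ k)%N.
(* The error g + 2 d is about 3 s / 8000, below the s / 2000 that [trace_contra] admits; L cells of
   length g reach past s + 1 + [U0], and s >= 1000^5 makes d^2 exceed the union bound over 2 L
   deviations. *)
pose g := (s %/ (8 * 1000))%N; pose d : R := S / (8 * 1000); pose L := (40 * 1000)%N.
have U0s : (U0 <= s)%N.
  rewrite /U0 -ltnS ltn_divLR //; apply: leq_ltn_trans (_ : s * (5 * k.+1) < _)%N.
    by rewrite mulnC leq_mul2l; apply/orP; right; clear; lia.
  by rewrite ltn_mul2r ltnSn.
have s33 : (33 * s <= 20 * (h - s))%N by apply: leq_trans n1g; rewrite leq_pmulr.
have U0h : (s.+1 + U0 <= h)%N by clear - U0s s33 sp; lia.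
have [U0l U0g] : U0%:R <= 2 / 5 * w * S /\ 2 / 5 * w * S <= U0%:R + 1.
  have [l1 l2] := @floorR R (2 * k * s) (5 * k.+1) isT.
  have e : 2 / 5 * w * S * (5 * (K + 1)) = 2 * K * S by rewrite -[in RHS]wk; field.
  have k5 : 0 < 5 * (K + 1) by rewrite mulr_gt0.
  move: l1 l2; rewrite -/U0 !natrM -(natr1 k) -/K -/S -e ler_pM2r // ltr_pM2r // => -> /ltW ->.
  by [].
have Kp : 0 < K by lra_from K1.
have [Tl Tg] : T%:R * K <= M - 1 - U0%:R /\ M - 1 - U0%:R < (T%:R + 1) * K.
  have [l1 l2] := @floorR R (h - s.+1 - U0) k k0; move: l1 l2; rewrite -/T -/K.
  have e0 : (h - s = (h - s.+1 - U0) + U0.+1)%N by clear - U0h; lia.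
  by rewrite /M e0 natrD -(natr1 U0) => l1 l2; split; lra_from l1 l2.
have [S0 S15] : 0 < S /\ 500 * 1000 * (64 * 1000 * 1000) <= S.
  by split; [lra_from S1|apply: le_trans s_big; rewrite !exprS; clear; lra].
have [gl gg] := @floorR R s (8 * 1000) isT; rewrite -/g natrM -/S in gl gg.
have dS : d * (8 * 1000) = S by rewrite /d divfK // gt_eqF // mulr_gt0.
have Tge : tauf w * S - 2 <= T%:R.
  rewrite -(ler_pM2r Kp); have h1 : w * S * (K + 1) = S * K by rewrite -[in RHS]wk; ring.
  by rewrite /tauf; lra_from h1 Tg Mg U0l K1.
have Tle : T%:R <= 33 / 20 * S + 1.
  rewrite -(ler_pM2r Kp); have h1 : (0 : R) <= U0%:R by rewrite ler0n.
  by lra_from h1 Tl Ml K1.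
have [w0 w1] : 1 / 2 <= w /\ w <= 1 by case/andP: w12.
have wS0 : 1 / 2 * S <= w * S by rewrite ler_pM2r.
have wS1 : w * S <= 1 * S by rewrite ler_pM2r.
have T1 : (1 < T)%N by rewrite -(ltr_nat R); move: Tge; rewrite /tauf; lra_from S1 wS0.
have U01 : (2 < U0)%N by rewrite -(ltr_nat R); lra_from U0g wS0 S1.
have g0 : (0 < g)%N by rewrite -(ltr_nat R); lra_from gg S1.
have gL : (s.+1 + U0 < L * g)%N.
  rewrite -(ltr_nat R) natrD -(natr1 s) !natrM -/S; lra_from gg S1 U0l wS1.
have d0 : 0 < d by rewrite divr_gt0 // mulr_gt0.
have Tk : (T * k <= h - s.+1 - U0)%N by apply: leq_divM.
have dich m : (m <= s.+1)%N -> exists y : 'I_n, [/\ (y < h)%N, (y < m)%N || (m <= s)%N &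
    (pos m (s.+1 - m + U0) (h - m) y)%:R + T%:R * dens R F m h k y <= S + g%:R + 2 * d].
  move=> ms; apply: (@dichotomy R n F s m h k T (s.+1 - m + U0) g L d) => //.
  - by clear - U01; lia.
  - by clear - Tk ms U0h sh; lia.
  - by rewrite hn andbT; apply: leq_trans ms sh.
  - by clear - U01 ms; lia.
  - by rewrite ltn_divLR // addnA subnKC.
  - have h1 : (s.+1 - m + U0)%:R <= S + 1 + U0%:R :> R.
      by rewrite natrD lerD2r natr1 ler_nat leq_subr.
    have h2 : d ^+ 2 * (64 * 1000 * 1000) = S * S by rewrite -dS; ring.
    have h3 : 500 * 1000 * (64 * 1000 * 1000) * S <= S * S by rewrite ler_pM2r.
    rewrite -muln2 !natrM; lra_from h1 h2 h3 Tle S1 U0l wS1.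
pose E : R := g%:R + 2 * d.
have E0 : 0 <= E by rewrite addr_ge0 ?ler0n // mulr_ge0 // ltW.
have ES : E + 3 <= S / 2000 by rewrite /E; lra_from gl dS S1.
pose A m := [exists y : 'I_n, (y < m)%N && (y%:R + T%:R * dens R F m h k y <= S + E)].
have A1 : A s.+1.
  have [y [_ ym yle]] := dich _ (leqnn _).
  rewrite ltnn orbF in ym; apply/existsP; exists y; rewrite ym /=.
  by move: yle; rewrite /pos ym -addrA.
(* Let m be the least level at which the greedy matching can get stuck at some
   i < m; at level m - 1 it is then stuck at some p >= m - 1. *)
case: (ex_minnP (ex_intro A _ A1)) => m /existsP[i /andP[im Ai]] mmin.
have ms : (m <= s.+1)%N := mmin _ A1.
case: m im ms Ai mmin => // m im ms Ai mmin.
have [p [ph _ ple]] := dich m (ltnW ms).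
have mp : (m <= p)%N.
  rewrite leqNgt; apply/negP => pm; suff /mmin : A m by rewrite ltnn.
  apply/existsP; exists p; rewrite pm /=; move: ple.
  by rewrite /pos pm -addrA.
have mh : (m.+1 <= h)%N := leq_trans ms sh.
have ms' : (m <= s)%N := ms.
pose V : R := (s - m)%:R; pose N' : R := (h - m)%:R.
have VE : V = S - m%:R by rewrite /V natrB.
have NE : (h - m = (h - s) + (s - m))%N by clear - sh ms'; lia.
have N1E : (h - m.+1 = ((h - s) + (s - m)).-1)%N by rewrite -NE subnS.
have N'E : N' = M + V by rewrite /N' NE natrD.
have kN : (k < h - m.+1)%N.
  have k33 : (33 * k <= 20 * (h - s))%N by apply: leq_trans n1g; rewrite mulnAC leq_pmulr.
  have h2 : (33 * 2 * k <= 20 * (h - s))%N.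
    have s2 : (2 <= s)%N by rewrite -(ler_nat R) -/S; lra_from S1.
    by apply: leq_trans n1g; rewrite leq_mul2r leq_mul2l s2 !orbT.
  by rewrite N1E; clear - h2 k0; lia.
have kN' : (k <= h - m)%N by apply: leq_trans (ltnW kN) _; rewrite leq_sub2l.
set C : R := 'C(h - m.+1, k)%:R; set C' : R := 'C(h - m, k)%:R.
have C0 : 0 < C by rewrite /C ltr0n bin_gt0 ltnW.
have C'0 : 0 < C' by rewrite /C' ltr0n bin_gt0.
have N0 : 0 < N' by rewrite /N' ltr0n subn_gt0.
set a := dens R F m.+1 h k i in Ai *; set b := dens R F m h k p in ple *.
have a01 : 0 <= a <= 1 by rewrite /a dens_ge0 dens_le1 // ltnW.
have b01 : 0 <= b <= 1 by rewrite /b dens_ge0 dens_le1.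
have aC : a * C = #|fam F m.+1 h k i|%:R by rewrite /a /dens divfK // gt_eqF.
have bC : b * C' = #|fam F m h k p|%:R by rewrite /b /dens divfK // gt_eqF.
have alow : 13 / 132 <= a.
  by apply: (trace_dens_ge R k0 sp hn xsE sh n1g Fsh _ big); rewrite im ms.
clearbody a b.
have [a0 a1] : 0 <= a /\ a <= 1 by apply/andP.
pose q : R := (p - m)%:R / N'.
have qN : q * N' = (p - m)%:R by rewrite /q divfK // gt_eqF.
have q01 : 0 <= q <= 1.
  by rewrite /q divr_ge0 ?ler0n // ler_pdivrMr // mul1r /N' ler_nat leq_sub2r // ltnW.
have pN : N' - q * N' = (h - p)%:R.
  by rewrite qN /N' -natrB ?leq_sub2r ?(ltnW ph) //; congr (_%:R); clear - mp ph; lia.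
clearbody q.
pose c : R := C' / C; have cC : c * C = C' by rewrite /c divfK // gt_eqF.
have c0 : 0 <= c by rewrite /c divr_ge0 ?ltW.
have V0S : 0 <= V <= S by rewrite /V /S ler0n ler_nat leq_subr.
have [V0 VS] : 0 <= V /\ V <= S by apply/andP.
have SK : S <= S * K by rewrite -{1}[S]mulr1 ler_pM2l.
have KS : 1000 * K <= S * K by rewrite ler_pM2r //; lra_from S1.
have cle : c <= 1 + 1 / S.
  have NK : 0 < N' - K by rewrite N'E; lra_from Mg V0 KS K1.
  have e1 : N' * C = (N' - K) * C'.
    have := mul_bin_down (h - m) k => /(congr1 (fun m => m%:R : R)).
    by rewrite -subnS !natrM (natrB _ kN').
  rewrite -(ler_pM2r C0) cC -(ler_pM2l NK) -e1 mulrA ler_pM2r //.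
  rewrite -(ler_pM2r S0); have -> : (N' - K) * (1 + 1 / S) * S = (N' - K) * (S + 1).
    by field; rewrite gt_eqF.
  by rewrite N'E; lra_from Mg V0 KS K1.
apply/negPn/negP; rewrite -ltnNge => bad.
pose Fm := F :&: draws (iv n m.+1 h) k.+1; pose f : R := #|Fm|%:R / C.
have fC : f * C = #|Fm|%:R by rewrite /f divfK // gt_eqF.
pose ga : R := ('C(h - m.+1, k.+1)%:R - 'C(h - s, k.+1)%:R) / C.
have gaC : ga * C = 'C(h - m.+1, k.+1)%:R - 'C(h - s, k.+1)%:R by rewrite /ga divfK // gt_eqF.
have famC : (#|fam F m.+1 h k i| <= 'C(h - m.+1, k))%N by apply: card_fam_le.
have lv : ('C(h - m.+1, k.+1) + (m.+1 - i) * ('C(h - m.+1, k) - #|fam F m.+1 h k i|) <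
    'C(h - s, k.+1) + #|Fm|)%N.
  have sumge : ((m.+1 - i) * ('C(h - m.+1, k) - #|fam F m.+1 h k i|) <=
      \sum_(x in iv n 0 m.+1) ('C(h - m.+1, k) - #|fam F m.+1 h k x|))%N.
    rewrite -{1}(card_iv i (leq_trans mh hn)) -sum_nat_const.
    rewrite big_mkcond [leqRHS]big_mkcond; apply: leq_sum => x _; rewrite !inE /=.
    case: (leqP i x) => //= ix; case: ifP => // _.
    exact/leq_sub2l/subset_leq_card/fam_sub.
  have := @level_count n F m.+1 h k (introT andP (conj mh hn)) FD.
  rewrite -/Fm; move: sumge bad.
  move: (\sum_(_ in _) _)%N ((_ - i) * _)%N ('C(h - m.+1, k.+1)) ('C(h, k.+1)) #|Fm| #|F| ('C(h - s, k.+1)).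
  by clear; lia.
have Hlev : (S + 1 - V - i%:R) * (1 - a) + ga < f.
  have e : ((S + 1 - V - i%:R) * (1 - a) + ga) * C = (m%:R + 1 - i%:R) * (C - a * C) + ga * C.
    by rewrite VE; ring.
  rewrite -(ltr_pM2r C0) fC e aC gaC.
  move: lv; rewrite -(ltr_nat R) !natrD natrM (natrB _ (ltnW im)) (natrB _ famC) -(natr1 m) -/C.
  by clear; lra.
have Hf : (K + 1) * f <= (M + V) * (q * a + (1 - q) * (b * c)).
  rewrite -N'E -(ler_pM2r C0) -mulrA fC.
  have -> : N' * (q * a + (1 - q) * (b * c)) * C = q * N' * (a * C) + (N' - q * N') * (b * (c * C)) by ring.
  rewrite cC bC aC pN qN.
  have := @empty_trace_split n F m h k i p Fsh im (introT andP (conj mp ph)) hn.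
  by rewrite -(ler_nat R) natrD !natrM -(natr1 k).
have Hf' : f <= S * a.
  rewrite -(ler_pM2r C0) fC -mulrA aC /S -natrM ler_nat.
  exact: empty_trace_bound.
have Hb : (V + 1 + U0%:R) * q + T%:R * b <= V + 1 + E.
  have N'n : (0 < h - m)%N by rewrite subn_gt0.
  have [_ fl] := @floorR R ((s.+1 - m + U0) * (p - m)) (h - m) N'n.
  move: ple fl; rewrite /pos ltnNge mp /= natrD !natrM natrD (subSn ms') -(natr1 (s - m)) -/V -/N' -qN mulrA ltr_pM2r //.
  by rewrite /E VE; clear; lra.
have iR : i%:R <= m%:R :> R by rewrite ler_nat -ltnS.
(* The link of [i] has density at least 13/132, so at least about 29/20 * 13/132 > 7/50 of s is
   taken by its blocks. This is the origin of the bound 7/50 on y. *)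
have i86 : i%:R <= 43 / 50 * S.
  have h1 : (tauf w * S - 2) * a <= T%:R * a by rewrite ler_wpM2r.
  have h2 : (tauf w * S - 2) * (13 / 132) <= (tauf w * S - 2) * a.
    by rewrite ler_wpM2l //; rewrite /tauf; lra_from wS0 S1.
  have h3 : (29 / 20 * S - 2) * (13 / 132) <= (tauf w * S - 2) * (13 / 132).
    by rewrite /tauf; lra_from wS0.
  by lra_from h1 h2 h3 Ai ES S1.
apply: (@trace_contra R S K V M U0%:R T%:R i%:R q a b c f E ga) => //.
- by lra_from S1.
- by lra_from Ml.
- by rewrite VE; lra_from iR.
- by rewrite -N'E ltW.
- have := @gain_bound R k (h - s) (s - m) s k0 sp (leq_subr _ _) n1g n1l.
  by rewrite -N1E.
Qed.

(** * The matching bound for n >= (33/20)sk - (13/20)s *)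

(** At level s + 1, the members avoiding [0, s] number at most s times the link of s, exactly the
    surplus term in [small_trace]. The loss left over is one full link, which Pascal's rule adds to
    'C(h - s - 1, k + 1). *)
Lemma matching_bound_small (R : realFieldType) n (F : {set {set 'I_n}}) s h k (xs : 'I_n) :
  (0 < k)%N -> (h <= n)%N -> xs = s :> nat -> (s < h)%N ->
  (33 * s * k <= 20 * (h - s))%N -> (20 * (h - s) < 33 * s * k + 20)%N ->
  F \subset draws (iv n 0 h) k.+1 -> shifted 0 F -> nomatch s F -> (1600 <= s)%N ->
  (4 * #|fam F s.+1 h k xs| <= 'C(h - s.+1, k))%N ->
  (#|F| + 'C(h - s, k.+1) <= 'C(h, k.+1))%N.
Proof.
move=> k0 hn xsE sh n1g n1l FD Fsh Fs s0 small.
pose T := ((h - s.+1) %/ k)%N; pose S : R := s%:R; pose K : R := k%:R.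
have S0 : 1600 <= S by rewrite (ler_nat R 1600).
have K1 : 1 <= K by rewrite ler1n.
have Kp : 0 < K by apply: lt_le_trans K1.
have NE : (h - s = (h - s.+1).+1)%N by rewrite subnSK.
have ME : (h - s)%:R = (h - s.+1)%:R + 1 :> R by rewrite NE natr1.
have Mg : 33 * S * K <= 20 * (h - s)%:R by move: n1g; rewrite -(ler_nat R) !natrM.
have Ml : 20 * (h - s)%:R < 33 * S * K + 20 by move: n1l; rewrite -(ltr_nat R) natrD !natrM.
have [Tl Tg] := @floorR R (h - s.+1) k k0; rewrite -/T -/K in Tl Tg.
have T1 : 33 / 20 * S - 3 <= T%:R :> R.
  by rewrite -(ler_pM2r Kp); lra_from Tg ME Mg K1.
have T2 : T%:R <= 33 / 20 * S :> R.
  by rewrite -(ler_pM2r Kp); lra_from Tl ME Ml.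
have T3 : (1 < T)%N by rewrite -(ltr_nat R); lra_from T1 S0.
have Tk : (T * k <= h - s.+1)%N by apply: leq_divM.
have key := @small_trace R n F s h k T xs k0 hn xsE T3 Tk Fsh Fs T1 T2 s0 small.
have xs1 : (xs < s.+1)%N by rewrite xsE.
have e0 := @empty_trace_bound n F s s.+1 h k xs Fsh Fs xs1.
have lv := @level_count n F s.+1 h k (introT andP (conj sh hn)) FD.
have sumE : (\sum_(i in iv n 0 s.+1) ('C(h - s.+1, k) - #|fam F s.+1 h k i|) +
    \sum_(i in iv n 0 s.+1) #|fam F s.+1 h k i| = s.+1 * 'C(h - s.+1, k))%N.
  rewrite -big_split /= (eq_bigr (fun=> 'C(h - s.+1, k))) => [|i _]; last first.
    by rewrite subnK // card_fam_le.
  by rewrite sum_nat_const card_iv ?subn0 // (leq_trans sh hn).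
rewrite NE binS; move: key e0 lv sumE; rewrite mulSn.
move: (\sum_(_ in _) _)%N (\sum_(_ in _) _)%N (s * #|fam _ _ _ _ xs|)%N (s * 'C(_, _))%N.
move: #|F :&: _| 'C(h - s.+1, k.+1) 'C(h - s.+1, k) 'C(h, k.+1) #|F|.
by clear; lia.
Qed.

(** As long as the hypothesis survives at h - 1, the sets with and without the last point are
    treated by induction and Pascal's rule adds the bounds. Otherwise 20 (h - s) exceeds 33 s (k -
    1) by less than 20, the case settled by the two estimates for the link of s. *)
Lemma shifted_matching_bound (R : realFieldType) n s h k (F : {set {set 'I_n}}) :
  1000 ^+ 5 <= s%:R :> R -> (0 < k)%N -> (h <= n)%N ->
  (33 * s * k <= 20 * h + 13 * s)%N ->
  F \subset draws (iv n 0 h) k -> shifted 0 F -> nomatch s F ->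
  (#|F| + 'C(h - s, k) <= 'C(h, k))%N.
Proof.
move=> s_big; have S1 : 1600 <= s%:R :> R by apply: le_trans s_big; rewrite !exprS; lra.
have s0 : (1600 <= s)%N by rewrite -(ler_nat R).
elim: h k F => [|h IH] [//|k] F _ hn hyp Fd Fsh Fs.
  by exfalso; move: hyp; rewrite mulnS; clear - s0; lia.
have sh : (s <= h.+1)%N by move: hyp; rewrite mulnS; clear; lia.
case: k Fd hyp => [|k] Fd hyp.
  by rewrite !bin1 addnC -leq_subRL ?leq_subr // subKn // (singletons_le Fd Fs).
have hyp' : (33 * s * k.+1 + 20 * s <= 20 * h.+1)%N by move: hyp; rewrite mulnS; clear; lia.
have sk : (33 * s <= 33 * s * k.+1)%N by rewrite leq_pmulr.
pose t : 'I_n := Ordinal hn.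
have [le|gt] := leqP (33 * s * k.+2) (20 * h + 13 * s).
  have tE : t = h :> nat by [].
  have big : (k.+2 * s.+1 <= h.+1 - 0)%N.
    have h1 : (k.+2 * 20 <= k.+2 * s)%N by rewrite leq_mul2l /=; lia.
    by move: le sk; rewrite subn0 !mulnS [(k.+2 * s)%N]mulnC !mulnS; move: h1; rewrite [(k.+2 * s)%N]mulnC !mulnS mulnC !mulnS -!mulnA; move: (s * k)%N; lia.
  have Ls := link_nomatch tE Fd Fsh Fs big.
  have As : nomatch s (avoid t F) by apply: nomatch_sub Fs; apply/subsetP => A; rewrite inE => /andP[].
  have hs : (s <= h)%N by move: hyp' sk; clear - s0; lia.
  have h1 := IH k.+2 _ isT (ltnW hn) le (avoid_draws tE Fd) (avoid_shifted tE Fd Fsh) As.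
  have le' : (33 * s * k.+1 <= 20 * h + 13 * s)%N by apply: leq_trans le; rewrite leq_mul2l leqnSn orbT.
  have h2 := IH k.+1 _ isT (ltnW hn) le' (link_draws tE Fd) (link_shifted tE Fd Fsh) Ls.
  rewrite (card_avoid_link t) subSn // !binS.
  by rewrite addnACA leq_add.
have sh' : (s < h.+1)%N by move: hyp' sk; clear - s0; lia.
pose xs : 'I_n := Ordinal (leq_trans sh' hn).
have n1g : (33 * s * k.+1 <= 20 * (h.+1 - s))%N by move: hyp'; clear - sh; lia.
have n1l : (20 * (h.+1 - s) < 33 * s * k.+1 + 20)%N by move: gt; rewrite mulnS; clear - sh; lia.
have [small|big] := leqP (4 * #|fam F s.+1 h.+1 k.+1 xs|) 'C(h.+1 - s.+1, k.+1).
  by apply: (@matching_bound_small R n F s h.+1 k.+1 xs).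
by apply: (@large_trace R n F s h.+1 k.+1 xs) => //; apply: ltnW.
Qed.

Lemma nomatch_imset (T U : finType) (g : T -> U) s (F : {set {set T}}) :
  injective g -> set0 \notin F -> nomatch s F -> nomatch s [set g @: (A : {set T}) | A in F].
Proof.
move=> ginj F0 Fs M MF tM; rewrite -(card_sig (mem M)).
have pre (B : {set U}) : B \in M -> (g @^-1: B \in F) /\ (exists x, x \in g @^-1: B).
  move=> /(subsetP MF)/imsetP[A AF ->].
  have -> : g @^-1: (g @: A) = A by apply/setP => x; rewrite inE mem_imset.
  by split=> //; apply/set0Pn; apply: contraNneq F0 => <-.
apply: (nomatch_fun (f := fun B : {B | B \in M} => g @^-1: val B) Fs).
- by case=> B BM; case: (pre B BM).
- by case=> B BM; apply/set0Pn; case: (pre B BM).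
- move=> [B BM] [C CM]; rewrite -val_eqE /= => BC.
  have dBC := trivIsetP tM _ _ BM CM BC.
  rewrite -setI_eq0 -preimsetI; move: dBC; rewrite -setI_eq0 => /eqP ->.
  by rewrite preimset0.
Qed.

Lemma matching_bound (R : realFieldType) (X : finType) s k (F : {set {set X}}) :
  1000 ^+ 5 <= s%:R :> R -> (0 < k)%N ->
  (33 * s * k <= 20 * #|X| + 13 * s)%N ->
  F \subset draws [set: X] k -> nomatch s F ->
  (#|F| + 'C(#|X| - s, k) <= 'C(#|X|, k))%N.
Proof.
move=> s_big k0 hyp Fd Fs.
have F0 : set0 \notin F.
  by apply/negP => /(subsetP Fd)/drawsP[_]; rewrite cards0 => k00; rewrite -k00 in k0.
pose F1 := [set (@enum_rank X) @: (A : {set X}) | A in F].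
have F1s : nomatch s F1 := nomatch_imset (@enum_rank_inj X) F0 Fs.
have F1k : F1 \subset ksets #|X| k.
  apply/subsetP => _ /imsetP[A /(subsetP Fd)/drawsP[_ cA] ->].
  by rewrite inE card_imset ?cA //; apply: enum_rank_inj.
have [F2 [F2k F2s cF2 F2sh]] := exists_shifted k0 F1k F1s.
have <- : #|F2| = #|F|.
  by rewrite cF2 card_imset //; apply/imset_inj/enum_rank_inj.
apply: (shifted_matching_bound s_big k0 (leqnn _) hyp _ F2sh F2s).
by apply/subsetP => A /(subsetP F2k); rewrite !inE iv_all subsetT.
Qed.

(** * Decreasing n *)

Definition misses (R : realFieldType) (N k s : nat) (x : R) : Prop :=
  forall (X : finType) (F : {set {set X}}), #|X| = N -> F \subset draws [set: X] k ->
    nomatch s F -> #|F|%:R <= (1 - x) * 'C(N, k)%:R.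

Lemma nomatch_pull (T : finType) s k (B : {set T}) (F : {set {set T}}) :
  (0 < k)%N -> F \subset draws [set: T] k -> nomatch s.+1 F -> B \in F ->
  nomatch s (pull (~: B) F).
Proof.
move=> k0 Fd Fs BF M MF tM; rewrite -ltnS -(card_sig (mem M)) -card_option.
have ne (A : {set T}) : A \in F -> A != set0.
  move=> /(subsetP Fd)/drawsP[_ cA]; apply: contraTneq k0 => A0.
  by rewrite -cA A0 cards0.
have FM (A : {set {x | x \in ~: B}}) : A \in M -> val @: A \in F.
  by move=> /(subsetP MF); rewrite inE.
have dB (A : {set {x | x \in ~: B}}) : [disjoint B & val @: A].
  rewrite disjoint_sym disjoints_subset; apply/subsetP => _ /imsetP[x _ ->].
  exact: valP.
pose f (o : option {A | A \in M}) : {set T} := if o is Some A then val @: val A else B.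
apply: (nomatch_fun (f := f) Fs).
- by case=> [[A AM]|] //=; apply: FM.
- by case=> [[A AM]|] /=; apply: ne => //; apply: FM.
- case=> [[A AM]|] [[A' AM']|] //= ne'; last by rewrite disjoint_sym.
  by apply: imset_val_disjoint; apply: (trivIsetP tM).
Qed.

(* The number of members of F in a uniformly random (t + 1)-tuple of disjoint
   k-sets has nonnegative variance; given B in F, the members of F disjoint from
   B have no s + 1 disjoint members. *)
Lemma misses_step (R : realFieldType) N k s t (x : R) :
  (0 < k)%N -> (0 < t)%N -> (t * k <= N)%N -> x <= 1 ->
  misses N k s x -> misses (N + k) k s.+1 (x * (t%:R / (t%:R + 1))).
Proof.
move=> k0 t0 tN x1 Q X F cX Fd Fs.
pose bl := @blocks X 0 k t.+1.
have TX : (t.+1 * k <= #|X|)%N by rewrite cX mulSn addnC leq_add2r.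
have cbl a : #|bl a| = k by apply: card_blocks; rewrite add0n.
have dbl a a' : a != a' -> [disjoint bl a & bl a'] by apply: blocks_disjoint.
have kX : (k <= #|X|)%N by rewrite cX leq_addl.
have kN : (k <= N)%N by apply: leq_trans tN; rewrite leq_pmull.
set C : R := 'C(N + k, k)%:R; set D : R := 'C(N, k)%:R.
have C0 : 0 < C by rewrite ltr0n bin_gt0 leq_addl.
have D0 : 0 < D by rewrite ltr0n bin_gt0.
pose f : R := #|F|%:R / C; pose q : R := #|disjoint_pairs F|%:R / (C * D).
pose tR : R := t%:R.
have tR1 : 1 <= tR by rewrite ler1n.
have f0 : 0 <= f by rewrite divr_ge0 ?ler0n.
have var : 0 <= f + tR * q - (tR + 1) * f ^+ 2.
  have := block_variance R cbl dbl kX Fd; rewrite cX addnK -/C -/D -/f -/q -natr1 -/tR => e.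
  have : 0 <= #|{perm X}|%:R * ((tR + 1) * f + (tR + 1) * (tR + 1 - 1) * q - ((tR + 1) * f) ^+ 2).
    by rewrite -e; apply: sumr_ge0 => p _; apply: sqr_ge0.
  have Mperm : (0 : R) < #|{perm X}|%:R by rewrite ltr0n; apply/card_gt0P; exists 1%g.
  rewrite pmulr_rge0 //.
  have -> : (tR + 1) * f + (tR + 1) * (tR + 1 - 1) * q - ((tR + 1) * f) ^+ 2 =
    (tR + 1) * (f + tR * q - (tR + 1) * f ^+ 2) by ring.
  by rewrite pmulr_rge0 //; lra_from tR1.
have qle : q <= f * (1 - x).
  have step B : B \in F -> #|[set A in F | [disjoint B & A]]|%:R <= (1 - x) * D.
    move=> BF; have [_ cB] := drawsP (subsetP Fd _ BF).
    have cY : #|{: {y | y \in ~: B}}| = N.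
      by rewrite card_sig cardsCs setCK cX cB addnK.
    have GD : [set A in F | [disjoint B & A]] \subset draws (~: B) k.
      apply/subsetP => A; rewrite inE => /andP[AF dBA]; have [_ cA] := drawsP (subsetP Fd _ AF).
      by rewrite inE cA eqxx andbT -disjoints_subset disjoint_sym.
    rewrite -(card_pull GD); apply: Q; rewrite ?cY //; first exact: pull_draws.
    apply: nomatch_sub (nomatch_pull k0 Fd Fs BF); apply/subsetP => A.
    by rewrite [A \in _]inE inE => /andP[AF _]; rewrite inE.
  rewrite /q ler_pdivrMr ?mulr_gt0 //.
  have -> : f * (1 - x) * (C * D) = #|F|%:R * ((1 - x) * D).
    by rewrite /f; field; rewrite gt_eqF.
  have -> : #|disjoint_pairs F| = (\sum_(B in F) #|[set A in F | [disjoint B & A]]|)%N.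
    rewrite -(card_dep F (fun B => [set A in F | [disjoint B & A]])); apply: eq_card => -[B A].
    by rewrite !inE /= ?andbA.
  rewrite natr_sum -[#|F|]sum1_card natr_sum mulr_suml; apply: ler_sum => B BF.
  by rewrite mul1r; apply: step.
have -> : #|F|%:R = f * C by rewrite /f divfK // gt_eqF.
rewrite ler_pM2r //.
have t1 : 0 < tR + 1 by lra_from tR1.
have tt : tR / (tR + 1) * (tR + 1) = tR by rewrite divfK // gt_eqF.
rewrite -/tR -(ler_pM2r t1).
have -> : (1 - x * (tR / (tR + 1))) * (tR + 1) = tR + 1 - x * (tR / (tR + 1) * (tR + 1)) by ring.
rewrite tt; have [->|fn0] := eqVneq f 0.
  have h : x * tR <= 1 * tR by rewrite ler_wpM2r //; lra_from tR1.
  by rewrite mul0r; lra_from h.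
have fp : 0 < f by rewrite lt_neqAle eq_sym fn0.
rewrite -(ler_pM2l fp).
have h : tR * q <= tR * (f * (1 - x)) by rewrite ler_wpM2l //; lra_from tR1.
have -> : f * (f * (tR + 1)) = (tR + 1) * f ^+ 2 by ring.
by lra_from h var.
Qed.

(** At each step one more block fits, so the factors t / (t + 1), (t + 1) / (t + 2), ...
    telescope. *)
Lemma misses_iter (R : realFieldType) N k s t r (x : R) :
  (0 < k)%N -> (0 < t)%N -> (t * k <= N)%N -> 0 <= x <= 1 ->
  misses N k s x -> misses (N + r * k) k (s + r) (x * (t%:R / (t%:R + r%:R))).
Proof.
move=> k0 t0 tN /andP[x0 x1] Q.
have t1 : 0 < t%:R :> R by rewrite ltr0n.
elim: r => [|r IH].
  by rewrite mul0n !addn0 addr0 divff ?mulr1 // gt_eqF.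
rewrite mulSn addnCA addnC addnS.
have r0 : 0 <= r%:R :> R by rewrite ler0n.
have tr : 0 < t%:R + r%:R :> R by rewrite ltr_pwDl.
have -> : x * (t%:R / (t%:R + r.+1%:R)) =
    x * (t%:R / (t%:R + r%:R)) * ((t + r)%:R / ((t + r)%:R + 1)).
  rewrite natrD -(natr1 r); field.
  by rewrite !gt_eqF ?addrA // ltr_pwDl.
apply: misses_step => //.
- by rewrite addn_gt0 t0.
- by rewrite mulnDl leq_add2r.
- have y0 : 0 <= t%:R / (t%:R + r%:R) :> R by rewrite divr_ge0 // ltW.
  have y1 : t%:R / (t%:R + r%:R) <= 1 :> R by rewrite ler_pdivrMr // mul1r lerDl.
  exact: mulr_ile1.
Qed.

(** Both pairs share D = n - s k. Factor by factor, (n - s - j) / (n - j) has the form (s e + u) /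
    (s (e + 1) + u) with e = k - 1 and u = D - j >= 0, which decreases in s. *)
Lemma bin_cross n s n' s' k :
  (s' <= s)%N -> (s * k <= n)%N -> (s' * k <= n')%N -> (n' - s' * k = n - s * k)%N ->
  (k.-1 <= n - s * k)%N ->
  ('C(n - s, k) * 'C(n', k) <= 'C(n' - s', k) * 'C(n, k))%N.
Proof.
move=> ss sn sn' DE kD.
have nE : n = (s * k + (n - s * k))%N by rewrite subnKC.
have nE' : n' = (s' * k + (n - s * k))%N by rewrite -DE subnKC.
suff H j : (j <= k)%N -> ('C(n - s, j) * 'C(n', j) <= 'C(n' - s', j) * 'C(n, j))%N by apply: H.
elim: j => [|j IH] jk; first by rewrite !bin0.
have jD : (j <= n - s * k)%N by apply: leq_trans kD; rewrite -ltnS prednK // (leq_ltn_trans _ jk).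
have st : ((n - s - j) * (n' - j) <= (n' - s' - j) * (n - j))%N.
  move: nE nE' jD jk; move: (n - s * k)%N => D -> -> jD jk.
  have [d ->] : exists d, s = (s' + d)%N by exists (s - s')%N; rewrite subnKC.
  have [e ->] : exists e, k = e.+1 by case: (k) jk => // e; exists e.
  have [u ->] : exists u, D = (j + u)%N by exists (D - j)%N; rewrite subnKC.
  have -> : ((s' + d) * e.+1 + (j + u) - (s' + d) - j = (s' + d) * e + u)%N by rewrite mulnS; lia.
  have -> : (s' * e.+1 + (j + u) - s' - j = s' * e + u)%N by rewrite mulnS; lia.
  have -> : (s' * e.+1 + (j + u) - j = s' * e.+1 + u)%N by lia.
  have -> : ((s' + d) * e.+1 + (j + u) - j = (s' + d) * e.+1 + u)%N by lia.
  rewrite !mulnS !mulnDl !mulnDr; clear; nia.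
rewrite -(leq_pmul2l (ltn0Sn j)) -(leq_pmul2l (ltn0Sn j)).
have -> : (j.+1 * (j.+1 * ('C(n - s, j.+1) * 'C(n', j.+1))) =
    (j.+1 * 'C(n - s, j.+1)) * (j.+1 * 'C(n', j.+1)))%N by rewrite mulnACA !mulnA.
have -> : (j.+1 * (j.+1 * ('C(n' - s', j.+1) * 'C(n, j.+1))) =
    (j.+1 * 'C(n' - s', j.+1)) * (j.+1 * 'C(n, j.+1)))%N by rewrite mulnACA !mulnA.
rewrite !mul_bin_left ![((_ - _) * 'C(_, _) * _)%N]mulnACA.
exact: leq_mul st (IH (ltnW jk)).
Qed.

Lemma coef_bounds (R : realFieldType) (gamma K : R) : 1 < gamma -> gamma <= 5 / 3 -> 1 <= K ->
  let c := (gamma - 1) / 2 * ((5 * K - 2) / (gamma * K - (gamma - 1))) in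
  [/\ 0 <= c, c <= 1 & c * (gamma * K - (gamma - 1)) = (gamma - 1) / 2 * (5 * K - 2)].
Proof.
move=> g1 g2 K1 c.
have gK : gamma <= gamma * K by rewrite -{1}[gamma]mulr1 ler_pM2l //; lra_from g1.
have den : 0 < gamma * K - (gamma - 1) by lra_from gK.
have cden : c * (gamma * K - (gamma - 1)) = (gamma - 1) / 2 * (5 * K - 2).
  by rewrite /c -mulrA divfK // gt_eqF.
have eK : (gamma - 1) * K <= 2 / 3 * K by rewrite ler_wpM2r //; [lra_from K1 | lra_from g2].
have e0 : 0 <= (gamma - 1) * (5 * K - 2) by rewrite mulr_ge0 //; [lra_from g1 | lra_from K1].
clearbody c; split=> //.
  by rewrite -(pmulr_lge0 _ den) cden; lra_from e0.
by rewrite -(ler_pM2r den) cden mul1r; lra_from eK K1.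
Qed.

Lemma misses_base (R : realFieldType) n k s :
  1000 ^+ 5 <= s%:R :> R -> (0 < k)%N -> (k <= n)%N -> (33 * s * k <= 20 * n + 13 * s)%N ->
  misses n k s ('C(n - s, k)%:R / 'C(n, k)%:R : R).
Proof.
move=> s_big k0 kn hyp X F cX Fd Fs.
have C0 : (0 : R) < 'C(n, k)%:R by rewrite ltr0n bin_gt0.
have := @matching_bound R X s k F s_big k0 _ Fd Fs; rewrite cX => /(_ hyp).
rewrite -(ler_nat R) natrD mulrBl mul1r divfK ?gt_eqF // => h.
by lra_from h.
Qed.

Lemma family_bound (R : realFieldType) (gamma : R) n k s (F : {set {set 'I_n}}) :
  1 < gamma -> gamma <= 5 / 3 -> 2 * 1000 ^+ 5 <= (gamma - 1) * s%:R -> (0 < k)%N ->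
  gamma * s%:R * k%:R - (gamma - 1) * s%:R <= n%:R ->
  F \subset ksets n k -> nomatch s F ->
  #|F|%:R <= 'C(n, k)%:R
        - (gamma - 1) / 2 * ((5 * k%:R - 2) / (gamma * k%:R - (gamma - 1))) * 'C(n - s, k)%:R.
Proof.
move=> g1 g2 s_big k0 hn Fk Fs.
set S : R := s%:R in s_big hn *; set K : R := k%:R in hn *; set e := gamma - 1 in s_big hn *.
have K1 : 1 <= K by rewrite ler1n.
have [c0 c1 cden] := coef_bounds g1 g2 K1; rewrite -/e in c0 c1 cden.
set c := e / 2 * _ in c0 c1 cden *; clearbody c.
have S0 : 0 <= S by rewrite ler0n.
have e0 : 0 < e by rewrite subr_gt0.
have eS : e * S <= 1 * S by rewrite ler_wpM2r // /e; lra_from g2.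
have big0 : 1 <= 1000 ^+ 5 :> R by rewrite !exprS; clear; lra.
have bigN : 52 <= 1000 ^+ 5 :> R by rewrite !exprS; clear; lra.
have Sb : 1000 ^+ 5 <= S by lra_from s_big eS big0.
have Fd : F \subset draws [set: 'I_n] k.
  by apply/subsetP => A /(subsetP Fk); rewrite !inE subsetT.
have gE : gamma = e + 1 by rewrite /e subrK.
have hn' : S * K + e * S * (K - 1) <= n%:R by move: hn; rewrite gE; lra_from S0.
have eSK : 0 <= e * S * (K - 1).
  by apply: mulr_ge0; [apply: mulr_ge0 => //; exact: ltW | rewrite subr_ge0].
have skn : (s * k <= n)%N by rewrite -(ler_nat R) natrM -/S -/K; lra_from hn' eSK.
have Cle (a : nat) : c * 'C(a, k)%:R <= 'C(a, k)%:R by rewrite ler_piMl ?ler0n.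
(* k = 1 is treated directly, since the choice of [s'] divides by k - 1. *)
case: (ltnP 1 k) => [k2|k1]; last first.
  have kE : k = 1%N by apply/eqP; rewrite eqn_leq k1 k0.
  have Fle : #|F|%:R <= S by rewrite ler_nat; apply: (@singletons_le _ s setT) => //; rewrite -kE.
  have sn : (s <= n)%N by move: skn; rewrite kE muln1.
  have := Cle (n - s)%N; rewrite kE !bin1 natrB // -/S => h.
  by lra_from h Fle.
have [leA|gtB] := leqP (33 * s * k) (20 * n + 13 * s).
  have := @matching_bound R 'I_n s k F Sb k0; rewrite card_ord => /(_ leA Fd Fs).
  rewrite -(ler_nat R) natrD => h; have := Cle (n - s)%N => h2.
  by lra_from h h2.
pose D := (n - s * k)%N; have DE : D%:R = n%:R - S * K by rewrite /D natrB // natrM.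
have Dge : e * S * (K - 1) <= D%:R by rewrite DE; lra_from hn'.
have kap0 : (0 < k.-1)%N by rewrite -ltnS prednK.
have kapE : (k.-1)%:R = K - 1 by rewrite -subn1 natrB.
have kap : 0 < K - 1 by rewrite -kapE ltr0n.
have nE : (n = D + s * k)%N by rewrite /D subnK.
(* The largest [s'] with D >= 13/20 s' (k - 1), which is the hypothesis of [matching_bound] for n' =
   D + s' k. *)
pose s' := ((20 * D) %/ (13 * k.-1))%N.
have kk : k = k.-1.+1 by rewrite prednK.
have ss : (s' < s)%N.
  have p0 : (0 < 13 * k.-1)%N by rewrite muln_gt0.
  rewrite /s' ltn_divLR //; move: gtB; rewrite nE {1 2}kk !mulnS.
  by rewrite (mulnCA s 13) -mulnA; move: (s * k.-1)%N => x; clear; lia.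
have p13 : (0 < 13 * k.-1)%N by rewrite muln_gt0.
have [s'l s'g] := @floorR R (20 * D) (13 * k.-1) p13.
rewrite -/s' !natrM kapE in s'l s'g.
pose S' : R := s'%:R; rewrite -/S' in s'l s'g.
have S'g : 20 / 13 * (e * S) <= S' + 1.
  by rewrite -(ler_pM2r kap); lra_from s'g Dge.
have S'b : 1000 ^+ 5 <= S' by lra_from S'g s_big big0.
have s'0 : (0 < s')%N by rewrite -(ltr_nat R) -/S'; lra_from S'b big0.
pose n' := (D + s' * k)%N; pose r := (s - s')%N.
have sE : (s = s' + r)%N by rewrite /r subnKC // ltnW.
have nE' : (n = n' + r * k)%N by rewrite nE sE mulnDl addnA.
have hyp' : (33 * s' * k <= 20 * n' + 13 * s')%N.
  have : (s' * (13 * k.-1) <= 20 * D)%N by apply: leq_divM.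
  rewrite /n' {2 3}kk !mulnS (mulnCA s' 13) -mulnA.
  by move: (s' * k.-1)%N => x; clear; lia.
have kn' : (k <= n')%N by apply: leq_trans (leq_addl _ _); rewrite leq_pmull.
pose t := (n' %/ k)%N.
have t0 : (0 < t)%N by rewrite divn_gt0.
have tk : (t * k <= n')%N by apply: leq_divM.
have Cn' : (0 : R) < 'C(n', k)%:R by rewrite ltr0n bin_gt0.
pose x : R := 'C(n' - s', k)%:R / 'C(n', k)%:R.
have x0 : 0 <= x by rewrite divr_ge0 ?ler0n.
have x01 : 0 <= x <= 1.
  by rewrite x0 ler_pdivrMr // mul1r ler_nat leq_bin2l // leq_subr.
have base := @misses_base R n' k s' S'b k0 kn' hyp'.
have := @misses_iter R n' k s' t r x k0 t0 tk x01 base.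
rewrite -nE' -sE => /(_ 'I_n F (card_ord n) Fd Fs).
set y := t%:R / _ => Fy.
have tR : 0 < t%:R :> R by rewrite ltr0n.
have r0 : 0 <= r%:R :> R by rewrite ler0n.
have tr : 0 < t%:R + r%:R :> R by rewrite ltr_pwDl.
have k_pos : 0 < K by lra_from K1.
have cy : c <= y.
  rewrite /y ler_pdivlMr // -(ler_pM2r k_pos).
  have [_ tg] := @floorR R n' k k0; rewrite -/t -/K in tg.
  have n'R : n'%:R = D%:R + S' * K by rewrite /n' natrD natrM.
  have nR : n%:R = n'%:R + r%:R * K by rewrite nE' natrD natrM.
  (* The margin is (20/13 - 3/2) e S K = e S K / 26 >= 2 K: one K for the integer part in [s'], one
     for that in [t]. *)
  have main : c * n%:R <= n'%:R - K.
    have h1 : 0 <= (1 - c) * (D%:R - e * S * (K - 1)) by rewrite mulr_ge0 ?subr_ge0.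
    have h2 : (20 / 13 * (e * S)) * K <= (S' + 1) * K by rewrite ler_pM2r.
    have h3 : 52 * K <= e * S * K by rewrite ler_pM2r //; lra_from s_big bigN.
    have h4 : c * (e * S * (K - 1)) + c * (S * K) = S * (e / 2 * (5 * K - 2)).
      by rewrite -cden gE; ring.
    have h5 : c * n%:R = c * D%:R + c * (S * K) by rewrite DE; ring.
    by rewrite h5 n'R; lra_from h1 h2 h3 h4.
  have h6 : 0 <= (1 - c) * ((t%:R + 1) * K - n'%:R) by rewrite mulr_ge0 ?subr_ge0 // ltW.
  have h7 : 0 <= c * K by rewrite mulr_ge0 // ltW.
  by move: main; rewrite nR; lra_from h6 h7.
have Cx : 'C(n - s, k)%:R <= x * 'C(n, k)%:R.
  rewrite /x mulrAC ler_pdivlMr // -!natrM ler_nat.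
  apply: bin_cross => //; first exact: ltnW.
  - by rewrite leq_addl.
  - by rewrite /n' addnK.
  - rewrite -/D -(ler_nat R) kapE; apply: le_trans Dge.
    by rewrite -[leLHS]mul1r ler_pM2r //; lra_from s_big big0.
have h8 : c * 'C(n - s, k)%:R <= c * (x * 'C(n, k)%:R) by rewrite ler_wpM2l.
have h9 : c * (x * 'C(n, k)%:R) <= y * (x * 'C(n, k)%:R).
  by rewrite ler_wpM2r // mulr_ge0 ?ler0n.
by lra_from Fy h8 h9.
Qed.

Theorem theorem2 (R : realType) (gamma : R)
    (gamma_gt1 : 1 < gamma) (gamma_le : gamma <= 5 / 3) :
  exists s0 : nat, forall s : nat, (s0 <= s)%N ->
    forall n k : nat, (0 < n)%N -> (0 < k)%N ->
      gamma * s%:R * k%:R - (gamma - 1) * s%:R <= n%:R ->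
      (max_family n k s)%:R <=
        'C(n, k)%:R
        - (gamma - 1) / 2 * ((5 * k%:R - 2) / (gamma * k%:R - (gamma - 1)))
          * 'C(n - s, k)%:R.
Proof.
have e0 : 0 < gamma - 1 by rewrite subr_gt0.
(* After the reduction [s'] is still at least 20/13 (gamma - 1) s - 1, which has to reach the 1000^5
   required by [matching_bound]. *)
pose x : R := 2 * 1000 ^+ 5 / (gamma - 1).
have x0 : 0 <= x by apply: divr_ge0 (ltW e0); apply: mulr_ge0 => //; apply: exprn_ge0.
exists (Num.bound x) => s hs n k n0 k0 hn.
have s_big : 2 * 1000 ^+ 5 <= (gamma - 1) * s%:R.
  have : x <= s%:R by apply: le_trans (ltW (archi_boundP x0)) _; rewrite ler_nat.
  by rewrite /x ler_pdivrMr // [_%:R * (_ - _)]mulrC.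
have bound F := @family_bound R gamma n k s F gamma_gt1 gamma_le s_big k0 hn.
rewrite /max_family; apply: (big_ind (fun m : nat => m%:R <= _)).
- have := bound set0 (sub0set _); rewrite cards0; apply=> M.
  by rewrite subset0 => /eqP ->; rewrite cards0.
- by move=> a b ha hb; rewrite /maxn; case: ifP.
- by move=> F /andP[Fk /nomatchP Fs]; apply: bound.
Qed.
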